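(* Let $\mathcal{S}$ be a lextensive category and let $\mathbb{G}=\mathrm{Aut}(\mathbf{R},<)$. The functor $$\mathrm{LEx}^{\oplus}(\mathbf{S}(\mathbb{G}),\mathcal{S})\to\mathrm{Ord}(\mathcal{S}),\qquad \Psi\mapsto\Psi(\mathbf{R})$$ is an equivalence of categories.
   Context: $\mathbb{G}$ is the group of order-preserving self-bijections of the real line, topologized so that the pointwise stabilizers of finite subsets of $\mathbf{R}$ form a neighborhood basis of the identity. $\mathbf{S}(\mathbb{G})$ is the category of $\mathbb{G}$-sets with open point stabilizers and finitely many orbits. A category $\mathcal{S}$ is lextensive if it has finite limits and finite coproducts, and for all objects $X,Y$ the functor $\mathcal{S}_{/X}\times\mathcal{S}_{/Y}\to\mathcal{S}_{/(X\amalg Y)}$, $(A,B)\mapsto A\amalg B$, is an equivalence. $\mathbf{S}(\mathbb{G})$ is lextensive. $\mathrm{LEx}^{\oplus}(\mathcal{S}',\mathcal{S})$ is the category of functors $\mathcal{S}'\to\mathcal{S}$ that are additive (preserve finite coproducts) and left-exact (preserve finite limits), with natural transformations as morphisms. A total order on an object $X$ of $\mathcal{S}$ is a subobject $R_X\subset X\times X$ such that (total) the natural map $R_X\amalg\Delta_X\amalg R_X^{\mathrm{op}}\to X\times X$ is an isomorphism, where $\Delta_X$ is the diagonal and $R_X^{\mathrm{op}}$ the image of $R_X$ under the switching map; and (transitive) $R_{12}\cap R_{23}\subset R_{13}$ in $X^3$, where $R_{ij}$ is the inverse image of $R_X$ under the projection $p_{ij}\colon X^3\to X^2$. $\mathrm{Ord}(\mathcal{S})$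 is the category of pairs $(X,R_X)$; morphisms are the monotonic morphisms, i.e. morphisms $f\colon X\to Y$ with $R_X\subset(f\times f)^{-1}(R_Y)$. Additive left-exact functors carry ordered objects to ordered objects; $\mathbf{R}$ is an ordered object of $\mathbf{S}(\mathbb{G})$ via $\{(x,y):x<y\}\subset\mathbf{R}^2$, and $\Psi(\mathbf{R})$ carries the induced order $\Psi(\{x<y\})$. *)

(* Defs.v *)
From Stdlib Require Import Reals Lra List FinFun.
From Stdlib Require Import FunctionalExtensionality ProofIrrelevance ClassicalEpsilon.

Set Implicit Arguments.
Unset Strict Implicit.
Unset Printing Implicit Defensive.

Local Obligation Tactic := idtac.

Declare Scope cat_scope.
Delimit Scope cat_scope with cat.

Lemma sig_eq (A : Type) (P : A -> Prop) (u v : {x : A | P x}) :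
  proj1_sig u = proj1_sig v -> u = v.
Proof.
  destruct u as [x p], v as [y q]; simpl; intros ->.
  now rewrite (proof_irrelevance _ p q).
Qed.

Record Category := {
  Ob :> Type;
  Hom : Ob -> Ob -> Type;
  idm : forall X, Hom X X;
  comp : forall X Y Z, Hom Y Z -> Hom X Y -> Hom X Z;
  comp_id_l : forall X Y (f : Hom X Y), comp (idm Y) f = f;
  comp_id_r : forall X Y (f : Hom X Y), comp f (idm X) = f;
  comp_assoc : forall X Y Z W (h : Hom Z W) (g : Hom Y Z) (f : Hom X Y),
    comp h (comp g f) = comp (comp h g) f
}.
Arguments Hom {c} X Y.
Arguments idm {c} X.
Arguments comp {c X Y Z} g f.

Notation "g ∘ f" := (comp g f) (at level 40, left associativity) : cat_scope.
Local Open Scope cat_scope.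

Definition is_iso (C : Category) (X Y : C) (f : Hom X Y) : Prop :=
  exists g : Hom Y X, g ∘ f = idm X /\ f ∘ g = idm Y.

Definition is_mono (C : Category) (X Y : C) (f : Hom X Y) : Prop :=
  forall (Z : C) (a b : Hom Z X), f ∘ a = f ∘ b -> a = b.

Record Functor (C D : Category) := {
  fob :> C -> D;
  fmap : forall X Y : C, Hom X Y -> Hom (fob X) (fob Y);
  fmap_id : forall X : C, fmap (idm X) = idm (fob X);
  fmap_comp : forall (X Y Z : C) (g : Hom Y Z) (f : Hom X Y),
    fmap (g ∘ f) = fmap g ∘ fmap f
}.
Arguments fmap {C D} F {X Y} f : rename.

Program Definition functor_id (C : Category) : Functor C C :=
  {| fob := fun X => X; fmap := fun X Y f => f |}.
Next Obligation. reflexivity. Qed.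
Next Obligation. reflexivity. Qed.

Program Definition functor_comp (C D E : Category)
    (G : Functor D E) (F : Functor C D) : Functor C E :=
  {| fob := fun X => G (F X); fmap := fun X Y f => fmap G (fmap F f) |}.
Next Obligation. intros; simpl; now rewrite !fmap_id. Qed.
Next Obligation. intros; simpl; now rewrite !fmap_comp. Qed.

Record NatTrans (C D : Category) (F G : Functor C D) := {
  nt :> forall X : C, Hom (F X) (G X);
  nt_natural : forall (X Y : C) (f : Hom X Y), nt Y ∘ fmap F f = fmap G f ∘ nt X
}.

Lemma nat_trans_eq (C D : Category) (F G : Functor C D) (s t : NatTrans F G) :
  (forall X, s X = t X) -> s = t.
Proof.
  destruct s as [s ps], t as [t pt]; simpl; intros H.
  assert (s = t) by (apply functional_extensionality_dep; exact H).
  subst t; now rewrite (proof_irrelevance _ ps pt).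
Qed.

Program Definition nat_id (C D : Category) (F : Functor C D) : NatTrans F F :=
  {| nt := fun X => idm (F X) |}.
Next Obligation. intros; simpl; now rewrite comp_id_l, comp_id_r. Qed.

Program Definition nat_comp (C D : Category) (F G H : Functor C D)
    (t : NatTrans G H) (s : NatTrans F G) : NatTrans F H :=
  {| nt := fun X => t X ∘ s X |}.
Next Obligation.
  intros; simpl.
  now rewrite <- comp_assoc, nt_natural, comp_assoc, nt_natural, comp_assoc.
Qed.

Definition is_equivalence (C D : Category) (F : Functor C D) : Prop :=
  exists G : Functor D C,
    (exists s : NatTrans (functor_id C) (functor_comp G F), forall X, is_iso (s X)) /\
    (exists t : NatTrans (functor_comp F G) (functor_id D), forall Y, is_iso (t Y)).

Program Definition product_category (C D : Category) : Category :=
  {| Ob := (C * D)%type;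
     Hom := fun X Y => (Hom (fst X) (fst Y) * Hom (snd X) (snd Y))%type;
     idm := fun X => (idm (fst X), idm (snd X));
     comp := fun X Y Z g f => (fst g ∘ fst f, snd g ∘ snd f) |}.
Next Obligation. intros C D X Y [f g]; simpl; now rewrite !comp_id_l. Qed.
Next Obligation. intros C D X Y [f g]; simpl; now rewrite !comp_id_r. Qed.
Next Obligation. intros; simpl; now rewrite !comp_assoc. Qed.

Program Definition slice (C : Category) (X : C) : Category :=
  {| Ob := {A : C & Hom A X};
     Hom := fun A B =>
       {h : Hom (projT1 A) (projT1 B) | projT2 B ∘ h = projT2 A};
     idm := fun A => exist _ (idm (projT1 A)) _;
     comp := fun A B D g f => exist _ (proj1_sig g ∘ proj1_sig f) _ |}.
Next Obligation. intros; simpl; apply comp_id_r. Qed.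
Next Obligation.
  intros C X A B D [g Hg] [f Hf]; simpl in *; now rewrite comp_assoc, Hg.
Qed.
Next Obligation. intros; apply sig_eq; simpl; apply comp_id_l. Qed.
Next Obligation. intros; apply sig_eq; simpl; apply comp_id_r. Qed.
Next Obligation. intros; apply sig_eq; simpl; apply comp_assoc. Qed.

Record Cone (J C : Category) (D : Functor J C) := {
  apex : C;
  leg : forall j : J, Hom apex (D j);
  leg_natural : forall (i j : J) (u : Hom i j), fmap D u ∘ leg i = leg j
}.
Arguments leg {J C D} c j : rename.

Definition is_limit (J C : Category) (D : Functor J C) (c : Cone D) : Prop :=
  forall c' : Cone D,
    exists! h : Hom (apex c') (apex c), forall j, leg c j ∘ h = leg c' j.

Program Definition map_cone (J C E : Category) (D : Functor J C) (F : Functor C E)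
    (c : Cone D) : Cone (functor_comp F D) :=
  {| apex := F (apex c); leg := fun j => fmap F (leg c j) |}.
Next Obligation. intros; simpl; now rewrite <- fmap_comp, leg_natural. Qed.

Definition finite_category (J : Category) : Prop :=
  Finite J /\ forall i j : J, Finite (Hom i j).

Class has_finite_limits (C : Category) : Prop :=
  finite_limit_exists : forall J : Category, finite_category J ->
    forall D : Functor J C, exists c : Cone D, is_limit c.

Definition is_coproduct (C : Category) (I : Type) (X : I -> C) (A : C)
    (inj : forall i, Hom (X i) A) : Prop :=
  forall (Z : C) (f : forall i, Hom (X i) Z),
    exists! h : Hom A Z, forall i, h ∘ inj i = f i.

Class has_finite_coproducts (C : Category) : Prop :=
  finite_coproduct_exists : forall I : Type, Finite I -> forall X : I -> C,
    exists (A : C) (inj : forall i, Hom (X i) A), is_coproduct inj.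

Definition left_exact (C D : Category) (F : Functor C D) : Prop :=
  forall J : Category, finite_category J ->
  forall (K : Functor J C) (c : Cone K), is_limit c -> is_limit (map_cone F c).

Definition additive (C D : Category) (F : Functor C D) : Prop :=
  forall I : Type, Finite I ->
  forall (X : I -> C) (A : C) (inj : forall i, Hom (X i) A),
    is_coproduct inj -> is_coproduct (fun i => fmap F (inj i)).

Program Definition LEx (C D : Category) : Category :=
  {| Ob := {F : Functor C D | additive F /\ left_exact F};
     Hom := fun F G => NatTrans (proj1_sig F) (proj1_sig G);
     idm := fun F => nat_id (proj1_sig F);
     comp := fun F G H t s => nat_comp t s |}.
Next Obligation. intros; apply nat_trans_eq; intros; apply comp_id_l. Qed.
Next Obligation. intros; apply nat_trans_eq; intros; apply comp_id_r. Qed.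
Next Obligation. intros; apply nat_trans_eq; intros; apply comp_assoc. Qed.

Lemma Finite_prop (P : Prop) : Finite P.
Proof.
  destruct (classic P) as [p|np].
  - exists (p :: nil); intros q; left; apply proof_irrelevance.
  - exists nil; intros q; contradiction.
Qed.

Lemma Finite_bool : Finite bool.
Proof. exists (true :: false :: nil); intros []; simpl; auto. Qed.

Program Definition preorder_category (I : Type) (le : I -> I -> Prop)
    (le_refl : forall i, le i i)
    (le_trans : forall i j k, le i j -> le j k -> le i k) : Category :=
  {| Ob := I; Hom := le; idm := le_refl;
     comp := fun i j k v u => le_trans i j k u v |}.
Next Obligation. intros; apply proof_irrelevance. Qed.
Next Obligation. intros; apply proof_irrelevance. Qed.
Next Obligation. intros; apply proof_irrelevance. Qed.

Definition discrete (I : Type) : Category :=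
  preorder_category (@eq_refl I) (@eq_trans I).

Program Definition pair_diagram (C : Category) (X Y : C) : Functor (discrete bool) C :=
  {| fob := fun b : bool => if b then X else Y;
     fmap := fun i j (e : i = j) =>
       match e in _ = k return
         Hom (if i then X else Y) (if k then X else Y)
       with eq_refl => idm _ end |}.
Next Obligation. reflexivity. Qed.
Next Obligation.
  intros C X Y i j k v u; simpl in *; destruct v, u; simpl.
  symmetry; apply comp_id_l.
Qed.

(* [Some true] and [Some false] are the two feet of the cospan, [None] its base. *)
Definition cospan_le (i j : option bool) : Prop := j = None \/ i = j.

Lemma cospan_refl i : cospan_le i i.
Proof. now right. Qed.

Lemma cospan_trans i j k : cospan_le i j -> cospan_le j k -> cospan_le i k.
Proof. unfold cospan_le; intuition congruence. Qed.

Definition cospan : Category := preorder_category cospan_refl cospan_trans.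

Lemma cospan_absurd (i : option bool) (b : bool) :
  i <> Some b -> cospan_le i (Some b) -> False.
Proof. unfold cospan_le; intuition congruence. Qed.

Definition cospan_ob (C : Category) (X Y B : C) (i : option bool) : C :=
  match i with Some true => X | Some false => Y | None => B end.

Program Definition cospan_diagram (C : Category) (X Y B : C)
    (f : Hom X B) (g : Hom Y B) : Functor cospan C :=
  {| fob := @cospan_ob C X Y B;
     fmap := fun i j =>
       match i, j return
         cospan_le i j -> Hom (cospan_ob X Y B i) (cospan_ob X Y B j) with
       | Some true, Some true => fun _ => idm X
       | Some false, Some false => fun _ => idm Y
       | None, None => fun _ => idm B
       | Some true, None => fun _ => f
       | Some false, None => fun _ => g
       | Some true, Some false => fun u => False_rect _ (cospan_absurd _ u)
       | Some false, Some true => fun u => False_rect _ (cospan_absurd _ u)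
       | None, Some b => fun u => False_rect _ (cospan_absurd _ u)
       end |}.
Next Obligation. discriminate. Qed.
Next Obligation. discriminate. Qed.
Next Obligation. discriminate. Qed.
Next Obligation. intros C X Y B f g [[]|]; reflexivity. Qed.
Next Obligation.
  intros C X Y B f g [[]|] [[]|] [[]|] v u; simpl in *;
  try (exfalso; destruct u, v; congruence);
  now rewrite ?comp_id_l, ?comp_id_r.
Qed.

Lemma discrete_bool_finite : finite_category (discrete bool).
Proof. split; [apply Finite_bool | intros i j; exact (Finite_prop (i = j))]. Qed.

Lemma cospan_finite : finite_category cospan.
Proof.
  split; [|intros i j; exact (Finite_prop (cospan_le i j))].
  exists (Some true :: Some false :: None :: nil); intros [[]|]; simpl; auto.
Qed.

Definition limit (C : Category) {H : has_finite_limits C} (J : Category)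
    (HJ : finite_category J) (D : Functor J C) : Cone D :=
  proj1_sig (constructive_indefinite_description _ (H J HJ D)).

Lemma limit_is_limit (C : Category) {H : has_finite_limits C} (J : Category)
    (HJ : finite_category J) (D : Functor J C) : is_limit (limit HJ D).
Proof. apply (proj2_sig (constructive_indefinite_description _ (H J HJ D))). Qed.

Definition is_binary_product (C : Category) (X Y P : C)
    (p : Hom P X) (q : Hom P Y) : Prop :=
  forall (Z : C) (f : Hom Z X) (g : Hom Z Y),
    exists! h : Hom Z P, p ∘ h = f /\ q ∘ h = g.

Definition is_pullback (C : Category) (X Y B P : C) (f : Hom X B) (g : Hom Y B)
    (p : Hom P X) (q : Hom P Y) : Prop :=
  f ∘ p = g ∘ q /\
  forall (Z : C) (a : Hom Z X) (b : Hom Z Y), f ∘ a = g ∘ b ->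
    exists! h : Hom Z P, p ∘ h = a /\ q ∘ h = b.

Definition bprod (C : Category) {H : has_finite_limits C} (X Y : C) : C :=
  apex (limit discrete_bool_finite (pair_diagram X Y)).
Definition pr1 (C : Category) {H : has_finite_limits C} (X Y : C) :
    Hom (bprod X Y) X :=
  leg (limit discrete_bool_finite (pair_diagram X Y)) true.
Definition pr2 (C : Category) {H : has_finite_limits C} (X Y : C) :
    Hom (bprod X Y) Y :=
  leg (limit discrete_bool_finite (pair_diagram X Y)) false.
Arguments pr1 {C H X Y}.
Arguments pr2 {C H X Y}.

Definition pullback (C : Category) {H : has_finite_limits C} (X Y B : C)
    (f : Hom X B) (g : Hom Y B) : C :=
  apex (limit cospan_finite (cospan_diagram f g)).
Definition pb1 (C : Category) {H : has_finite_limits C} (X Y B : C)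
    (f : Hom X B) (g : Hom Y B) : Hom (pullback f g) X :=
  leg (limit cospan_finite (cospan_diagram f g)) (Some true).
Definition pb2 (C : Category) {H : has_finite_limits C} (X Y B : C)
    (f : Hom X B) (g : Hom Y B) : Hom (pullback f g) Y :=
  leg (limit cospan_finite (cospan_diagram f g)) (Some false).

Lemma discrete_leg_natural (C : Category) (D : Functor (discrete bool) C) (Z : C)
    (l : forall b : bool, Hom Z (D b)) (i j : discrete bool) (u : Hom i j) :
  fmap D u ∘ l i = l j.
Proof.
  simpl in *; destruct u.
  change (@eq_refl bool i) with (@idm (discrete bool) i).
  now rewrite fmap_id, comp_id_l.
Qed.

Definition discrete_cone (C : Category) (D : Functor (discrete bool) C) (Z : C)
    (f : Hom Z (D true)) (g : Hom Z (D false)) : Cone D :=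
  Build_Cone (@discrete_leg_natural C D Z
    (fun b => if b return Hom Z (D b) then f else g)).

Lemma limit_binary_product (C : Category) (D : Functor (discrete bool) C) (c : Cone D) :
  is_limit c <-> is_binary_product (leg c true) (leg c false).
Proof.
  split.
  - intros H Z f g.
    destruct (H (discrete_cone f g)) as [h [Hh Hu]].
    exists h; split; [split; [apply (Hh true) | apply (Hh false)]|].
    intros h' [H1 H2]; apply Hu; intros []; assumption.
  - intros H c'.
    destruct (H _ (leg c' true) (leg c' false)) as [h [[H1 H2] Hu]].
    exists h; split; [intros []; assumption|].
    intros h' Hh'; apply Hu; split; apply Hh'.
Qed.

Lemma bprod_is_product (C : Category) {H : has_finite_limits C} (X Y : C) :
  is_binary_product (@pr1 C H X Y) (@pr2 C H X Y).
Proof.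
  exact (proj1 (limit_binary_product _)
           (@limit_is_limit C H _ discrete_bool_finite (pair_diagram X Y))).
Qed.

Definition foot (b : bool) : @Hom cospan (Some b) None := or_introl eq_refl.

Lemma cospan_leg_natural (C : Category) (D : Functor cospan C) (Z : C)
    (a : Hom Z (D (Some true))) (b : Hom Z (D (Some false)))
    (E : fmap D (foot true) ∘ a = fmap D (foot false) ∘ b)
    (l := fun i : option bool => match i return Hom Z (D i) with
       | Some true => a | Some false => b | None => fmap D (foot true) ∘ a end)
    (i j : cospan) (u : Hom i j) :
  fmap D u ∘ l i = l j.
Proof.
  destruct (classic (i = j)) as [e|ne].
  - subst j. rewrite (proof_irrelevance (cospan_le i i) u (@idm cospan i)).
    now rewrite fmap_id, comp_id_l.
  - assert (j = None) by (destruct u; [assumption | contradiction]). subst j.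
    destruct i as [b'|]; [|congruence].
    rewrite (proof_irrelevance (cospan_le (Some b') None) u (foot b')).
    destruct b'; simpl; auto.
Qed.

Definition cospan_cone (C : Category) (D : Functor cospan C) (Z : C)
    (a : Hom Z (D (Some true))) (b : Hom Z (D (Some false)))
    (E : fmap D (foot true) ∘ a = fmap D (foot false) ∘ b) : Cone D :=
  Build_Cone (cospan_leg_natural E).

Lemma limit_pullback (C : Category) (D : Functor cospan C) (c : Cone D) :
  is_limit c <->
  is_pullback (fmap D (foot true)) (fmap D (foot false))
    (leg c (Some true)) (leg c (Some false)).
Proof.
  split.
  - intros H; split.
    + now rewrite !leg_natural.
    + intros Z a b E.
      destruct (H (cospan_cone E)) as [h [Hh Hu]].
      exists h; split; [split; [apply (Hh (Some true)) | apply (Hh (Some false))]|].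
      intros h' [H1 H2]; apply Hu; intros [[]|]; [assumption | assumption|].
      rewrite <- (leg_natural c (foot true)), <- comp_assoc; simpl.
      now rewrite H1.
  - intros [_ H] c'.
    destruct (H _ (leg c' (Some true)) (leg c' (Some false))) as [h [[H1 H2] Hu]].
    { now rewrite !leg_natural. }
    exists h; split.
    + intros [[]|]; [assumption | assumption|].
      now rewrite <- (leg_natural c (foot true)), <- comp_assoc, H1, leg_natural.
    + intros h' Hh'; apply Hu; split; apply Hh'.
Qed.

Lemma pullback_is_pullback (C : Category) {H : has_finite_limits C} (X Y B : C)
    (f : Hom X B) (g : Hom Y B) : is_pullback f g (pb1 f g) (pb2 f g).
Proof.
  exact (proj1 (limit_pullback _) (@limit_is_limit C H _ cospan_finite (cospan_diagram f g))).
Qed.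

Lemma left_exact_product (C D : Category) (F : Functor C D) (HF : left_exact F)
    (X Y P : C) (p : Hom P X) (q : Hom P Y) :
  is_binary_product p q -> is_binary_product (fmap F p) (fmap F q).
Proof.
  intros H.
  pose (c := @discrete_cone C (pair_diagram X Y) P p q).
  assert (Hc : is_limit c) by (apply limit_binary_product; exact H).
  exact (proj1 (limit_binary_product _) (HF _ discrete_bool_finite _ _ Hc)).
Qed.

Lemma left_exact_pullback (C D : Category) (F : Functor C D) (HF : left_exact F)
    (X Y B P : C) (f : Hom X B) (g : Hom Y B) (p : Hom P X) (q : Hom P Y) :
  is_pullback f g p q -> is_pullback (fmap F f) (fmap F g) (fmap F p) (fmap F q).
Proof.
  intros H.
  pose (c := @cospan_cone C (cospan_diagram f g) P p q (proj1 H)).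
  assert (Hc : is_limit c) by (apply limit_pullback; exact H).
  exact (proj1 (limit_pullback _) (HF _ cospan_finite _ _ Hc)).
Qed.

Lemma mono_pullback (C : Category) (X Y : C) (f : Hom X Y) :
  is_mono f <-> is_pullback f f (idm X) (idm X).
Proof.
  split.
  - intros H; split; [reflexivity|]; intros Z a b E.
    apply H in E; subst b; exists a; split; [now rewrite comp_id_l|].
    intros h [E _]; now rewrite comp_id_l in E.
  - intros [_ H] Z a b E.
    destruct (H Z a b E) as [h [[<- <-] _]]; reflexivity.
Qed.

Lemma left_exact_mono (C D : Category) (F : Functor C D) (HF : left_exact F)
    (X Y : C) (f : Hom X Y) : is_mono f -> is_mono (fmap F f).
Proof.
  rewrite !mono_pullback; intros H.
  rewrite <- fmap_id; now apply left_exact_pullback.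
Qed.

Definition pairing (C : Category) {H : has_finite_limits C} (X Y Z : C)
    (f : Hom Z X) (g : Hom Z Y) : Hom Z (bprod X Y) :=
  proj1_sig (constructive_indefinite_description _ (@bprod_is_product C H X Y Z f g)).

Lemma pr1_pairing (C : Category) {H : has_finite_limits C} (X Y Z : C)
    (f : Hom Z X) (g : Hom Z Y) : pr1 ∘ pairing f g = f.
Proof.
  exact (proj1 (proj1 (proj2_sig
    (constructive_indefinite_description _ (@bprod_is_product C H X Y Z f g))))).
Qed.

Lemma pr2_pairing (C : Category) {H : has_finite_limits C} (X Y Z : C)
    (f : Hom Z X) (g : Hom Z Y) : pr2 ∘ pairing f g = g.
Proof.
  exact (proj2 (proj1 (proj2_sig
    (constructive_indefinite_description _ (@bprod_is_product C H X Y Z f g))))).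
Qed.

Lemma bprod_ext (C : Category) {H : has_finite_limits C} (X Y Z : C)
    (u v : Hom Z (bprod X Y)) : pr1 ∘ u = pr1 ∘ v -> pr2 ∘ u = pr2 ∘ v -> u = v.
Proof.
  intros E1 E2.
  destruct (@bprod_is_product C H X Y Z (pr1 ∘ v) (pr2 ∘ v)) as [h [_ Hu]].
  rewrite <- (Hu u), <- (Hu v); auto.
Qed.

Lemma pairing_comp (C : Category) {H : has_finite_limits C} (X Y Z W : C)
    (f : Hom Z X) (g : Hom Z Y) (k : Hom W Z) :
  pairing f g ∘ k = pairing (f ∘ k) (g ∘ k).
Proof.
  apply bprod_ext; rewrite comp_assoc.
  - now rewrite !pr1_pairing.
  - now rewrite !pr2_pairing.
Qed.

Definition two (C : Category) (X Y : C) (b : bool) : C := if b then X else Y.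

Lemma bcoprod_exists (C : Category) {H : has_finite_coproducts C} (X Y : C) :
  exists u : {A : C & forall b, Hom (two X Y b) A}, is_coproduct (projT2 u).
Proof.
  destruct (H bool Finite_bool (two X Y)) as [A [inj Hinj]].
  now exists (existT _ A inj).
Qed.

Definition bcoprod (C : Category) {H : has_finite_coproducts C} (X Y : C) : C :=
  projT1 (proj1_sig (constructive_indefinite_description _ (bcoprod_exists X Y))).
Definition in1 (C : Category) {H : has_finite_coproducts C} (X Y : C) :
    Hom X (bcoprod X Y) :=
  projT2 (proj1_sig (constructive_indefinite_description _ (bcoprod_exists X Y))) true.
Definition in2 (C : Category) {H : has_finite_coproducts C} (X Y : C) :
    Hom Y (bcoprod X Y) :=
  projT2 (proj1_sig (constructive_indefinite_description _ (bcoprod_exists X Y))) false.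
Arguments in1 {C H X Y}.
Arguments in2 {C H X Y}.

Lemma bcoprod_is_coproduct (C : Category) {H : has_finite_coproducts C} (X Y Z : C)
    (f : Hom X Z) (g : Hom Y Z) :
  exists! h : Hom (bcoprod X Y) Z, h ∘ in1 = f /\ h ∘ in2 = g.
Proof.
  unfold in1, in2, bcoprod.
  destruct constructive_indefinite_description as [[A inj] HA]; simpl in *.
  destruct (HA Z (fun b => if b return Hom (two X Y b) Z then f else g)) as [h [Hh Hu]].
  exists h; split; [split; [apply (Hh true) | apply (Hh false)]|].
  intros h' [H1 H2]; apply Hu; intros []; assumption.
Qed.

Definition copairing (C : Category) {H : has_finite_coproducts C} (X Y Z : C)
    (f : Hom X Z) (g : Hom Y Z) : Hom (bcoprod X Y) Z :=
  proj1_sig (constructive_indefinite_description _ (bcoprod_is_coproduct f g)).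

Lemma copairing_in1 (C : Category) {H : has_finite_coproducts C} (X Y Z : C)
    (f : Hom X Z) (g : Hom Y Z) : copairing f g ∘ in1 = f.
Proof.
  exact (proj1 (proj1 (proj2_sig
    (constructive_indefinite_description _ (bcoprod_is_coproduct f g))))).
Qed.

Lemma copairing_in2 (C : Category) {H : has_finite_coproducts C} (X Y Z : C)
    (f : Hom X Z) (g : Hom Y Z) : copairing f g ∘ in2 = g.
Proof.
  exact (proj2 (proj1 (proj2_sig
    (constructive_indefinite_description _ (bcoprod_is_coproduct f g))))).
Qed.

Lemma bcoprod_ext (C : Category) {H : has_finite_coproducts C} (X Y Z : C)
    (u v : Hom (bcoprod X Y) Z) : u ∘ in1 = v ∘ in1 -> u ∘ in2 = v ∘ in2 -> u = v.
Proof.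
  intros E1 E2.
  destruct (bcoprod_is_coproduct (v ∘ in1) (v ∘ in2)) as [h [_ Hu]].
  rewrite <- (Hu u), <- (Hu v); auto.
Qed.

Lemma comp_copairing (C : Category) {H : has_finite_coproducts C} (X Y Z W : C)
    (f : Hom X Z) (g : Hom Y Z) (k : Hom Z W) :
  k ∘ copairing f g = copairing (k ∘ f) (k ∘ g).
Proof.
  apply bcoprod_ext; rewrite <- comp_assoc.
  - now rewrite !copairing_in1.
  - now rewrite !copairing_in2.
Qed.

Definition bcoprod_map (C : Category) {H : has_finite_coproducts C} (X X' Y Y' : C)
    (f : Hom X X') (g : Hom Y Y') : Hom (bcoprod X Y) (bcoprod X' Y') :=
  copairing (in1 ∘ f) (in2 ∘ g).

Lemma bcoprod_map_id (C : Category) {H : has_finite_coproducts C} (X Y : C) :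
  bcoprod_map (idm X) (idm Y) = idm (bcoprod X Y).
Proof.
  apply bcoprod_ext; unfold bcoprod_map;
  now rewrite ?copairing_in1, ?copairing_in2, comp_id_l, comp_id_r.
Qed.

Lemma bcoprod_map_comp (C : Category) {H : has_finite_coproducts C}
    (X X' X'' Y Y' Y'' : C)
    (f : Hom X X') (f' : Hom X' X'') (g : Hom Y Y') (g' : Hom Y' Y'') :
  bcoprod_map (f' ∘ f) (g' ∘ g) = bcoprod_map f' g' ∘ bcoprod_map f g.
Proof.
  apply bcoprod_ext; unfold bcoprod_map; rewrite <- comp_assoc;
  rewrite ?copairing_in1, ?copairing_in2, !comp_assoc;
  now rewrite ?copairing_in1, ?copairing_in2.
Qed.

Program Definition slice_coproduct (C : Category) {H : has_finite_coproducts C}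
    (X Y : C) :
    Functor (product_category (slice X) (slice Y)) (slice (bcoprod X Y)) :=
  {| fob := fun AB =>
       existT (fun A => Hom A (bcoprod X Y))
         (bcoprod (projT1 (fst AB)) (projT1 (snd AB)))
         (bcoprod_map (projT2 (fst AB)) (projT2 (snd AB)));
     fmap := fun AB AB' fg =>
       exist _ (bcoprod_map (proj1_sig (fst fg)) (proj1_sig (snd fg))) _ |}.
Next Obligation.
  intros C H X Y [A B] [A' B'] [[f Hf] [g Hg]]; simpl in *.
  now rewrite <- bcoprod_map_comp, Hf, Hg.
Qed.
Next Obligation. intros; apply sig_eq; apply bcoprod_map_id. Qed.
Next Obligation. intros; apply sig_eq; apply bcoprod_map_comp. Qed.

Class lextensive (C : Category) : Prop := {
  lextensive_limits :: has_finite_limits C;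
  lextensive_coproducts :: has_finite_coproducts C;
  lextensive_equivalence : forall X Y : C, is_equivalence (slice_coproduct X Y)
}.

(* Subobjects are given by representing monomorphisms and compared by [sub_le]. *)
Record Subobject (C : Category) (X : C) := {
  sub_dom : C;
  sub_arr : Hom sub_dom X;
  sub_mono : is_mono sub_arr
}.
Arguments sub_mono {C X} s : rename.

Definition factors (C : Category) (X Z : C) (z : Hom Z X) (A : Subobject X) : Prop :=
  exists h : Hom Z (sub_dom A), sub_arr A ∘ h = z.

Definition sub_le (C : Category) (X : C) (A B : Subobject X) : Prop :=
  factors (sub_arr A) B.

Lemma mono_comp (C : Category) (X Y Z : C) (g : Hom Y Z) (f : Hom X Y) :
  is_mono g -> is_mono f -> is_mono (g ∘ f).
Proof.
  intros Hg Hf W a b E; apply Hf, Hg; now rewrite !comp_assoc.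
Qed.

Lemma pullback_mono (C : Category) {H : has_finite_limits C} (X Y B : C)
    (f : Hom X B) (g : Hom Y B) : is_mono g -> is_mono (pb1 f g).
Proof.
  intros Hg Z a b E.
  destruct (pullback_is_pullback f g) as [Esq Hu].
  assert (E' : pb2 f g ∘ a = pb2 f g ∘ b).
  { apply Hg; rewrite !comp_assoc, <- Esq, <- !comp_assoc; now rewrite E. }
  destruct (Hu Z (pb1 f g ∘ b) (pb2 f g ∘ b)) as [h [_ Huu]].
  { now rewrite !comp_assoc, Esq. }
  rewrite <- (Huu a), <- (Huu b); auto.
Qed.

Definition inverse_image (C : Category) {H : has_finite_limits C} (X Y : C)
    (f : Hom X Y) (A : Subobject Y) : Subobject X :=
  {| sub_dom := pullback f (sub_arr A);
     sub_arr := pb1 f (sub_arr A);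
     sub_mono := @pullback_mono C H _ _ _ f _ (sub_mono A) |}.

Definition intersection (C : Category) {H : has_finite_limits C} (X : C)
    (A B : Subobject X) : Subobject X :=
  {| sub_dom := pullback (sub_arr A) (sub_arr B);
     sub_arr := sub_arr A ∘ pb1 (sub_arr A) (sub_arr B);
     sub_mono := mono_comp (sub_mono A)
                   (@pullback_mono C H _ _ _ (sub_arr A) _ (sub_mono B)) |}.

Lemma factors_inverse_image (C : Category) {H : has_finite_limits C} (X Y Z : C)
    (f : Hom X Y) (A : Subobject Y) (z : Hom Z X) :
  factors z (inverse_image f A) <-> factors (f ∘ z) A.
Proof.
  destruct (pullback_is_pullback f (sub_arr A)) as [Esq Hu].
  split; intros [h Hh]; simpl in *.
  - exists (pb2 f (sub_arr A) ∘ h).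
    now rewrite comp_assoc, <- Esq, <- comp_assoc, Hh.
  - destruct (Hu Z z h (eq_sym Hh)) as [k [[Hk _] _]]; now exists k.
Qed.

Lemma factors_intersection (C : Category) {H : has_finite_limits C} (X Z : C)
    (A B : Subobject X) (z : Hom Z X) :
  factors z (intersection A B) <-> factors z A /\ factors z B.
Proof.
  destruct (pullback_is_pullback (sub_arr A) (sub_arr B)) as [Esq Hu].
  split.
  - intros [h Hh]; simpl in *; split.
    + exists (pb1 _ _ ∘ h); now rewrite comp_assoc.
    + exists (pb2 _ _ ∘ h); now rewrite comp_assoc, <- Esq.
  - intros [[a Ha] [b Hb]].
    destruct (Hu Z a b (eq_trans Ha (eq_sym Hb))) as [k [[Hk _] _]].
    exists k; simpl; now rewrite <- comp_assoc, Hk.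
Qed.

Lemma factors_comp (C : Category) (X Z W : C) (A : Subobject X)
    (z : Hom Z X) (w : Hom W Z) : factors z A -> factors (z ∘ w) A.
Proof. intros [h <-]; exists (h ∘ w); apply comp_assoc. Qed.

Definition diagonal_map (C : Category) {H : has_finite_limits C} (X : C) :
  Hom X (bprod X X) := pairing (idm X) (idm X).

Definition switch (C : Category) {H : has_finite_limits C} (X Y : C) :
  Hom (bprod X Y) (bprod Y X) := pairing pr2 pr1.
Arguments switch {C H X Y}.

Lemma diagonal_mono (C : Category) {H : has_finite_limits C} (X : C) :
  is_mono (diagonal_map X).
Proof.
  intros Z a b E; unfold diagonal_map in E; rewrite !pairing_comp, !comp_id_l in E.
  now rewrite <- (pr1_pairing a a), E, pr1_pairing.
Qed.

Lemma switch_mono (C : Category) {H : has_finite_limits C} (X Y : C) :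
  is_mono (@switch C H X Y).
Proof.
  intros Z a b E; unfold switch in E; rewrite !pairing_comp in E.
  apply bprod_ext.
  - now rewrite <- (pr2_pairing (pr2 ∘ a) (pr1 ∘ a)), E, pr2_pairing.
  - now rewrite <- (pr1_pairing (pr2 ∘ a) (pr1 ∘ a)), E, pr1_pairing.
Qed.

Definition diagonal (C : Category) {H : has_finite_limits C} (X : C) :
    Subobject (bprod X X) :=
  {| sub_dom := X; sub_arr := diagonal_map X; sub_mono := @diagonal_mono C H X |}.

Definition opposite (C : Category) {H : has_finite_limits C} (X : C)
    (T : Subobject (bprod X X)) : Subobject (bprod X X) :=
  {| sub_dom := sub_dom T;
     sub_arr := switch ∘ sub_arr T;
     sub_mono := mono_comp (@switch_mono C H X X) (sub_mono T) |}.

Definition relation_total (C : Category) {HL : has_finite_limits C}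
    {HC : has_finite_coproducts C} (X : C) (T : Subobject (bprod X X)) : Prop :=
  is_iso (copairing (copairing (sub_arr T) (sub_arr (diagonal X)))
                    (sub_arr (opposite T))).

Definition cube (C : Category) {H : has_finite_limits C} (X : C) : C :=
  bprod (bprod X X) X.
Definition p12 (C : Category) {H : has_finite_limits C} (X : C) :
  Hom (cube X) (bprod X X) := pr1.
Definition p23 (C : Category) {H : has_finite_limits C} (X : C) :
  Hom (cube X) (bprod X X) := pairing (pr2 ∘ pr1) pr2.
Definition p13 (C : Category) {H : has_finite_limits C} (X : C) :
  Hom (cube X) (bprod X X) := pairing (pr1 ∘ pr1) pr2.
Arguments p12 {C H X}.
Arguments p23 {C H X}.
Arguments p13 {C H X}.

Definition relation_transitive (C : Category) {H : has_finite_limits C} (X : C)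
    (T : Subobject (bprod X X)) : Prop :=
  sub_le (intersection (inverse_image p12 T) (inverse_image p23 T))
         (inverse_image p13 T).

Lemma relation_transitive_criterion (C : Category) {H : has_finite_limits C} (X : C)
    (T : Subobject (bprod X X)) :
  (forall (Z : C) (z : Hom Z (cube X)),
     factors (p12 ∘ z) T -> factors (p23 ∘ z) T -> factors (p13 ∘ z) T) ->
  relation_transitive T.
Proof.
  intros HT; unfold relation_transitive, sub_le; apply factors_inverse_image.
  set (A := intersection _ _).
  assert (HA : factors (sub_arr A) A) by (exists (idm _); apply comp_id_r).
  apply factors_intersection in HA; rewrite !factors_inverse_image in HA.
  now apply HT.
Qed.

Record OrderedObject (C : Category) {HL : has_finite_limits C}
    {HC : has_finite_coproducts C} := {
  ord_car :> C;
  ord_rel : Subobject (bprod ord_car ord_car);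
  ord_total : relation_total ord_rel;
  ord_trans : relation_transitive ord_rel
}.
Arguments OrderedObject C {HL HC}.

Definition bprod_map (C : Category) {H : has_finite_limits C} (X X' Y Y' : C)
    (f : Hom X X') (g : Hom Y Y') : Hom (bprod X Y) (bprod X' Y') :=
  pairing (f ∘ pr1) (g ∘ pr2).

Definition monotonic (C : Category) {HL : has_finite_limits C}
    {HC : has_finite_coproducts C} (X Y : OrderedObject C) (f : Hom X Y) : Prop :=
  sub_le (ord_rel X) (inverse_image (bprod_map f f) (ord_rel Y)).
Arguments monotonic {C HL HC} X Y f.

Lemma bprod_map_id (C : Category) {H : has_finite_limits C} (X Y : C) :
  bprod_map (idm X) (idm Y) = idm (bprod X Y).
Proof.
  apply bprod_ext; unfold bprod_map;
  now rewrite ?pr1_pairing, ?pr2_pairing, comp_id_l, comp_id_r.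
Qed.

Lemma bprod_map_comp (C : Category) {H : has_finite_limits C}
    (X X' X'' Y Y' Y'' : C)
    (f : Hom X X') (f' : Hom X' X'') (g : Hom Y Y') (g' : Hom Y' Y'') :
  bprod_map (f' ∘ f) (g' ∘ g) = bprod_map f' g' ∘ bprod_map f g.
Proof.
  unfold bprod_map; rewrite pairing_comp, <- !comp_assoc.
  now rewrite pr1_pairing, pr2_pairing.
Qed.

Lemma monotonicE (C : Category) {HL : has_finite_limits C}
    {HC : has_finite_coproducts C} (X Y : OrderedObject C) (f : Hom X Y) :
  monotonic X Y f <-> factors (bprod_map f f ∘ sub_arr (ord_rel X)) (ord_rel Y).
Proof. apply factors_inverse_image. Qed.

Lemma monotonic_id (C : Category) {HL : has_finite_limits C}
    {HC : has_finite_coproducts C} (X : OrderedObject C) : monotonic X X (idm X).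
Proof.
  apply monotonicE; rewrite bprod_map_id, comp_id_l.
  exists (idm _); apply comp_id_r.
Qed.

Lemma monotonic_comp (C : Category) {HL : has_finite_limits C}
    {HC : has_finite_coproducts C} (X Y Z : OrderedObject C)
    (g : Hom Y Z) (f : Hom X Y) :
  monotonic Y Z g -> monotonic X Y f -> monotonic X Z (g ∘ f).
Proof.
  rewrite !monotonicE; intros Hg [h Hh].
  rewrite bprod_map_comp, <- comp_assoc, <- Hh, comp_assoc.
  now apply factors_comp.
Qed.

Program Definition Ord (C : Category) {HL : has_finite_limits C}
    {HC : has_finite_coproducts C} : Category :=
  {| Ob := OrderedObject C;
     Hom := fun X Y => {f : Hom X Y | monotonic X Y f};
     idm := fun X => exist _ (idm (ord_car X)) (monotonic_id X);
     comp := fun X Y Z g f =>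
       exist _ (proj1_sig g ∘ proj1_sig f)
         (monotonic_comp (proj2_sig g) (proj2_sig f)) |}.
Next Obligation. intros; apply sig_eq; apply comp_id_l. Qed.
Next Obligation. intros; apply sig_eq; apply comp_id_r. Qed.
Next Obligation. intros; apply sig_eq; apply comp_assoc. Qed.
Arguments Ord C {HL HC}.

Local Open Scope R_scope.

Record autR := {
  aut :> R -> R;
  aut_inv : R -> R;
  aut_invK : forall x, aut_inv (aut x) = x;
  autK : forall x, aut (aut_inv x) = x;
  aut_lt : forall x y, x < y -> aut x < aut y
}.

Definition aut_one : autR :=
  {| aut := fun x => x; aut_inv := fun x => x;
     aut_invK := fun x => eq_refl; autK := fun x => eq_refl;
     aut_lt := fun x y H => H |}.

Program Definition aut_mul (g h : autR) : autR :=
  {| aut := fun x => g (h x); aut_inv := fun x => aut_inv h (aut_inv g x) |}.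
Next Obligation. intros; simpl; now rewrite !aut_invK. Qed.
Next Obligation. intros; simpl; now rewrite !autK. Qed.
Next Obligation. intros; simpl; now apply aut_lt, aut_lt. Qed.

Definition fixes (A : list R) (g : autR) : Prop := forall a, In a A -> g a = a.

(* Open sets of the group topology having the subgroups [fixes A], for [A] finite,
   as a neighborhood basis of the identity: the cosets [g (fixes A)] are a
   neighborhood basis of [g]. *)
Definition aut_open (U : autR -> Prop) : Prop :=
  forall g, U g -> exists A : list R, forall h, fixes A h -> U (aut_mul g h).

(* Objects of S(G), for G the topological group [autR]. *)
Record GSet := {
  gcar :> Type;
  gact : autR -> gcar -> gcar;
  gact_one : forall x, gact aut_one x = x;
  gact_mul : forall g h x, gact (aut_mul g h) x = gact g (gact h x);
  gact_open : forall x, aut_open (fun g => gact g x = x);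
  gact_orbits : exists l : list gcar, forall x, exists y, In y l /\ exists g, gact g y = x
}.

Record GMap (X Y : GSet) := {
  gfun :> X -> Y;
  gfun_equivariant : forall g x, gfun (gact g x) = gact g (gfun x)
}.

Lemma gmap_eq (X Y : GSet) (f f' : GMap X Y) : (forall x, f x = f' x) -> f = f'.
Proof.
  destruct f as [f p], f' as [f' p']; simpl; intros H.
  assert (f = f') by (apply functional_extensionality; exact H).
  subst f'; now rewrite (proof_irrelevance _ p p').
Qed.

Definition gmap_id (X : GSet) : GMap X X :=
  {| gfun := fun x => x; gfun_equivariant := fun g x => eq_refl |}.

Program Definition gmap_comp (X Y Z : GSet) (f' : GMap Y Z) (f : GMap X Y) : GMap X Z :=
  {| gfun := fun x => f' (f x) |}.
Next Obligation. intros; simpl; now rewrite !gfun_equivariant. Qed.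

Program Definition SG : Category :=
  {| Ob := GSet; Hom := GMap; idm := gmap_id; comp := gmap_comp |}.
Next Obligation. intros; now apply gmap_eq. Qed.
Next Obligation. intros; now apply gmap_eq. Qed.
Next Obligation. intros; now apply gmap_eq. Qed.

Lemma aut_lt_iff (g : autR) x y : g x < g y <-> x < y.
Proof.
  split; [|apply aut_lt].
  intros H; destruct (Rtotal_order x y) as [L|[E|G]]; auto.
  - subst; lra.
  - apply (@aut_lt g) in G; lra.
Qed.

(* Piecewise linear map sending 0, 1, 2 to x, y, z. *)
Definition pl (x y z t : R) : R :=
  if Rle_dec t 1 then x + (y - x) * t else y + (z - y) * (t - 1).
Definition pl_inv (x y z s : R) : R :=
  if Rle_dec s y then (s - x) / (y - x) else 1 + (s - y) / (z - y).

Lemma pl_lt x y z : x < y -> y < z -> forall s t, s < t -> pl x y z s < pl x y z t.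
Proof.
  intros H1 H2 s t H; unfold pl; destruct (Rle_dec s 1), (Rle_dec t 1); try nra.
Qed.

Lemma plK x y z : x < y -> y < z -> forall t, pl_inv x y z (pl x y z t) = t.
Proof.
  intros H1 H2 t; unfold pl, pl_inv.
  destruct (Rle_dec t 1) as [L|L]; destruct Rle_dec as [L'|L'];
    try (field; lra); exfalso; nra.
Qed.

Lemma pl_invK x y z : x < y -> y < z -> forall s, pl x y z (pl_inv x y z s) = s.
Proof.
  intros H1 H2 s; unfold pl, pl_inv.
  destruct (Rle_dec s y) as [L|L]; destruct Rle_dec as [L'|L'];
    try (field; lra); exfalso.
  - apply L'; apply Rmult_le_reg_r with (y - x); [lra|].
    unfold Rdiv; rewrite Rmult_assoc, Rinv_l by lra; lra.
  - assert (0 < (s - y) / (z - y)) by (apply Rdiv_lt_0_compat; lra); lra.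
Qed.

Lemma aut_three x y z : x < y -> y < z -> exists g : autR, g 0 = x /\ g 1 = y /\ g 2 = z.
Proof.
  intros H1 H2.
  exists {| aut := pl x y z; aut_inv := pl_inv x y z; aut_invK := plK H1 H2;
            autK := pl_invK H1 H2; aut_lt := pl_lt H1 H2 |}.
  simpl; unfold pl; repeat split; destruct Rle_dec; lra.
Qed.

Lemma stabilizer_open (X : Type) (act : autR -> X -> X)
    (act_mul : forall g h x, act (aut_mul g h) x = act g (act h x)) (x : X) :
  (exists A, forall h, fixes A h -> act h x = x) -> aut_open (fun g => act g x = x).
Proof.
  intros [A HA] g Hg; exists A; intros h Hh; now rewrite act_mul, HA.
Qed.

Program Definition line : GSet :=
  {| gcar := R; gact := fun g x => g x |}.
Next Obligation. reflexivity. Qed.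
Next Obligation. reflexivity. Qed.
Next Obligation.
  intros x; apply (@stabilizer_open R (fun g x => g x)); [reflexivity|].
  exists (x :: nil); intros h Hh; apply Hh; simpl; auto.
Qed.
Next Obligation.
  exists (0 :: nil); intros x; exists 0; split; [simpl; auto|].
  destruct (@aut_three x (x + 1) (x + 2)) as [g [Hg _]]; try lra; now exists g.
Qed.

Program Definition plane : GSet :=
  {| gcar := (R * R)%type; gact := fun g p => (g (fst p), g (snd p)) |}.
Next Obligation. intros []; reflexivity. Qed.
Next Obligation. reflexivity. Qed.
Next Obligation.
  intros [x y]; apply (@stabilizer_open (R * R) (fun g p => (g (fst p), g (snd p))));
    [reflexivity|].
  exists (x :: y :: nil); intros h Hh; simpl; f_equal; apply Hh; simpl; auto.
Qed.
Next Obligation.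
  exists ((0, 0) :: (0, 1) :: (1, 0) :: nil); intros [x y].
  destruct (Rtotal_order x y) as [L|[E|L]].
  - exists (0, 1); split; [simpl; auto|].
    destruct (@aut_three x y (y + 1)) as [g [H0 [H1 _]]]; try lra.
    exists g; simpl; congruence.
  - exists (0, 0); split; [simpl; auto|].
    destruct (@aut_three x (x + 1) (x + 2)) as [g [H0 _]]; try lra.
    exists g; simpl; congruence.
  - exists (1, 0); split; [simpl; auto|].
    destruct (@aut_three y x (x + 1)) as [g [H0 [H1 _]]]; try lra.
    exists g; simpl; congruence.
Qed.

Program Definition less : GSet :=
  {| gcar := {p : R * R | fst p < snd p};
     gact := fun g p => exist _ (g (fst (proj1_sig p)), g (snd (proj1_sig p))) _ |}.
Next Obligation. intros g [[x y] H]; simpl in *; now apply aut_lt. Qed.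
Next Obligation. intros [[x y] H]; now apply sig_eq. Qed.
Next Obligation. intros; now apply sig_eq. Qed.
Next Obligation.
  intros [[x y] H]; apply (@stabilizer_open {p : R * R | fst p < snd p}
    (fun g p => exist _ (g (fst (proj1_sig p)), g (snd (proj1_sig p)))
                  (less_obligation_1 g p))); [intros; now apply sig_eq|].
  exists (x :: y :: nil); intros h Hh; apply sig_eq; simpl; f_equal; apply Hh; simpl; auto.
Qed.
Next Obligation.
  exists (exist (fun p : R * R => fst p < snd p) (0, 1) Rlt_0_1 :: nil).
  intros [[x y] H]; simpl in H; eexists; split; [simpl; left; reflexivity|].
  destruct (@aut_three x y (y + 1)) as [g [H0 [H1 _]]]; try lra.
  exists g; apply sig_eq; simpl; congruence.
Qed.

Definition plane_fst : @Hom SG plane line :=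
  {| gfun := (fun p => fst p) : plane -> line; gfun_equivariant := fun g p => eq_refl |}.
Definition plane_snd : @Hom SG plane line :=
  {| gfun := (fun p => snd p) : plane -> line; gfun_equivariant := fun g p => eq_refl |}.
Definition less_incl : @Hom SG less plane :=
  {| gfun := (fun p => proj1_sig p) : less -> plane;
     gfun_equivariant := fun g p => eq_refl |}.

Lemma plane_is_product : is_binary_product plane_fst plane_snd.
Proof.
  intros Z f g; simpl in *.
  unshelve eexists.
  { exists (fun z => (f z, g z) : plane).
    intros a z; simpl; f_equal; apply gfun_equivariant. }
  split.
  - split; apply gmap_eq; reflexivity.
  - intros h [<- <-]; apply gmap_eq; intros z; simpl; symmetry; apply surjective_pairing.
Qed.

Lemma less_incl_mono : is_mono less_incl.
Proof.
  intros Z a b E; apply gmap_eq; intros z; apply sig_eq.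
  exact (f_equal (fun k : GMap Z plane => k z) E).
Qed.

Program Definition less3 : GSet :=
  {| gcar := {p : R * R * R | fst (fst p) < snd (fst p) /\ snd (fst p) < snd p};
     gact := fun g p =>
       exist _ (g (fst (fst (proj1_sig p))), g (snd (fst (proj1_sig p))),
                g (snd (proj1_sig p))) _ |}.
Next Obligation. intros g [[[x y] z] [H1 H2]]; simpl in *; split; now apply aut_lt. Qed.
Next Obligation. intros [[[x y] z] H]; now apply sig_eq. Qed.
Next Obligation. intros; now apply sig_eq. Qed.
Next Obligation.
  intros [[[x y] z] H]; apply (@stabilizer_open
    {p : R * R * R | fst (fst p) < snd (fst p) /\ snd (fst p) < snd p}
    (fun g p => exist _ (g (fst (fst (proj1_sig p))), g (snd (fst (proj1_sig p))),
                         g (snd (proj1_sig p))) (less3_obligation_1 g p)));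
    [intros; now apply sig_eq|].
  exists (x :: y :: z :: nil); intros h Hh; apply sig_eq; simpl.
  repeat f_equal; apply Hh; simpl; auto.
Qed.
Next Obligation.
  assert (H0 : 0 < 1 /\ 1 < 2) by lra.
  exists (exist (fun p : R * R * R => fst (fst p) < snd (fst p) /\ snd (fst p) < snd p)
            (0, 1, 2) H0 :: nil).
  intros [[[x y] z] [H1 H2]]; simpl in H1, H2.
  eexists; split; [simpl; left; reflexivity|].
  destruct (aut_three H1 H2) as [g [E0 [E1 E2]]].
  exists g; apply sig_eq; simpl; congruence.
Qed.

Program Definition less3_12 : @Hom SG less3 less :=
  {| gfun := (fun p => exist _ (fst (proj1_sig p)) _) : less3 -> less |}.
Next Obligation. intros p; exact (proj1 (proj2_sig p)). Qed.
Next Obligation. intros; now apply sig_eq. Qed.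

Program Definition less3_23 : @Hom SG less3 less :=
  {| gfun := (fun p => exist _ (snd (fst (proj1_sig p)), snd (proj1_sig p)) _)
       : less3 -> less |}.
Next Obligation. intros p; exact (proj2 (proj2_sig p)). Qed.
Next Obligation. intros; now apply sig_eq. Qed.

Program Definition less3_13 : @Hom SG less3 less :=
  {| gfun := (fun p => exist _ (fst (fst (proj1_sig p)), snd (proj1_sig p)) _)
       : less3 -> less |}.
Next Obligation. intros [[[x y] z] [H1 H2]]; simpl in *; lra. Qed.
Next Obligation. intros; now apply sig_eq. Qed.

Lemma less3_is_pullback :
  is_pullback (plane_snd ∘ less_incl) (plane_fst ∘ less_incl) less3_12 less3_23.
Proof.
  split; [now apply gmap_eq|].
  intros Z a b E; simpl in *.
  assert (E' : forall z, snd (proj1_sig (a z)) = fst (proj1_sig (b z))).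
  { intros z; exact (f_equal (fun k : GMap Z line => k z) E). }
  assert (P : forall z, fst (proj1_sig (a z)) < snd (proj1_sig (a z)) /\
                        snd (proj1_sig (a z)) < snd (proj1_sig (b z))).
  { intros z; split; [exact (proj2_sig (a z))|].
    rewrite E'; exact (proj2_sig (b z)). }
  unshelve eexists.
  { exists (fun z => exist (fun p : R * R * R =>
        fst (fst p) < snd (fst p) /\ snd (fst p) < snd p)
      (fst (proj1_sig (a z)), snd (proj1_sig (a z)), snd (proj1_sig (b z))) (P z)).
    intros g z; apply sig_eq; simpl; now rewrite !gfun_equivariant. }
  split.
  - split; apply gmap_eq; intros z; apply sig_eq; simpl.
    + symmetry; apply surjective_pairing.
    + rewrite E'; symmetry; apply surjective_pairing.
  - intros h [<- <-]; apply gmap_eq; intros z; apply sig_eq; simpl.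
    now rewrite <- !surjective_pairing.
Qed.

Definition line_diag : @Hom SG line plane :=
  {| gfun := (fun x => (x, x)) : line -> plane; gfun_equivariant := fun g x => eq_refl |}.

Definition greater_incl : @Hom SG less plane :=
  {| gfun := (fun p => (snd (proj1_sig p), fst (proj1_sig p))) : less -> plane;
     gfun_equivariant := fun g p => eq_refl |}.

Definition plane_part (c : comparison) : SG :=
  match c with Lt => less | Eq => line | Gt => less end.

Definition plane_inj (c : comparison) : Hom (plane_part c) plane :=
  match c with Lt => less_incl | Eq => line_diag | Gt => greater_incl end.

Definition plane_glue (Z : SG) (f : forall c, Hom (plane_part c) Z) (p : plane) : gcar Z :=
  match total_order_T (fst p) (snd p) with
  | inleft (left H) => (f Lt : GMap less Z) (exist _ p H)
  | inleft (right _) => (f Eq : GMap line Z) (fst p)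
  | inright H =>
      (f Gt : GMap less Z) (exist (fun q : R * R => fst q < snd q) (snd p, fst p) H)
  end.

Lemma plane_glue_equivariant (Z : SG) (f : forall c, Hom (plane_part c) Z) g p :
  plane_glue f (gact g p) = gact g (plane_glue f p).
Proof.
  destruct p as [x y]; unfold plane_glue; simpl.
  destruct (total_order_T (g x) (g y)) as [[L|E]|L];
  destruct (total_order_T x y) as [[L'|E']|L']; simpl in *;
  try (exfalso; subst; try rewrite !aut_lt_iff in *; unfold Rgt in *;
       repeat match goal with
       | H : aut g _ < aut g _ |- _ => apply aut_lt_iff in H
       | H : aut g ?a = aut g ?b |- _ =>
           apply (f_equal (aut_inv g)) in H; rewrite !aut_invK in H
       end; lra);
  rewrite <- gfun_equivariant; f_equal; now apply sig_eq.
Qed.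

Lemma plane_is_coproduct : is_coproduct plane_inj.
Proof.
  intros Z f.
  exists ({| gfun := plane_glue f; gfun_equivariant := plane_glue_equivariant f |}
            : @Hom SG plane Z).
  split.
  - intros []; apply gmap_eq; simpl; unfold plane_glue; simpl.
    + intros x; destruct total_order_T as [[L|E]|L]; try (exfalso; lra); reflexivity.
    + intros [[x y] H]; simpl in *.
      destruct total_order_T as [[L|E]|L]; try (exfalso; lra).
      f_equal; now apply sig_eq.
    + intros [[x y] H]; simpl in *.
      destruct total_order_T as [[L|E]|L]; try (exfalso; lra).
      f_equal; now apply sig_eq.
  - intros h Hh; apply gmap_eq; intros [x y]; simpl; unfold plane_glue; simpl.
    destruct total_order_T as [[L|E]|L]; rewrite <- Hh; simpl; congruence.
Qed.

Local Close Scope R_scope.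

Lemma Finite_comparison : Finite comparison.
Proof. exists (Eq :: Lt :: Gt :: nil); intros []; simpl; auto. Qed.

Definition square_map (S : Category) {HL : has_finite_limits S} (F : Functor SG S) :
    Hom (F plane) (bprod (F line) (F line)) :=
  pairing (fmap F plane_fst) (fmap F plane_snd).

Lemma square_map_iso (S : Category) {HL : has_finite_limits S} (F : Functor SG S) :
  left_exact F -> is_iso (square_map F).
Proof.
  intros HF.
  pose proof (left_exact_product HF plane_is_product) as HP.
  destruct (HP _ (@pr1 S HL (F line) (F line)) (@pr2 S HL (F line) (F line)))
    as [k [[K1 K2] _]].
  exists k; split.
  - destruct (HP _ (fmap F plane_fst) (fmap F plane_snd)) as [u [_ Hu]].
    rewrite <- (Hu (k ∘ square_map F)), <- (Hu (idm _)); auto.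
    + now rewrite !comp_id_r.
    + unfold square_map; rewrite !comp_assoc, K1, K2.
      now rewrite pr1_pairing, pr2_pairing.
  - apply bprod_ext; unfold square_map; rewrite comp_assoc, comp_id_r.
    + now rewrite pr1_pairing.
    + now rewrite pr2_pairing.
Qed.

Lemma iso_mono (C : Category) (X Y : C) (f : Hom X Y) : is_iso f -> is_mono f.
Proof.
  intros [g [Hg _]] Z a b E.
  rewrite <- (comp_id_l a), <- (comp_id_l b), <- Hg, <- !comp_assoc; now rewrite E.
Qed.

Lemma iso_comp (C : Category) (X Y Z : C) (g : Hom Y Z) (f : Hom X Y) :
  is_iso g -> is_iso f -> is_iso (g ∘ f).
Proof.
  intros [g' [G1 G2]] [f' [F1 F2]]; exists (f' ∘ g'); split.
  - now rewrite comp_assoc, <- (comp_assoc f' g' g), G1, comp_id_r.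
  - now rewrite comp_assoc, <- (comp_assoc g f f'), F2, comp_id_r.
Qed.

(* F({x < y}) -> F(R^2) -> F(R) x F(R), where the last map, invertible by left
   exactness, compares F(R^2) with the chosen product. *)
Definition induced_rel (S : Category) {HL : has_finite_limits S} (F : Functor SG S)
    (HF : left_exact F) : Subobject (bprod (F line) (F line)) :=
  {| sub_dom := F less;
     sub_arr := square_map F ∘ fmap F less_incl;
     sub_mono := mono_comp (iso_mono (square_map_iso HF))
                   (left_exact_mono HF less_incl_mono) |}.

Lemma induced_total (S : Category) {HL : has_finite_limits S}
    {HC : has_finite_coproducts S} (F : Functor SG S) (HF : left_exact F) :
  additive F -> relation_total (induced_rel HF).
Proof.
  intros HA; unfold relation_total; simpl.
  set (k := copairing (copairing (fmap F less_incl) (fmap F line_diag))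
                      (fmap F greater_incl)).
  assert (Hk : is_iso k).
  { pose proof (HA _ Finite_comparison _ _ _ plane_is_coproduct) as HP.
    destruct (HP _ (fun c => match c return
         Hom (F (plane_part c)) (bcoprod (bcoprod (F less) (F line)) (F less)) with
         | Lt => in1 ∘ in1 | Eq => in1 ∘ in2 | Gt => in2 end)) as [j [Hj _]].
    pose proof (Hj Lt) as JL; pose proof (Hj Eq) as JE; pose proof (Hj Gt) as JG.
    simpl in JL, JE, JG.
    exists j; split.
    - apply bcoprod_ext; [apply bcoprod_ext|];
      rewrite comp_id_l, <- ?comp_assoc; unfold k;
      rewrite ?copairing_in2, ?(comp_assoc _ in1 _), ?copairing_in1, ?copairing_in2;
      assumption.
    - destruct (HP _ (fun c => fmap F (plane_inj c))) as [u [_ Hu]].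
      rewrite <- (Hu (k ∘ j)), <- (Hu (idm _)); [reflexivity | intros; apply comp_id_l |].
      intros []; rewrite <- comp_assoc; simpl; rewrite ?JL, ?JE, ?JG; unfold k;
      rewrite ?comp_assoc, ?copairing_in1, ?copairing_in2; reflexivity. }
  match goal with |- is_iso ?m => assert (E : m = square_map F ∘ k) end.
  { unfold k; rewrite !comp_copairing; f_equal; [f_equal|].
    - unfold square_map, diagonal_map; rewrite pairing_comp, <- !fmap_comp.
      f_equal; rewrite <- fmap_id; f_equal; now apply gmap_eq.
    - unfold square_map, switch; rewrite !pairing_comp.
      rewrite pr1_pairing, pr2_pairing, <- !fmap_comp.
      f_equal; f_equal; now apply gmap_eq. }
  rewrite E; apply iso_comp; [now apply square_map_iso | exact Hk].
Qed.

Lemma induced_trans (S : Category) {HL : has_finite_limits S} (F : Functor SG S)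
    (HF : left_exact F) : relation_transitive (induced_rel HF).
Proof.
  apply relation_transitive_criterion; intros Z z [u Hu] [v Hv].
  cbn [sub_arr sub_dom induced_rel] in u, v, Hu, Hv.
  destruct (left_exact_pullback HF less3_is_pullback) as [_ HP].
  pose proof (f_equal (comp pr1) Hu) as U1; pose proof (f_equal (comp pr2) Hu) as U2.
  pose proof (f_equal (comp pr1) Hv) as V1; pose proof (f_equal (comp pr2) Hv) as V2.
  unfold square_map, p12, p23 in U1, U2, V1, V2.
  rewrite !comp_assoc, pr1_pairing, <- fmap_comp in U1.
  rewrite !comp_assoc, pr2_pairing, <- fmap_comp in U2.
  rewrite !comp_assoc, !pr1_pairing, <- fmap_comp in V1.
  rewrite !comp_assoc, !pr2_pairing, <- fmap_comp in V2.
  destruct (HP _ u v) as [w [[W1 W2] _]].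
  { exact (eq_trans U2 (eq_sym V1)). }
  exists (fmap F less3_13 ∘ w); cbn [sub_arr sub_dom induced_rel].
  apply bprod_ext; unfold square_map, p13;
  rewrite !comp_assoc, ?pr1_pairing, ?pr2_pairing, <- !fmap_comp.
  - refine (eq_trans _ U1); rewrite <- W1, comp_assoc, <- fmap_comp.
    now replace (plane_fst ∘ less_incl ∘ less3_13)
      with (plane_fst ∘ less_incl ∘ less3_12) by now apply gmap_eq.
  - refine (eq_trans _ V2); rewrite <- W2, comp_assoc, <- fmap_comp.
    now replace (plane_snd ∘ less_incl ∘ less3_13)
      with (plane_snd ∘ less_incl ∘ less3_23) by now apply gmap_eq.
Qed.

Definition eval_line_ob (S : Category) {HL : has_finite_limits S}
    {HC : has_finite_coproducts S} (F : LEx SG S) : Ord S :=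
  {| ord_car := proj1_sig F line;
     ord_rel := induced_rel (proj2 (proj2_sig F));
     ord_total := induced_total (proj2 (proj2_sig F)) (proj1 (proj2_sig F));
     ord_trans := induced_trans (proj2 (proj2_sig F)) |}.

Lemma eval_line_monotonic (S : Category) {HL : has_finite_limits S}
    {HC : has_finite_coproducts S} (F G : LEx SG S) (s : Hom F G) :
  monotonic (eval_line_ob F) (eval_line_ob G) (nt s line).
Proof.
  apply monotonicE; exists (nt s less); simpl.
  apply bprod_ext; unfold square_map, bprod_map;
  rewrite !comp_assoc, ?pr1_pairing, ?pr2_pairing, <- !fmap_comp, <- nt_natural,
    fmap_comp, !comp_assoc.
  - now rewrite <- (comp_assoc _ pr1), pr1_pairing.
  - now rewrite <- (comp_assoc _ pr2), pr2_pairing.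
Qed.

Program Definition eval_line (S : Category) {HS : lextensive S} :
    Functor (LEx SG S) (Ord S) :=
  {| fob := fun F => eval_line_ob F;
     fmap := fun F G s => exist _ (nt s line) (eval_line_monotonic s) |}.
Next Obligation. intros; now apply sig_eq. Qed.
Next Obligation. intros; now apply sig_eq. Qed.

(* Main.v *)
(* The stabilizer of a point of a G-set in S(G) is the pointwise stabilizer of a
   unique finite set of reals, so each such G-set is a finite sum of the G-sets
   Emb A of order embeddings A -> R, with A finite.  Given an
   ordered object X, let conf A represent the strictly monotone maps from A to X, and
   let psi Y be the sum of the conf (supp i) over the orbits i of Y.  A point y of Y
   supported by A and a strictly monotone c : A -> X(Z) define a morphism
   Z -> psi Y.  Locally for finite coproduct decompositions of Z: every morphism
   Z -> psi Y is of this form; finitely many such morphisms admit a common c, because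
   elements of X become comparable and R is a dense homogeneous order; and c determines
   y unless Z is initial.  Hence a cone over psi of a finite diagram of G-sets is, on
   each noninitial piece, a compatible family of points supported by A, that is, a point of
   the limit; so psi is left exact.  Conversely a left-exact F sends Emb A to the object
   of strictly monotone maps from A to F(R), since Emb A is the corresponding limit
   in S(G), and additivity then determines F from the ordered object F(R). *)

From Stdlib Require Import Reals Lra List FinFun FunctionalExtensionality
  PropExtensionality ProofIrrelevance ClassicalEpsilon.
Require Import Defs.

Set Implicit Arguments.
Unset Strict Implicit.
Unset Printing Implicit Defensive.

#[local] Obligation Tactic := idtac.

Local Open Scope R_scope.

(** * Order automorphisms of the line *)

(** Every strictly increasing map between finite sets of reals extends to an automorphism of the
    line. This one fact makes [Emb A] the set of all order embeddings, exhibits it as a limit of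
    copies of the line, and lets embeddings of index sets act on points of G-sets. An order
    automorphism that preserves a finite set fixes each of its points, so no quotient of [Emb A] by
    a finite group of permutations occurs as an orbit. An object of S has no points to argue with.
    Morphisms Z -> X serve as elements, and a comparison of two of them is decided only after Z has
    been cut into summands. On an initial Z every relation holds, even x < x, so each argument by
    contradiction is preceded by a case distinction on whether Z is initial. Left exactness is shown
    for all finite diagrams at once. Checking binary products directly would require listing the
    orbits of [Emb A] x [Emb B], that is, all relative positions of A and B. Putting the elements of
    a cone on a common chart replaces this enumeration. *)

Lemma aut_eq (g h : autR) : (forall x, g x = h x) -> g = h.
Proof.
  destruct g as [g g' gK gK' gL], h as [h h' hK hK' hL]; simpl; intros E.
  assert (g = h) by now apply functional_extensionality. subst h.
  assert (g' = h').
  { apply functional_extensionality; intros x.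
    now rewrite <- (hK' x) at 1; rewrite gK. }
  subst h'; f_equal; apply proof_irrelevance.
Qed.

Definition aut_inverse (g : autR) : autR :=
  {| aut := aut_inv g; aut_inv := g; aut_invK := autK g; autK := aut_invK g;
     aut_lt := fun x y H => proj1 (aut_lt_iff g (aut_inv g x) (aut_inv g y))
       (eq_ind_r (fun u => u < g (aut_inv g y))
          (eq_ind_r (fun v => x < v) H (autK g y)) (autK g x)) |}.

Lemma aut_inverse_l (g : autR) : aut_mul (aut_inverse g) g = aut_one.
Proof. apply aut_eq; intros x; apply aut_invK. Qed.

Lemma aut_inverse_r (g : autR) : aut_mul g (aut_inverse g) = aut_one.
Proof. apply aut_eq; intros x; apply autK. Qed.

(** The piecewise linear map that is the identity outside [p, q] and sends x to y. The third branch
    is measured from q, so that both inner branches are scalings of a nonnegative length. Exchanging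
    x and y gives the inverse. *)
Definition bump_fun (p q x y t : R) : R :=
  if Rle_dec t p then t
  else if Rle_dec t x then p + (y - p) / (x - p) * (t - p)
  else if Rle_dec t q then q - (q - y) / (q - x) * (q - t)
  else t.

(** With this and the next two facts a slope can be treated as an opaque term, which leaves only
    linear arithmetic in the case analyses on [bump_fun]. *)
Lemma scale_lt (a b s t : R) : 0 < a -> 0 < b -> s < t -> b / a * s < b / a * t.
Proof. intros; apply Rmult_lt_compat_l; [now apply Rdiv_lt_0_compat | assumption]. Qed.

Lemma scaleK (a b s : R) : 0 < a -> 0 < b -> a / b * (b / a * s) = s.
Proof. intros; field; lra. Qed.

Lemma scale_end (a b : R) : 0 < a -> b / a * a = b.
Proof. intros; field; lra. Qed.

Lemma bump_lt (p q x y : R) : p < x < q -> p < y < q ->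
  forall s t, s < t -> bump_fun p q x y s < bump_fun p q x y t.
Proof.
  intros [X1 X2] [Y1 Y2] s t H.
  assert (A : forall u, u <= x -> (y - p) / (x - p) * (u - p) <= y - p).
  { intros u Hu; destruct (Req_dec u x) as [->|]; [rewrite scale_end; lra|].
    pose proof (@scale_lt (x - p) (y - p) (u - p) (x - p)) as K.
    rewrite scale_end in K; lra. }
  assert (B : forall u, x <= u -> (q - y) / (q - x) * (q - u) <= q - y).
  { intros u Hu; destruct (Req_dec u x) as [->|]; [rewrite scale_end; lra|].
    pose proof (@scale_lt (q - x) (q - y) (q - u) (q - x)) as K.
    rewrite scale_end in K; lra. }
  assert (B' : forall u, x < u -> (q - y) / (q - x) * (q - u) < q - y).
  { intros u Hu.
    pose proof (@scale_lt (q - x) (q - y) (q - u) (q - x)) as K.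
    rewrite scale_end in K; lra. }
  assert (A0 : forall u, p < u -> 0 < (y - p) / (x - p) * (u - p)).
  { intros u Hu; apply Rmult_lt_0_compat; [apply Rdiv_lt_0_compat|]; lra. }
  assert (B0 : forall u, u <= q -> 0 <= (q - y) / (q - x) * (q - u)).
  { intros u Hu; apply Rmult_le_pos; [apply Rlt_le, Rdiv_lt_0_compat|]; lra. }
  pose proof (@scale_lt (x - p) (y - p) (s - p) (t - p)) as SA.
  pose proof (@scale_lt (q - x) (q - y) (q - t) (q - s)) as SB.
  unfold bump_fun;
  repeat match goal with |- context [Rle_dec ?a ?b] => destruct (Rle_dec a b) end;
  try lra;
  try (pose proof (A0 t)); try (pose proof (B0 s)); try (pose proof (A s));
  try (pose proof (B' t)); lra.
Qed.

Lemma bumpK (p q x y : R) : p < x < q -> p < y < q ->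
  forall t, bump_fun p q y x (bump_fun p q x y t) = t.
Proof.
  intros [X1 X2] [Y1 Y2] t.
  assert (A : p < t <= x -> bump_fun p q y x (p + (y - p) / (x - p) * (t - p)) = t).
  { intros [T1 T2].
    assert (0 < (y - p) / (x - p) * (t - p)).
    { apply Rmult_lt_0_compat; [apply Rdiv_lt_0_compat|]; lra. }
    assert ((y - p) / (x - p) * (t - p) <= y - p).
    { destruct (Req_dec t x) as [->|]; [rewrite scale_end; lra|].
      pose proof (@scale_lt (x - p) (y - p) (t - p) (x - p)) as K.
      rewrite scale_end in K; lra. }
    unfold bump_fun; destruct Rle_dec; [lra|]; destruct Rle_dec; [|lra].
    replace (p + (y - p) / (x - p) * (t - p) - p) with ((y - p) / (x - p) * (t - p))
      by ring.
    rewrite scaleK; lra. }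
  assert (B : x < t <= q -> bump_fun p q y x (q - (q - y) / (q - x) * (q - t)) = t).
  { intros [T1 T2].
    assert (0 <= (q - y) / (q - x) * (q - t)).
    { apply Rmult_le_pos; [apply Rlt_le, Rdiv_lt_0_compat|]; lra. }
    assert ((q - y) / (q - x) * (q - t) < q - y).
    { pose proof (@scale_lt (q - x) (q - y) (q - t) (q - x)) as K.
      rewrite scale_end in K; lra. }
    unfold bump_fun; destruct Rle_dec; [lra|]; destruct Rle_dec; [lra|].
    destruct Rle_dec; [|lra].
    replace (q - (q - (q - y) / (q - x) * (q - t))) with ((q - y) / (q - x) * (q - t))
      by ring.
    rewrite scaleK; lra. }
  unfold bump_fun at 2.
  destruct (Rle_dec t p); [unfold bump_fun; destruct Rle_dec; lra|].
  destruct (Rle_dec t x); [apply A; lra|].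
  destruct (Rle_dec t q); [apply B; lra|].
  unfold bump_fun; repeat (destruct Rle_dec; try lra).
Qed.

Lemma aut_bump (p q x y : R) : p < x < q -> p < y < q ->
  exists g : autR, g x = y /\ forall t, t <= p \/ q <= t -> g t = t.
Proof.
  intros X Y.
  exists {| aut := bump_fun p q x y; aut_inv := bump_fun p q y x;
            aut_invK := bumpK X Y; autK := bumpK Y X; aut_lt := bump_lt X Y |}.
  simpl; split.
  - unfold bump_fun; repeat (destruct Rle_dec; try lra). rewrite scale_end; lra.
  - intros t Ht; unfold bump_fun; repeat (destruct Rle_dec; try lra).
    replace t with q by lra; ring.
Qed.

Lemma gap_right (L : list R) (c : R) : exists q, c < q /\ forall l, In l L -> ~ (c < l < q).
Proof.
  induction L as [|l L [q [Hq HL]]].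
  - exists (c + 1); split; [lra | intros l []].
  - destruct (Rlt_dec c l).
    + exists (Rmin l q); split; [now apply Rmin_glb_lt|].
      pose proof (Rmin_l l q); pose proof (Rmin_r l q).
      intros u [<-|Hu]; [lra|]. specialize (HL u Hu); lra.
    + exists q; split; [assumption|]. intros u [<-|Hu]; [lra|now apply HL].
Qed.

Lemma gap_left (L : list R) (c : R) : exists p, p < c /\ forall l, In l L -> ~ (p < l < c).
Proof.
  destruct (gap_right (map Ropp L) (- c)) as [q [Hq HL]].
  exists (- q); split; [lra|]; intros l Hl Hc.
  apply (HL (- l)); [now apply in_map | lra].
Qed.

(** Points are corrected one at a time: if g is already right on the tail, compose it with a bump
    carrying [g a] to [phi a] that leaves the values already attained in place. *)
Lemma aut_extend (A : list R) (phi : R -> R) :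
  (forall a b, In a A -> In b A -> a < b -> phi a < phi b) ->
  exists g : autR, forall a, In a A -> g a = phi a.
Proof.
  induction A as [|a A IH]; intros H.
  - exists aut_one; intros a [].
  - destruct IH as [g Hg]; [intros; apply H; simpl; auto|].
    (* For b in the tail other than a, [phi b = g b] lies on the same side of [g a] and of [phi a],
       because g and phi both increase. The interval from p to q can therefore be chosen to contain
       both of these and no such value. *)
    destruct (gap_left (map phi A) (Rmin (g a) (phi a))) as [p [P1 P2]].
    destruct (gap_right (map phi A) (Rmax (g a) (phi a))) as [q [Q1 Q2]].
    pose proof (Rmin_l (g a) (phi a)); pose proof (Rmin_r (g a) (phi a)).
    pose proof (Rmax_l (g a) (phi a)); pose proof (Rmax_r (g a) (phi a)).
    destruct (@aut_bump p q (g a) (phi a)) as [k [K1 K2]]; [lra | lra |].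
    exists (aut_mul k g); simpl; intros b [<-|Hb]; [assumption|].
    rewrite (Hg b Hb).
    pose proof (P2 _ (in_map phi _ _ Hb)) as P3.
    pose proof (Q2 _ (in_map phi _ _ Hb)) as Q3.
    destruct (Rtotal_order b a) as [L|[E|L]].
    + apply K2; left. pose proof (@aut_lt g _ _ L) as Lg; rewrite (Hg b Hb) in Lg.
      assert (phi b < phi a) by (apply H; simpl; auto).
      pose proof (Rmin_glb_lt _ _ _ Lg H4); lra.
    + subst b; now rewrite <- (Hg a Hb) at 1.
    + apply K2; right. pose proof (@aut_lt g _ _ L) as Lg; rewrite (Hg b Hb) in Lg.
      assert (phi a < phi b) by (apply H; simpl; auto).
      pose proof (Rmax_lub_lt _ _ _ Lg H4); lra.
Qed.

(** A list stands for the finite set of its members: two points with the same real value are equal,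
    so repetitions do no harm. *)
Definition pt (A : list R) : Type := {a : R | In a A}.

Lemma aut_extend_pt (A : list R) (phi : pt A -> R) :
  (forall a b : pt A, proj1_sig a < proj1_sig b -> phi a < phi b) ->
  exists g : autR, forall a : pt A, g (proj1_sig a) = phi a.
Proof.
  intros H.
  destruct (@aut_extend A (fun r => match excluded_middle_informative (In r A) with
    | left Hr => phi (exist _ r Hr) | right _ => 0 end)) as [g Hg].
  - intros a b Ha Hb L.
    destruct excluded_middle_informative; [|contradiction].
    destruct excluded_middle_informative; [|contradiction].
    now apply H.
  - exists g; intros [a Ha]; simpl; rewrite (Hg a Ha).
    destruct excluded_middle_informative; [|contradiction].
    f_equal; now apply sig_eq.
Qed.

(** A point outside A is moved by a bump supported in an interval that avoids A. Hence a finite set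
    is recovered from its pointwise stabilizer, which makes exact supports unique. *)
Lemma fixes_incl (A B : list R) : (forall h, fixes A h -> fixes B h) -> incl B A.
Proof.
  intros H b Hb; apply NNPP; intros Hn.
  destruct (gap_left A b) as [p [P1 P2]], (gap_right A b) as [q [Q1 Q2]].
  destruct (@aut_bump p q b ((b + q) / 2)) as [k [K1 K2]]; [lra | lra |].
  assert (k b = b); [|lra].
  apply (H k); [|assumption]. intros a Ha.
  specialize (P2 a Ha); specialize (Q2 a Ha).
  destruct (Req_dec a b); [subst; contradiction|]. apply K2; lra.
Qed.

Lemma fixes_conj (A : list R) (g h : autR) :
  fixes (map g A) h -> fixes A (aut_mul (aut_inverse g) (aut_mul h g)).
Proof. intros H a Ha; simpl; rewrite H by now apply in_map. apply aut_invK. Qed.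

Lemma least_in_list (P : R -> Prop) (A : list R) :
  (exists a, In a A /\ P a) ->
  exists a, In a A /\ P a /\ forall b, In b A -> P b -> a <= b.
Proof.
  induction A as [|c A IH]; intros [a [Ha Pa]]; [destruct Ha|].
  destruct (classic (exists a, In a A /\ P a)) as [Hs|Hn].
  - destruct (IH Hs) as [m [M1 [M2 M3]]].
    destruct (classic (P c /\ c < m)) as [[Pc Lc]|Nc].
    + exists c; simpl; repeat split; auto.
      intros b [<-|Hb] Pb; [lra|]. specialize (M3 b Hb Pb); lra.
    + exists m; simpl; repeat split; auto.
      intros b [<-|Hb] Pb; [|now apply M3].
      destruct (Rle_dec m c); [assumption|]. exfalso; apply Nc; split; [assumption|lra].
  - destruct Ha as [<-|Ha]; [|exfalso; apply Hn; eauto].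
    exists c; simpl; repeat split; auto.
    intros b [<-|Hb] Pb; [lra|]. exfalso; eauto.
Qed.

(** * Supports in G-sets *)

Definition supports (Y : GSet) (A : list R) (y : Y) : Prop :=
  forall h, fixes A h -> gact h y = y.

Lemma gact_inverse_l (Y : GSet) (g : autR) (y : Y) : gact (aut_inverse g) (gact g y) = y.
Proof. now rewrite <- gact_mul, aut_inverse_l, gact_one. Qed.

Lemma gact_inverse_r (Y : GSet) (g : autR) (y : Y) : gact g (gact (aut_inverse g) y) = y.
Proof. now rewrite <- gact_mul, aut_inverse_r, gact_one. Qed.

Lemma gact_inverse_fix (Y : GSet) (g : autR) (y : Y) :
  gact g y = y -> gact (aut_inverse g) y = y.
Proof. intros E; now rewrite <- E at 1; rewrite gact_inverse_l. Qed.

Lemma supports_act (Y : GSet) (A : list R) (y : Y) (g : autR) :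
  supports A y -> supports (map g A) (gact g y).
Proof.
  intros H h Hh; pose proof (H _ (fixes_conj Hh)) as E.
  rewrite !gact_mul in E. now rewrite <- E at 2; rewrite gact_inverse_r.
Qed.

Lemma supports_incl (Y : GSet) (A B : list R) (y : Y) :
  incl A B -> supports A y -> supports B y.
Proof. intros HI H h Hh; apply H; intros a Ha; apply Hh; now apply HI. Qed.

Lemma supports_map (Y Y' : GSet) (f : GMap Y Y') (A : list R) (y : Y) :
  supports A y -> supports A (f y).
Proof. intros H h Hh; rewrite <- gfun_equivariant; now rewrite H. Qed.

Lemma gact_agree (Y : GSet) (A : list R) (y : Y) (g g' : autR) :
  supports A y -> (forall a, In a A -> g a = g' a) -> gact g y = gact g' y.
Proof.
  intros H E.
  assert (F : gact (aut_mul (aut_inverse g') g) y = y).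
  { apply H; intros a Ha; simpl; rewrite E by assumption; apply aut_invK. }
  rewrite gact_mul in F. now rewrite <- F at 2; rewrite gact_inverse_r.
Qed.

(* With B = g A, the stabilizer of y contains the pointwise stabilizers of A and of
   B, and a is not in B.  An element h fixing A \ {a} with h a > a agrees on A with
   m k, where k fixes B and A \ {a} and moves a up slightly, and m fixes A. *)
Lemma supports_remove (Y : GSet) (A : list R) (y : Y) (g : autR) (a : R) :
  supports A y -> gact g y = y -> In a A -> a < g a ->
  (forall b, In b A -> b < a -> g b = b) ->
  supports (remove Req_dec_T a A) y.
Proof.
  intros HA Hg Ha Hga Hlt.
  assert (HB : supports (map g A) y) by (rewrite <- Hg; now apply supports_act).
  assert (aB : ~ In a (map g A)).
  { intros Hin; apply in_map_iff in Hin; destruct Hin as [a' [E Ha']].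
    assert (a' < a) by (apply (aut_lt_iff g); lra).
    rewrite Hlt in E; auto; lra. }
  assert (Up : forall h, fixes (remove Req_dec_T a A) h -> a < h a -> gact h y = y).
  { intros h Hh Hup.
    destruct (gap_left (map g A ++ A) a) as [p [P1 P2]].
    destruct (gap_right (map g A ++ A) a) as [q [Q1 Q2]].
    set (a' := (a + Rmin q (h a)) / 2).
    pose proof (Rmin_l q (h a)); pose proof (Rmin_r q (h a)).
    assert (a < Rmin q (h a)) by now apply Rmin_glb_lt.
    destruct (@aut_bump p q a a') as [k [K1 K2]]; [lra | unfold a'; lra |].
    assert (Kfix : forall b, In b (map g A ++ A) -> b <> a -> k b = b).
    { intros b Hb Nb; specialize (P2 b Hb); specialize (Q2 b Hb); apply K2; lra. }
    destruct (gap_right A (h a)) as [r [R1 R2]].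
    destruct (@aut_bump a r a' (h a)) as [m [M1 M2]]; [unfold a'; lra | lra |].
    assert (Hm : fixes A m).
    { intros b Hb; apply M2.
      destruct (Rle_dec b a); [now left|right].
      apply Rnot_lt_le; intros Hbr; apply (R2 b Hb); split; [|assumption].
      apply Rnot_le_lt; intros Hle.
      assert (h b = b).
      { apply Hh; apply in_in_remove; [intros ->; lra | assumption]. }
      assert (a < b) as L by lra. apply (@aut_lt h) in L; lra. }
    rewrite (@gact_agree Y A y h (aut_mul m k)); [|assumption|].
    - rewrite gact_mul, (HB k), (HA m); auto.
      intros b Hb; apply Kfix; [apply in_or_app; now left|]. intros ->; contradiction.
    - intros b Hb; simpl.
      destruct (Req_dec_T b a) as [->|Nb]; [now rewrite K1, M1|].
      rewrite Kfix, Hm; auto; [|apply in_or_app; now right].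
      apply Hh; now apply in_in_remove. }
  intros h Hh.
  destruct (Rtotal_order a (h a)) as [L|[E|L]].
  - now apply Up.
  - apply HA; intros b Hb; destruct (Req_dec_T b a) as [->|Nb]; [now symmetry|].
    apply Hh; now apply in_in_remove.
  - replace h with (aut_inverse (aut_inverse h)) by now apply aut_eq.
    apply gact_inverse_fix, Up.
    + intros b Hb; simpl; rewrite <- (Hh b Hb) at 1; apply aut_invK.
    + simpl; apply (aut_lt_iff h); now rewrite autK.
Qed.

Lemma supports_exists (Y : GSet) (y : Y) : exists A, supports A y.
Proof.
  destruct (gact_open (gact_one y)) as [A HA]; exists A; intros h Hh.
  rewrite <- (HA h Hh) at 2; f_equal; now apply aut_eq.
Qed.

Lemma exact_support_exists (Y : GSet) (y : Y) :
  exists A, forall g, gact g y = y <-> fixes A g.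
Proof.
  destruct (supports_exists y) as [A HA].
  remember (length A) as n eqn:En.
  revert A HA En; induction n as [n IH] using (well_founded_induction Wf_nat.lt_wf).
  intros A HA ->.
  destruct (classic (exists g a, gact g y = y /\ In a A /\ g a <> a)) as [H|H].
  - destruct H as [g [a0 [Hg [Ha0 Na0]]]].
    (* Taking the least moved point ensures that g fixes everything below it in A, which keeps it
       out of the image g A. *)
    destruct (@least_in_list (fun a => g a <> a) A) as [a [Ha [Na Hleast]]]; [eauto|].
    assert (Hlt : forall b, In b A -> b < a -> g b = b).
    { intros b Hb L; apply NNPP; intros Nb; specialize (Hleast b Hb Nb); lra. }
    refine (IH _ (remove_length_lt Req_dec_T A a Ha) (remove Req_dec_T a A) _ eq_refl).
    (* If g moves the point down, its inverse moves it up and still stabilizes y. *)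
    destruct (Rtotal_order a (g a)) as [L|[E|L]]; [|congruence|].
    + now apply supports_remove with g.
    + apply supports_remove with (aut_inverse g); auto.
      * now apply gact_inverse_fix.
      * simpl; apply (aut_lt_iff g); now rewrite autK.
      * intros b Hb Lb; simpl; rewrite <- (Hlt b Hb Lb) at 1; apply aut_invK.
  - exists A; intros g; split; [|apply HA].
    intros Hg a Ha; apply NNPP; intros Na; apply H; now exists g, a.
Qed.

(** [epsilon] depends only on the predicate, and points of one orbit define the same predicate. The
    choice is thus constant on orbits, and orbits can be encoded by their representatives instead of
    by a quotient. *)
Definition orb_rep (Y : GSet) (y : Y) : Y :=
  epsilon (inhabits y) (fun y' => exists g, gact g y = y').

Lemma orb_rep_spec (Y : GSet) (y : Y) : exists g, gact g y = orb_rep y.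
Proof.
  unfold orb_rep; apply (epsilon_spec (inhabits y) (fun y' => exists g, gact g y = y')).
  exists y, aut_one; apply gact_one.
Qed.

Lemma orb_rep_act (Y : GSet) (y : Y) (g : autR) : orb_rep (gact g y) = orb_rep y.
Proof.
  unfold orb_rep.
  rewrite (proof_irrelevance _ (inhabits (gact g y)) (inhabits y)); f_equal.
  apply functional_extensionality; intros y'; apply propositional_extensionality.
  split; intros [h <-].
  - exists (aut_mul h g); apply gact_mul.
  - exists (aut_mul h (aut_inverse g)).
    now rewrite <- gact_mul; f_equal; apply aut_eq; intros x; simpl; rewrite aut_invK.
Qed.

Lemma orb_rep_idem (Y : GSet) (y : Y) : orb_rep (orb_rep y) = orb_rep y.
Proof. destruct (orb_rep_spec y) as [g E]; rewrite <- E at 1; apply orb_rep_act. Qed.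

Definition orbits (Y : GSet) : Type := {y : Y | orb_rep y = y}.

Definition orb (Y : GSet) (y : Y) : orbits Y := exist _ (orb_rep y) (orb_rep_idem y).

Lemma orb_act (Y : GSet) (y : Y) (g : autR) : orb (gact g y) = orb y.
Proof. apply sig_eq, orb_rep_act. Qed.

Lemma orb_self (Y : GSet) (i : orbits Y) : orb (proj1_sig i) = i.
Proof. apply sig_eq; exact (proj2_sig i). Qed.

Lemma transport_exists (Y : GSet) (y : Y) : exists g, gact g (proj1_sig (orb y)) = y.
Proof.
  destruct (orb_rep_spec y) as [g E]; exists (aut_inverse g); simpl.
  rewrite <- E; apply gact_inverse_l.
Qed.

Definition transport (Y : GSet) (y : Y) : autR :=
  proj1_sig (constructive_indefinite_description _ (transport_exists y)).

Lemma transport_spec (Y : GSet) (y : Y) : gact (transport y) (proj1_sig (orb y)) = y.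
Proof. exact (proj2_sig (constructive_indefinite_description _ (transport_exists y))). Qed.

Lemma orbits_finite (Y : GSet) : Finite (orbits Y).
Proof.
  destruct (gact_orbits Y) as [l Hl]; exists (map (@orb Y) l); intros i.
  destruct (Hl (proj1_sig i)) as [y [Hy [g Hg]]].
  apply in_map_iff; exists y; split; [|assumption].
  rewrite <- (orb_self i), <- Hg; symmetry; apply orb_act.
Qed.

Definition supp (Y : GSet) (i : orbits Y) : list R :=
  proj1_sig (constructive_indefinite_description _ (exact_support_exists (proj1_sig i))).

Lemma supp_spec (Y : GSet) (i : orbits Y) (g : autR) :
  gact g (proj1_sig i) = proj1_sig i <-> fixes (supp i) g.
Proof.
  exact (proj2_sig
    (constructive_indefinite_description _ (exact_support_exists (proj1_sig i))) g).
Qed.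

Lemma supp_supports (Y : GSet) (i : orbits Y) : supports (supp i) (proj1_sig i).
Proof. intros h; apply supp_spec. Qed.

(** The inverse of h composed with g stabilizes the representative, hence fixes its exact support.
    So [transport y], which is chosen arbitrarily, has well-determined values on the support; a
    support that is not exact gives only the converse [gact_agree]. *)
Lemma supp_agree (Y : GSet) (i : orbits Y) (g h : autR) :
  gact g (proj1_sig i) = gact h (proj1_sig i) -> forall a, In a (supp i) -> g a = h a.
Proof.
  intros E a Ha.
  assert (F : fixes (supp i) (aut_mul (aut_inverse h) g)).
  { apply supp_spec; rewrite gact_mul, E; apply gact_inverse_l. }
  specialize (F a Ha); simpl in F; now rewrite <- F at 2; rewrite autK.
Qed.

(** The exact support is the least one: whatever fixes A stabilizes y, hence fixes the transported
    support pointwise, and [fixes_incl] turns this into an inclusion of sets. *)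
Lemma transport_supp (Y : GSet) (A : list R) (y : Y) :
  supports A y -> forall a, In a (supp (orb y)) -> In (transport y a) A.
Proof.
  intros H a Ha.
  assert (HI : incl (map (transport y) (supp (orb y))) A).
  { apply fixes_incl; intros h Hh b Hb.
    apply in_map_iff in Hb; destruct Hb as [c [<- Hc]].
    apply (@supp_agree Y (orb y) (aut_mul h (transport y)) (transport y)); [|assumption].
    rewrite gact_mul, transport_spec; now apply H. }
  apply HI; now apply in_map.
Qed.

Lemma transport_self (Y : GSet) (i : orbits Y) :
  forall a, In a (supp i) -> transport (proj1_sig i) a = a.
Proof.
  intros a Ha; apply (@supp_agree Y i (transport (proj1_sig i)) aut_one); [|assumption].
  rewrite gact_one. rewrite <- (orb_self i) at 2; apply transport_spec.
Qed.

Local Open Scope cat_scope.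

(** * Equivalences and extensivity *)

(** Choice supplies preimages of morphisms and of objects; every identity required of the
    quasi-inverse is checked after applying [F], by faithfulness. *)
Lemma equivalence_criterion (C D : Category) (F : Functor C D) :
  (forall X Y (h : Hom (F X) (F Y)), exists u : Hom X Y, fmap F u = h) ->
  (forall X Y (u v : Hom X Y), fmap F u = fmap F v -> u = v) ->
  (forall Y : D, exists (X : C) (e : Hom (F X) Y), is_iso e) ->
  is_equivalence F.
Proof.
  intros Full Faith Surj.
  pose (pre := fun X Y (h : Hom (F X) (F Y)) =>
    proj1_sig (constructive_indefinite_description _ (Full X Y h))).
  assert (preE : forall X Y h, fmap F (pre X Y h) = h).
  { intros X Y h;
    exact (proj2_sig (constructive_indefinite_description _ (Full X Y h))). }
  clearbody pre.
  assert (Surj' : forall Y : D,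
    exists q : {X : C & (Hom (F X) Y * Hom Y (F X))%type},
      snd (projT2 q) ∘ fst (projT2 q) = idm _ /\
      fst (projT2 q) ∘ snd (projT2 q) = idm Y).
  { intros Y; destruct (Surj Y) as [X [e [e' H]]]; now exists (existT _ X (e, e')). }
  pose (q := fun Y => proj1_sig (constructive_indefinite_description _ (Surj' Y))).
  pose (g := fun Y => projT1 (q Y)).
  pose (e := fun Y => fst (projT2 (q Y)) : Hom (F (g Y)) Y).
  pose (e' := fun Y => snd (projT2 (q Y)) : Hom Y (F (g Y))).
  assert (E : forall Y, e' Y ∘ e Y = idm _ /\ e Y ∘ e' Y = idm _).
  { intros Y; exact (proj2_sig (constructive_indefinite_description _ (Surj' Y))). }
  clearbody e e'; clearbody g.
  assert (G1 : forall Y, pre _ _ (e' Y ∘ idm Y ∘ e Y) = idm (g Y)).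
  { intros Y; apply Faith; rewrite preE, fmap_id, comp_id_r; apply E. }
  assert (G2 : forall (Y1 Y2 Y3 : D) (k : Hom Y2 Y3) (h : Hom Y1 Y2),
    pre _ _ (e' Y3 ∘ (k ∘ h) ∘ e Y1) = pre _ _ (e' Y3 ∘ k ∘ e Y2) ∘ pre _ _ (e' Y2 ∘ h ∘ e Y1)).
  { intros; apply Faith; rewrite fmap_comp, !preE.
    rewrite !comp_assoc, <- (comp_assoc _ (e Y2)), (proj2 (E Y2)), comp_id_r.
    reflexivity. }
  exists {| fob := g; fmap := fun Y Y' h => pre _ _ (e' Y' ∘ h ∘ e Y);
            fmap_id := G1; fmap_comp := G2 |}.
  split.
  - unshelve eexists.
    { unshelve eexists; [intros X; exact (pre _ _ (e' (F X)))|].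
      intros X Y f; apply Faith; simpl; rewrite !fmap_comp, !preE.
      now rewrite <- comp_assoc, (proj2 (E _)), comp_id_r. }
    intros X; exists (pre _ _ (e (F X))); simpl; split; apply Faith;
      rewrite fmap_comp, !preE, fmap_id; apply E.
  - unshelve eexists.
    { unshelve eexists; [intros Y; exact (e Y)|].
      intros X Y f; simpl; rewrite preE, !comp_assoc, (proj2 (E _)).
      now rewrite comp_id_l. }
    intros Y; exists (e' Y); simpl; split; apply E.
Qed.

Lemma equivalence_surjective (C D : Category) (F : Functor C D) :
  is_equivalence F -> forall Y : D, exists (X : C) (e : Hom (F X) Y), is_iso e.
Proof. intros [G [_ [t Ht]]] Y; exists (G Y), (t Y); apply Ht. Qed.

(** By naturality of s, the conjugate of [fmap G h] by s is a morphism u for which [fmap F u] and h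
    have the same image under G. By naturality of t, a morphism between values of F can be recovered
    from its image under G. *)
Lemma equivalence_full (C D : Category) (F : Functor C D) :
  is_equivalence F ->
  forall X Y (h : Hom (F X) (F Y)), exists u : Hom X Y, fmap F u = h.
Proof.
  intros [G [[s Hs] [t Ht]]] X Y h.
  destruct (Hs Y) as [s' [S1 S2]].
  pose (u := @comp C X (G (F X)) Y (@comp C (G (F X)) (G (F Y)) Y s' (fmap G h)) (s X)).
  exists u.
  assert (E : fmap G (fmap F u) = fmap G h).
  { pose proof (nt_natural s u) as N; destruct (Hs X) as [r [_ R2]]; simpl in *.
    rewrite <- (comp_id_r (fmap G (fmap F u))), <- (comp_id_r (fmap G h)).
    rewrite <- R2, !comp_assoc, <- N; unfold u.
    now rewrite !comp_assoc, S2, comp_id_l. }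
  destruct (Ht (F X)) as [r [_ R2]].
  assert (N : forall k : Hom (F X) (F Y), k = t (F Y) ∘ fmap F (fmap G k) ∘ r).
  { intros k; pose proof (nt_natural t k) as N; simpl in *.
    rewrite N, <- comp_assoc, R2; symmetry; apply comp_id_r. }
  rewrite (N h), (N (fmap F u)); now rewrite E.
Qed.

(** * Initial objects, sums, and the consequences of extensivity *)

Definition is_initial (C : Category) (X : C) : Prop :=
  forall T : C, exists h : Hom X T, forall h' : Hom X T, h' = h.

Lemma initial_unique (C : Category) (X T : C) (a b : Hom X T) : is_initial X -> a = b.
Proof. intros H; destruct (H T) as [h Hh]; now rewrite (Hh a), (Hh b). Qed.

Definition is_sum (C : Category) (X Y A : C) (i : Hom X A) (j : Hom Y A) : Prop :=
  forall (Z : C) (f : Hom X Z) (g : Hom Y Z), exists! h, h ∘ i = f /\ h ∘ j = g.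

Lemma sum_ext (C : Category) (X Y A T : C) (i : Hom X A) (j : Hom Y A) (a b : Hom A T) :
  is_sum i j -> a ∘ i = b ∘ i -> a ∘ j = b ∘ j -> a = b.
Proof.
  intros H E1 E2; destruct (H T (b ∘ i) (b ∘ j)) as [h [_ Hu]].
  now rewrite <- (Hu a), <- (Hu b).
Qed.

Lemma is_sum_iso (C : Category) {HC : has_finite_coproducts C} (X Y A : C)
    (e : Hom (bcoprod X Y) A) : is_iso e -> is_sum (e ∘ in1) (e ∘ in2).
Proof.
  intros [e' [E1 E2]] Z f g; exists (copairing f g ∘ e'); split.
  - rewrite !comp_assoc, <- !(comp_assoc _ e'), E1, comp_id_r.
    now rewrite copairing_in1, copairing_in2.
  - intros h [<- <-]; rewrite !comp_assoc.
    rewrite <- (comp_id_r h) at 3; rewrite <- E2, comp_assoc; f_equal.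
    apply bcoprod_ext; now rewrite ?copairing_in1, ?copairing_in2.
Qed.

Lemma initial_exists (C : Category) {HC : has_finite_coproducts C} :
  exists O : C, is_initial O.
Proof.
  assert (FE : Finite Empty_set) by (exists nil; intros []).
  destruct (HC Empty_set FE (fun e => match e with end)) as [O [inj H]].
  exists O; intros T.
  destruct (H T (fun e => match e with end)) as [h [_ Hu]].
  exists h; intros h'; symmetry; apply Hu; intros [].
Qed.

Section Extensive.
Context (S : Category) {HS : lextensive S}.

(** Essential surjectivity of the sum functor on slices, applied to z as an object over the sum. *)
Lemma lextensive_split (X Y Z : S) (z : Hom Z (bcoprod X Y)) :
  exists (A B : S) (i : Hom A Z) (j : Hom B Z) (a : Hom A X) (b : Hom B Y),
    is_sum i j /\ z ∘ i = in1 ∘ a /\ z ∘ j = in2 ∘ b.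
Proof.
  destruct (equivalence_surjective (lextensive_equivalence X Y) (existT _ Z z))
    as [[[A a] [B b]] [[e He] [[e' He'] [E1 E2]]]].
  simpl in *.
  apply (f_equal (@proj1_sig _ _)) in E1; apply (f_equal (@proj1_sig _ _)) in E2.
  simpl in *.
  exists A, B, (e ∘ in1), (e ∘ in2), a, b; split; [|split].
  - apply is_sum_iso; now exists e'.
  - rewrite comp_assoc, He; apply copairing_in1.
  - rewrite comp_assoc, He; apply copairing_in2.
Qed.

(** With O initial, the swap Z + O -> O + Z lies over X + Y because of the hypothesis. Fullness
    makes it a sum of morphisms, so [in2] on Z equals [in1 ∘ u] for some u : Z -> O. Composing with
    the copairing of t and h shows that every h : Z -> T is [t ∘ u]. *)
Lemma lextensive_disjoint (X Y Z : S) (x : Hom Z X) (y : Hom Z Y) :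
  in1 ∘ x = in2 ∘ y -> is_initial Z.
Proof.
  intros E. destruct (@initial_exists S _) as [O HO].
  destruct (HO X) as [oX _], (HO Y) as [oY _].
  destruct (HO (bcoprod O Z)) as [o _].
  pose (P := ((existT (fun A => Hom A X) Z x : slice X,
               existT (fun A => Hom A Y) O oY : slice Y)
              : product_category (slice X) (slice Y))).
  pose (Q := ((existT (fun A => Hom A X) O oX : slice X,
               existT (fun A => Hom A Y) Z y : slice Y)
              : product_category (slice X) (slice Y))).
  assert (Hh : bcoprod_map oX y ∘ copairing in2 o = bcoprod_map x oY).
  { unfold bcoprod_map; apply bcoprod_ext.
    - rewrite <- comp_assoc, copairing_in1, copairing_in2, copairing_in1; now symmetry.
    - now apply initial_unique. }
  destruct (@equivalence_full _ _ _ (lextensive_equivalence X Y) P Q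
              (exist _ (copairing in2 o) Hh)) as [[[u Hu] [v Hv]] E'].
  apply (f_equal (@proj1_sig _ _)) in E'; simpl in *.
  apply (f_equal (fun k => k ∘ in1)) in E'.
  unfold bcoprod_map in E'; rewrite !copairing_in1 in E'.
  intros T; destruct (HO T) as [t _]; exists (t ∘ u); intros h.
  rewrite <- (copairing_in2 t h), <- E', comp_assoc, copairing_in1; reflexivity.
Qed.

(** With O initial, the identity of Z + O is a morphism over X + Y from the sum with structure map a
    to the one with structure map b. Fullness yields u with b u = a, and a retraction of [in1] shows
    that u is the identity. *)
Lemma lextensive_in1_mono (X Y Z : S) (a b : Hom Z X) :
  @in1 S _ X Y ∘ a = in1 ∘ b -> a = b.
Proof.
  intros E. destruct (@initial_exists S _) as [O HO].
  destruct (HO Y) as [oY _].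
  pose (P := ((existT (fun A => Hom A X) Z a : slice X,
               existT (fun A => Hom A Y) O oY : slice Y)
              : product_category (slice X) (slice Y))).
  pose (Q := ((existT (fun A => Hom A X) Z b : slice X,
               existT (fun A => Hom A Y) O oY : slice Y)
              : product_category (slice X) (slice Y))).
  assert (Hh : bcoprod_map b oY ∘ idm _ = bcoprod_map a oY).
  { rewrite comp_id_r; unfold bcoprod_map; now rewrite E. }
  destruct (@equivalence_full _ _ _ (lextensive_equivalence X Y) P Q
              (exist _ (idm _) Hh)) as [[[u Hu] [v Hv]] E'].
  apply (f_equal (@proj1_sig _ _)) in E'; simpl in *.
  apply (f_equal (fun k => k ∘ in1)) in E'.
  unfold bcoprod_map in E'; rewrite copairing_in1, comp_id_l in E'.
  destruct (HO Z) as [o _].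
  apply (f_equal (fun k => copairing (idm Z) o ∘ k)) in E'.
  rewrite comp_assoc, copairing_in1, comp_id_l in E'.
  now rewrite <- Hu, E', comp_id_r.
Qed.

(** The two injections of O into O + O coincide, so disjointness applies to z. *)
Lemma initial_strict (O Z : S) (z : Hom Z O) : is_initial O -> is_initial Z.
Proof.
  intros HO; apply (@lextensive_disjoint O O Z z z); f_equal; now apply initial_unique.
Qed.

Section Coproduct.
Context (I : Type) (X : I -> S) (A : S) (inj : forall i, Hom (X i) A).
Context (HA : is_coproduct inj).

Lemma coproduct_ext (T : S) (u v : Hom A T) :
  (forall i, u ∘ inj i = v ∘ inj i) -> u = v.
Proof.
  intros H; destruct (HA (fun i => v ∘ inj i)) as [h [_ Hu]].
  now rewrite <- (Hu u), <- (Hu v).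
Qed.

(** A test morphism that reduces statements on a family to binary sums. Using all of A as the second
    summand avoids forming the coproduct of the other members. *)
Lemma coproduct_separate (i : I) :
  exists d : Hom A (bcoprod (X i) A),
    d ∘ inj i = in1 /\ forall k, i <> k -> d ∘ inj k = in2 ∘ inj k.
Proof.
  destruct (HA (fun k => match excluded_middle_informative (i = k) with
    | left e => in1 ∘ match e in _ = k return Hom (X k) (X i) with eq_refl => idm _ end
    | right _ => in2 ∘ inj k
    end)) as [d [Hd _]].
  exists d; split.
  - rewrite Hd; destruct excluded_middle_informative as [e|n]; [|contradiction].
    rewrite (proof_irrelevance _ e eq_refl); apply comp_id_r.
  - intros k Hk; rewrite Hd; now destruct excluded_middle_informative.
Qed.

Lemma coproduct_disjoint (i k : I) (Z : S) (x : Hom Z (X i)) (y : Hom Z (X k)) :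
  inj i ∘ x = inj k ∘ y -> is_initial Z \/ i = k.
Proof.
  intros E; destruct (classic (i = k)) as [e|n]; [now right|left].
  destruct (coproduct_separate i) as [d [D1 D2]].
  apply (@lextensive_disjoint _ _ Z x (inj k ∘ y)).
  now rewrite <- D1, <- comp_assoc, E, comp_assoc, D2, comp_assoc.
Qed.

Lemma coproduct_inj_mono (i : I) (Z : S) (x y : Hom Z (X i)) :
  inj i ∘ x = inj i ∘ y -> x = y.
Proof.
  intros E; destruct (coproduct_separate i) as [d [D1 _]].
  apply (@lextensive_in1_mono (X i) A).
  now rewrite <- D1, <- !comp_assoc, E.
Qed.
End Coproduct.
End Extensive.

(** * Local truth *)

(* Initial objects count as covered by the empty decomposition. *)
Inductive locally (C : Category) : forall Z : C, (forall W, Hom W Z -> Prop) -> Prop :=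
| locally_here (Z : C) (P : forall W, Hom W Z -> Prop) : P Z (idm Z) -> locally P
| locally_initial (Z : C) (P : forall W, Hom W Z -> Prop) : is_initial Z -> locally P
| locally_sum (Z Z1 Z2 : C) (i : Hom Z1 Z) (j : Hom Z2 Z) (P : forall W, Hom W Z -> Prop) :
    is_sum i j ->
    locally (fun W w => P W (i ∘ w)) -> locally (fun W w => P W (j ∘ w)) -> locally P.

Lemma locally_impl (C : Category) (Z : C) (P Q : forall W, Hom W Z -> Prop) :
  locally P -> (forall W w, P W w -> Q W w) -> locally Q.
Proof.
  intros H; revert Q; induction H as [Z P H|Z P H|Z Z1 Z2 i j P Hs H1 IH1 H2 IH2]; intros Q HQ.
  - now apply locally_here, HQ.
  - now apply locally_initial.
  - apply locally_sum with Z1 Z2 i j; auto.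
Qed.

Lemma locally_bind (C : Category) (Z : C) (P Q : forall W, Hom W Z -> Prop) :
  locally P -> (forall W w, P W w -> locally (fun V v => Q V (w ∘ v))) -> locally Q.
Proof.
  intros H; revert Q; induction H as [Z P H|Z P H|Z Z1 Z2 i j P Hs H1 IH1 H2 IH2]; intros Q HQ.
  - apply (locally_impl (HQ Z _ H)); intros W w; now rewrite comp_id_l.
  - now apply locally_initial.
  - apply locally_sum with Z1 Z2 i j; [assumption|apply IH1|apply IH2];
    intros W w Hw; apply (locally_impl (HQ W _ Hw)); intros V v; now rewrite comp_assoc.
Qed.

Lemma locally_always (C : Category) (Z : C) (P : forall W, Hom W Z -> Prop) :
  (forall W w, P W w) -> locally P.
Proof. intros H; now apply locally_here. Qed.

Lemma locally_eq (C : Category) (Z T : C) (a b : Hom Z T) :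
  locally (fun W w => a ∘ w = b ∘ w) -> a = b.
Proof.
  intros H; remember (fun W (w : Hom W Z) => a ∘ w = b ∘ w) as P eqn:E.
  assert (HP : forall W (w : Hom W Z), P W w -> a ∘ w = b ∘ w) by (now subst).
  clear E; revert a b HP;
  induction H as [Z P H|Z P H|Z Z1 Z2 i j P Hs H1 IH1 H2 IH2]; intros a b HP.
  - rewrite <- (comp_id_r a), <- (comp_id_r b); now apply HP.
  - now apply initial_unique.
  - apply (sum_ext Hs); [apply IH1|apply IH2]; intros W w Hw;
    rewrite <- !comp_assoc; now apply HP.
Qed.

(** The pieces of a sum do not overlap, so local lifts glue without any compatibility condition, and
    the lifts need not be unique. *)
Lemma locally_lift (C : Category) (Z T : C) (J : Type) (U : J -> C)
    (p : forall j, Hom T (U j)) (z : forall j, Hom Z (U j)) :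
  locally (fun W w => exists h : Hom W T, forall j, p j ∘ h = z j ∘ w) ->
  exists h : Hom Z T, forall j, p j ∘ h = z j.
Proof.
  intros H.
  remember (fun W (w : Hom W Z) => exists h : Hom W T, forall j, p j ∘ h = z j ∘ w)
    as P eqn:E.
  assert (HP : forall W (w : Hom W Z), P W w ->
    exists h : Hom W T, forall j, p j ∘ h = z j ∘ w) by (now subst).
  clear E; revert z HP;
  induction H as [Z P H|Z P H|Z Z1 Z2 i j P Hs H1 IH1 H2 IH2]; intros z HP.
  - destruct (HP _ _ H) as [h Hh]; exists h; intros k; now rewrite Hh, comp_id_r.
  - destruct (H T) as [h _]; exists h; intros k; now apply initial_unique.
  - destruct (IH1 (fun k => z k ∘ i)) as [h1 E1].
    { intros W w Hw; destruct (HP _ _ Hw) as [h Hh]; exists h; intros k.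
      now rewrite Hh, comp_assoc. }
    destruct (IH2 (fun k => z k ∘ j)) as [h2 E2].
    { intros W w Hw; destruct (HP _ _ Hw) as [h Hh]; exists h; intros k.
      now rewrite Hh, comp_assoc. }
    destruct (Hs T h1 h2) as [h [[K1 K2] _]]; exists h; intros k.
    apply (sum_ext Hs); rewrite <- comp_assoc; [now rewrite K1|now rewrite K2].
Qed.

Section LocallyExtensive.
Context (S : Category) {HS : lextensive S}.

Lemma locally_bcoprod (X Y Z : S) (z : Hom Z (bcoprod X Y)) :
  locally (fun W w => (exists a, z ∘ w = in1 ∘ a) \/ (exists b, z ∘ w = in2 ∘ b)).
Proof.
  destruct (lextensive_split z) as [A [B [i [j [a [b [Hs [Ea Eb]]]]]]]].
  apply (locally_sum Hs); apply locally_always; intros W w; [left|right].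
  - exists (a ∘ w); now rewrite !comp_assoc, Ea.
  - exists (b ∘ w); now rewrite !comp_assoc, Eb.
Qed.

(** A is a retract of an iterated binary sum B along a list that enumerates I. The list may contain
    repetitions, because only a section of r is needed. *)
Lemma locally_coproduct (I : Type) (X : I -> S) (A : S) (inj : forall i, Hom (X i) A)
    (Z : S) (z : Hom Z A) :
  Finite I -> is_coproduct inj ->
  locally (fun W w => exists i (a : Hom W (X i)), z ∘ w = inj i ∘ a).
Proof.
  intros [l Hl] HA.
  assert (K : exists (B : S) (r : Hom B A),
    (forall i, In i l -> exists c : Hom (X i) B, r ∘ c = inj i) /\
    (forall Z (z : Hom Z B),
       locally (fun W w => exists i (a : Hom W (X i)), r ∘ (z ∘ w) = inj i ∘ a))).
  { clear Hl; induction l as [|i l [B [r [H1 H2]]]].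
    - destruct (@initial_exists S _) as [O HO]; destruct (HO A) as [r _].
      exists O, r; split; [intros i []|].
      intros Y y; apply locally_initial; exact (initial_strict y HO).
    - exists (bcoprod (X i) B), (copairing (inj i) r); split.
      + intros k [<-|Hk]; [exists in1; apply copairing_in1|].
        destruct (H1 k Hk) as [c Hc]; exists (in2 ∘ c).
        now rewrite comp_assoc, copairing_in2.
      + intros Y y; apply (locally_bind (locally_bcoprod y)).
        intros W w [[a Ea]|[b Eb]].
        * apply locally_always; intros V v; exists i, (a ∘ v).
          rewrite (comp_assoc y w v), Ea, !comp_assoc; now rewrite copairing_in1.
        * apply (locally_impl (H2 W b)); intros V v [k [a Ea]]; exists k, a.
          rewrite (comp_assoc y w v), Eb, !comp_assoc, copairing_in2.
          now rewrite <- comp_assoc. }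
  destruct K as [B [r [H1 H2]]].
  assert (C : exists c : forall i, Hom (X i) B, forall i, r ∘ c i = inj i).
  { exists (fun i => proj1_sig (constructive_indefinite_description _ (H1 i (Hl i)))).
    intros i; exact (proj2_sig (constructive_indefinite_description _ (H1 i (Hl i)))). }
  destruct C as [c Hc]; destruct (HA B c) as [d [Hd _]].
  assert (E : r ∘ d = idm A).
  { apply (coproduct_ext HA); intros i; now rewrite <- comp_assoc, Hd, Hc, comp_id_l. }
  apply (locally_impl (H2 Z (d ∘ z))); intros W w [i [a Ea]]; exists i, a.
  now rewrite <- Ea, !comp_assoc, E, comp_id_l.
Qed.
End LocallyExtensive.

(** * Monotone maps from a finite set of reals into an ordered object *)

Section Graph.
Context (I : Type) (r : I -> I -> Prop).

Definition edge : Type := {p : I * I | r (fst p) (snd p)}.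

Definition incident (u v : I + edge) : Prop :=
  u = v \/ match u, v with
           | inr p, inl i => i = fst (proj1_sig p) \/ i = snd (proj1_sig p)
           | _, _ => False
           end.

Lemma incident_refl u : incident u u.
Proof. now left. Qed.

Lemma incident_trans u v w : incident u v -> incident v w -> incident u w.
Proof.
  intros [->|H] K; [assumption|]; destruct K as [<-|K]; [now right|].
  destruct u, v; contradiction.
Qed.

(** The shape whose arrows go from an edge to its two endpoints. With L at the vertices and a
    relation E on L at the edges, the limit is the object of families in L that carry r to E. *)
Definition graph : Category := preorder_category incident_refl incident_trans.

Lemma graph_finite : Finite I -> finite_category graph.
Proof.
  intros [l Hl]; split; [|intros u v; exact (Finite_prop (incident u v))].
  exists (map inl l ++ map inr (flat_map
    (fun p => match excluded_middle_informative (r (fst p) (snd p)) with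
       | left H => exist (fun p => r (fst p) (snd p)) p H :: nil
       | right _ => nil end) (list_prod l l))).
  intros [i|[[i j] H]]; apply in_or_app; [left|right]; apply in_map; [apply Hl|].
  apply in_flat_map; exists (i, j); split; [apply in_prod; apply Hl|].
  destruct excluded_middle_informative; [|contradiction]; left; now apply sig_eq.
Qed.

Context (irr : forall i, ~ r i i).

Lemma incident_absurd i (p : edge) : incident (inl i) (inr p) -> False.
Proof. intros [H|H]; [discriminate|contradiction]. Qed.

Context (C : Category) (L E : C) (s t : Hom E L).

(** An endpoint that is not the source is taken to be the target. A loop would have a single arrow
    to its endpoint, which could not carry both s and t; [irr] rules this out. *)
Program Definition graph_diagram : Functor graph C :=
  {| fob := fun u : I + edge => if u then L else E;
     fmap := fun u v => match u, v return
         incident u v -> Hom (if u then L else E) (if v then L else E) with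
       | inl _, inl _ => fun _ => idm L
       | inr _, inr _ => fun _ => idm E
       | inr p, inl i => fun _ =>
           if excluded_middle_informative (i = fst (proj1_sig p)) then s else t
       | inl i, inr p => fun H => False_rect _ (incident_absurd H)
       end |}.
Next Obligation. intros [i|p]; reflexivity. Qed.
Next Obligation.
  intros [i|p] [j|q] [k|o] H1 H2; simpl in *;
  try (exfalso; eapply incident_absurd; eassumption);
  rewrite ?comp_id_l, ?comp_id_r; try reflexivity.
  - destruct H1 as [H1|[]]; now injection H1 as <-.
  - destruct H2 as [H2|[]]; now injection H2 as <-.
Qed.

(** Stated for the image of the diagram under F so that it serves twice: with the identity functor
    it constructs the object of charts, with a left-exact functor it identifies the value at
    [Emb A]. Joint monicity of the images of s and t lets the legs at the vertices determine those
    at the edges. *)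
Lemma graph_limit (S : Category) (F : Functor C S) (c : Cone (functor_comp F graph_diagram))
    (Z : S) (x : I -> Hom Z (F L)) :
  (forall a b : Hom Z (F E), fmap F s ∘ a = fmap F s ∘ b ->
     fmap F t ∘ a = fmap F t ∘ b -> a = b) ->
  is_limit c ->
  (forall i j, r i j -> exists e : Hom Z (F E), fmap F s ∘ e = x i /\ fmap F t ∘ e = x j) ->
  exists! h : Hom Z (apex c), forall i, (leg c (inl i) : Hom (apex c) (F L)) ∘ h = x i.
Proof.
  intros Hm Hc Hx.
  pose (e := fun p : edge => proj1_sig (constructive_indefinite_description _
               (Hx _ _ (proj2_sig p)))).
  assert (He : forall p : edge, fmap F s ∘ e p = x (fst (proj1_sig p)) /\
                                fmap F t ∘ e p = x (snd (proj1_sig p))).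
  { intros p; exact (proj2_sig (constructive_indefinite_description _
               (Hx _ _ (proj2_sig p)))). }
  clearbody e.
  pose (l := fun u : graph => match u return Hom Z (functor_comp F graph_diagram u) with
                      | inl i => x i | inr p => e p end).
  assert (Hl : forall u v (k : @Hom graph u v), fmap (functor_comp F graph_diagram) k ∘ l u = l v).
  { intros [i|p] [j|q] k; simpl.
    - destruct k as [k|[]]; injection k as <-; now rewrite fmap_id, comp_id_l.
    - destruct (incident_absurd k).
    - destruct (He p) as [E1 E2].
      destruct excluded_middle_informative as [->|n]; [assumption|].
      destruct k as [k|[k|k]]; [discriminate|contradiction|now subst].
    - destruct k as [k|[]]; injection k as <-; now rewrite fmap_id, comp_id_l. }
  destruct (Hc (Build_Cone Hl)) as [h [Hh Hu]].
  exists h; split; [intros i; apply (Hh (inl i))|].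
  intros h' Hh'; apply Hu; intros [i|p]; [apply Hh'|simpl].
  assert (N1 : fmap F s ∘ leg c (inr p) = leg c (inl (fst (proj1_sig p)))).
  { rewrite <- (leg_natural c (i := inr p) (j := inl (fst (proj1_sig p)))
                  (or_intror (or_introl eq_refl))); simpl.
    now destruct excluded_middle_informative. }
  assert (N2 : fmap F t ∘ leg c (inr p) = leg c (inl (snd (proj1_sig p)))).
  { rewrite <- (leg_natural c (i := inr p) (j := inl (snd (proj1_sig p)))
                  (or_intror (or_intror eq_refl))); simpl.
    destruct excluded_middle_informative as [e0|]; [|reflexivity].
    exfalso; destruct p as [[i j] Hr]; simpl in *; subst; now apply (irr Hr). }
  destruct (He p) as [E1 E2].
  apply Hm; rewrite comp_assoc; simpl in *.
  - now rewrite N1, E1, Hh'.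
  - now rewrite N2, E2, Hh'.
Qed.
End Graph.

Lemma pt_finite (A : list R) : Finite (pt A).
Proof.
  exists (flat_map (fun a => match excluded_middle_informative (In a A) with
    | left H => exist (fun a => In a A) a H :: nil | right _ => nil end) A).
  intros [a Ha]; apply in_flat_map; exists a; split; [assumption|].
  destruct excluded_middle_informative; [|contradiction]; left; now apply sig_eq.
Qed.

Definition pt_lt (A : list R) (a b : pt A) : Prop := proj1_sig a < proj1_sig b.

Lemma pt_lt_irrefl (A : list R) (a : pt A) : ~ pt_lt a a.
Proof. apply Rlt_irrefl. Qed.

(** * Comparison of generalized elements of an ordered object *)

Section OrderedObject.
Context (S : Category) {HS : lextensive S} (X : @OrderedObject S _ _).

Definition lt (Z : S) (x y : Hom Z X) : Prop := factors (pairing x y) (ord_rel X).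

Lemma ltE (Z : S) (x y : Hom Z X) :
  lt x y <-> exists e : Hom Z (sub_dom (ord_rel X)),
    pr1 ∘ sub_arr (ord_rel X) ∘ e = x /\ pr2 ∘ sub_arr (ord_rel X) ∘ e = y.
Proof.
  split; intros [e He]; exists e.
  - now rewrite <- !comp_assoc, He, pr1_pairing, pr2_pairing.
  - destruct He as [<- <-]; apply bprod_ext; rewrite ?pr1_pairing, ?pr2_pairing;
    apply comp_assoc.
Qed.

Lemma lt_comp (Z W : S) (x y : Hom Z X) (w : Hom W Z) : lt x y -> lt (x ∘ w) (y ∘ w).
Proof. intros H; unfold lt; rewrite <- pairing_comp; now apply factors_comp. Qed.

Lemma lt_trans (Z : S) (x y z : Hom Z X) : lt x y -> lt y z -> lt x z.
Proof.
  intros H1 H2.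
  pose (u := pairing (pairing x y) z : Hom Z (cube X)).
  assert (E12 : p12 ∘ u = pairing x y) by apply pr1_pairing.
  assert (E23 : p23 ∘ u = pairing y z).
  { unfold p23, u; now rewrite pairing_comp, <- comp_assoc, pr1_pairing, !pr2_pairing. }
  assert (E13 : p13 ∘ u = pairing x z).
  { unfold p13, u; now rewrite pairing_comp, <- comp_assoc, pr1_pairing, pr2_pairing, pr1_pairing. }
  assert (H : factors u (intersection (inverse_image p12 (ord_rel X))
                                      (inverse_image p23 (ord_rel X)))).
  { apply factors_intersection; rewrite !factors_inverse_image, E12, E23; now split. }
  destruct H as [h Hh]; destruct (ord_trans X) as [k Hk].
  unfold lt; rewrite <- E13; apply (factors_inverse_image p13 (ord_rel X) u).
  exists (k ∘ h); now rewrite comp_assoc, Hk.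
Qed.

(** The pair (x, x) factors both through the relation and through the diagonal, which are disjoint
    summands of the square. *)
Lemma lt_irrefl (Z : S) (x : Hom Z X) : lt x x -> is_initial Z.
Proof.
  intros [e He]; pose proof (iso_mono (ord_total X)) as M.
  apply (@lextensive_disjoint S HS _ _ Z e x), (@lextensive_in1_mono S HS _ (sub_dom (ord_rel X))), M.
  rewrite !comp_assoc, !copairing_in1, copairing_in2, He; simpl.
  unfold diagonal_map; now rewrite pairing_comp, comp_id_l.
Qed.

(** Totality turns the pair (x, y) into a morphism to a sum of three objects, and extensivity cuts Z
    accordingly. *)
Lemma lt_trichotomy (Z : S) (x y : Hom Z X) :
  locally (fun W w => lt (x ∘ w) (y ∘ w) \/ x ∘ w = y ∘ w \/ lt (y ∘ w) (x ∘ w)).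
Proof.
  destruct (ord_total X) as [k [_ K]].
  set (m := copairing _ _) in K.
  assert (E : forall W (w : Hom W Z), m ∘ (k ∘ pairing x y ∘ w) = pairing (x ∘ w) (y ∘ w)).
  { intros; rewrite !comp_assoc, K, comp_id_l; apply pairing_comp. }
  apply (locally_bind (locally_bcoprod (k ∘ pairing x y))); intros W w [[a Ea]|[b Eb]].
  - apply (locally_impl (locally_bcoprod a)); intros V v Hv.
    rewrite !comp_assoc, <- !(comp_assoc _ w v).
    assert (E' : m ∘ (in1 ∘ (a ∘ v)) = pairing (x ∘ (w ∘ v)) (y ∘ (w ∘ v))).
    { now rewrite <- E, !comp_assoc, <- (comp_assoc m _ (pairing x y)),
        <- (comp_assoc m _ w), Ea, !comp_assoc. }
    unfold m in E'; rewrite comp_assoc, copairing_in1 in E'.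
    destruct Hv as [[c Ec]|[c Ec]]; rewrite Ec, comp_assoc in E'.
    + left; exists c; now rewrite <- E', copairing_in1.
    + right; left; rewrite copairing_in2 in E'; simpl in E'.
      unfold diagonal_map in E'; rewrite pairing_comp, comp_id_l in E'.
      apply (f_equal (comp pr1)) in E' as E1; apply (f_equal (comp pr2)) in E' as E2.
      rewrite !pr1_pairing in E1; rewrite !pr2_pairing in E2; congruence.
  - apply locally_always; intros V v; right; right.
    rewrite !comp_assoc, <- !(comp_assoc _ w v).
    assert (E' : m ∘ (in2 ∘ (b ∘ v)) = pairing (x ∘ (w ∘ v)) (y ∘ (w ∘ v))).
    { now rewrite <- E, !comp_assoc, <- (comp_assoc m _ (pairing x y)),
        <- (comp_assoc m _ w), Eb, !comp_assoc. }
    unfold m in E'; rewrite comp_assoc, copairing_in2 in E'; simpl in E'.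
    exists (b ∘ v).
    apply (f_equal (comp pr1)) in E' as E1; apply (f_equal (comp pr2)) in E' as E2.
    unfold switch in E1, E2; rewrite !comp_assoc in E1; rewrite !comp_assoc in E2.
    rewrite !pr1_pairing in E1; rewrite !pr2_pairing in E2.
    apply bprod_ext; rewrite ?pr1_pairing, ?pr2_pairing, !comp_assoc; assumption.
Qed.

Definition is_chart (A : list R) (Z : S) (x : pt A -> Hom Z X) : Prop :=
  forall a b, pt_lt a b -> lt (x a) (x b).

Lemma is_chart_comp (A : list R) (Z W : S) (x : pt A -> Hom Z X) (w : Hom W Z) :
  is_chart x -> is_chart (fun a => x a ∘ w).
Proof. intros H a b L; now apply lt_comp, H. Qed.

(** Either alternative among the reals would yield an element below itself, which forces Z to be
    initial. *)
Lemma chart_lt (A : list R) (Z : S) (x : pt A -> Hom Z X) (a b : pt A) :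
  is_chart x -> ~ is_initial Z -> lt (x a) (x b) -> pt_lt a b.
Proof.
  intros Hx HZ H; destruct (Rtotal_order (proj1_sig a) (proj1_sig b)) as [L|[E|L]].
  - assumption.
  - apply (@sig_eq _ (fun a => In a A)) in E; subst b; destruct HZ; now apply lt_irrefl in H.
  - destruct HZ; apply (@lt_irrefl _ (x a)), (lt_trans H); now apply Hx.
Qed.

Lemma chart_inj (A : list R) (Z : S) (x : pt A -> Hom Z X) (a b : pt A) :
  is_chart x -> ~ is_initial Z -> x a = x b -> a = b.
Proof.
  intros Hx HZ E; apply sig_eq.
  destruct (Rtotal_order (proj1_sig a) (proj1_sig b)) as [L|[L|L]]; [|assumption|];
  apply Hx in L; rewrite E in L; destruct HZ; now apply lt_irrefl in L.
Qed.

Definition represents_charts (A : list R) (K : S) (p : pt A -> Hom K X) : Prop :=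
  is_chart p /\
  forall (Z : S) (x : pt A -> Hom Z X), is_chart x ->
    exists! h : Hom Z K, forall a, p a ∘ h = x a.

Lemma edge_ext (Z : S) (a b : Hom Z (sub_dom (ord_rel X))) :
  pr1 ∘ sub_arr (ord_rel X) ∘ a = pr1 ∘ sub_arr (ord_rel X) ∘ b ->
  pr2 ∘ sub_arr (ord_rel X) ∘ a = pr2 ∘ sub_arr (ord_rel X) ∘ b -> a = b.
Proof.
  intros E1 E2; apply (sub_mono (ord_rel X)), bprod_ext; now rewrite !comp_assoc.
Qed.

Lemma conf_exists (A : list R) :
  exists q : {K : S & pt A -> Hom K X}, represents_charts (projT2 q).
Proof.
  pose (D := graph_diagram (@pt_lt A) (pr1 ∘ sub_arr (ord_rel X)) (pr2 ∘ sub_arr (ord_rel X))).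
  destruct (@lextensive_limits S HS _ (graph_finite (@pt_lt A) (pt_finite A))
              (functor_comp (functor_id S) D)) as [c Hc].
  exists (existT (fun K => pt A -> Hom K X) (apex c) (fun a => leg c (inl a))); simpl; split.
  - intros a b L; apply ltE.
    pose (p := exist (fun p : pt A * pt A => pt_lt (fst p) (snd p)) (a, b) L : edge (@pt_lt A)).
    exists (leg c (inr p)); split.
    + rewrite <- (leg_natural c (i := inr p) (j := inl a) (or_intror (or_introl eq_refl))); simpl.
      now destruct excluded_middle_informative.
    + rewrite <- (leg_natural c (i := inr p) (j := inl b) (or_intror (or_intror eq_refl))); simpl.
      destruct excluded_middle_informative as [e|]; [|reflexivity].
      exfalso; subst b; exact (pt_lt_irrefl L).
  - intros Z x Hx.
    apply (@graph_limit _ _ (@pt_lt_irrefl A) S _ _ _ _ S (functor_id S) c Z x).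
    + apply edge_ext.
    + exact Hc.
    + intros a b L; now apply ltE, Hx.
Qed.
End OrderedObject.

(** * Limits and coproducts of G-sets *)

Lemma emb_base_mem (A : list R) :
  exists g : autR, forall a : pt A, proj1_sig a = g (proj1_sig a).
Proof. now exists aut_one. Qed.

(** Defining embeddings as restrictions of automorphisms makes transitivity immediate; by
    [aut_extend_pt] these are all strictly increasing maps from A to the line. *)
Program Definition Emb (A : list R) : GSet :=
  {| gcar := {f : pt A -> R | exists g : autR, forall a, f a = g (proj1_sig a)};
     gact := fun g f => exist _ (fun a => g (proj1_sig f a)) _ |}.
Next Obligation. intros A g [f [h H]]; exists (aut_mul g h); intros a; simpl; now rewrite H. Qed.
Next Obligation. intros A [f H]; now apply sig_eq. Qed.
Next Obligation. intros; now apply sig_eq. Qed.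
Next Obligation.
  intros A [f H].
  apply (@stabilizer_open {f : pt A -> R | exists g : autR, forall a, f a = g (proj1_sig a)}
    (fun g f => exist _ (fun a => g (proj1_sig f a)) (Emb_obligation_1 g f)));
    [intros; now apply sig_eq|].
  destruct H as [g Hg]; exists (map g A); intros h Hh; apply sig_eq; simpl.
  apply functional_extensionality; intros a; rewrite Hg; apply Hh, in_map, (proj2_sig a).
Qed.
Next Obligation.
  intros A.
  exists (exist (fun f : pt A -> R => exists g : autR, forall a, f a = g (proj1_sig a))
    (@proj1_sig _ _) (emb_base_mem A) :: nil).
  intros [f [g Hg]]; eexists; split; [left; reflexivity|].
  exists g; apply sig_eq; simpl; apply functional_extensionality; intros a; now symmetry.
Qed.

Definition emb_base (A : list R) : Emb A :=
  exist (fun f : pt A -> R => exists g : autR, forall a, f a = g (proj1_sig a))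
    (@proj1_sig _ _) (emb_base_mem A).

Lemma emb_transitive (A : list R) (f : Emb A) : exists g, gact g (emb_base A) = f.
Proof.
  destruct f as [f [g Hg]]; exists g; apply sig_eq; simpl.
  apply functional_extensionality; intros a; now symmetry.
Qed.

Lemma emb_base_supports (A : list R) : supports A (emb_base A).
Proof.
  intros h Hh; apply sig_eq; simpl; apply functional_extensionality.
  intros [a Ha]; now apply Hh.
Qed.

Lemma emb_ext (A : list R) (Y : GSet) (f f' : GMap (Emb A) Y) :
  f (emb_base A) = f' (emb_base A) -> f = f'.
Proof.
  intros E; apply gmap_eq; intros u; destruct (emb_transitive u) as [g <-].
  now rewrite !gfun_equivariant, E.
Qed.

Definition emb_aut (A : list R) (f : Emb A) : autR :=
  proj1_sig (constructive_indefinite_description _ (emb_transitive f)).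

Lemma emb_aut_spec (A : list R) (f : Emb A) : gact (emb_aut f) (emb_base A) = f.
Proof. exact (proj2_sig (constructive_indefinite_description _ (emb_transitive f))). Qed.

Lemma emb_agree (A : list R) (Y : GSet) (y : Y) (g h : autR) :
  supports A y -> gact g (emb_base A) = gact h (emb_base A) -> gact g y = gact h y.
Proof.
  intros H E; apply (gact_agree H); intros a Ha.
  exact (f_equal (fun f : Emb A => proj1_sig f (exist _ a Ha)) E).
Qed.

(** [Emb A] represents the functor of points supported by A, with [emb_base A] as universal point;
    this is the morphism classifying y. *)
Definition orbit_map (A : list R) (Y : GSet) (y : Y) (H : supports A y) : @Hom SG (Emb A) Y.
Proof.
  exists (fun f : Emb A => gact (emb_aut f) y).
  intros g f; rewrite <- gact_mul; apply (emb_agree H).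
  now rewrite gact_mul, !emb_aut_spec.
Defined.

Lemma orbit_map_base (A : list R) (Y : GSet) (y : Y) (H : supports A y) :
  (orbit_map H : GMap _ _) (emb_base A) = y.
Proof.
  simpl; rewrite (@emb_agree A Y y _ aut_one H); [apply gact_one|].
  now rewrite emb_aut_spec, gact_one.
Qed.

Lemma orbit_map_act (A : list R) (Y : GSet) (y : Y) (H : supports A y) (g : autR) :
  (orbit_map H : GMap _ _) (gact g (emb_base A)) = gact g y.
Proof. now rewrite gfun_equivariant, orbit_map_base. Qed.

Lemma in_conj_support (A B : list R) (g : autR) :
  (forall b, In b B -> In (g b) A) -> supports A (gact g (emb_base B)).
Proof.
  intros H; apply supports_incl with (map g B); [|apply supports_act, emb_base_supports].
  intros a Ha; apply in_map_iff in Ha; destruct Ha as [b [<- Hb]]; auto.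
Qed.

Definition emb_leg (A : list R) (a : pt A) : @Hom SG (Emb A) line :=
  {| gfun := (fun f => proj1_sig f a) : Emb A -> line; gfun_equivariant := fun g f => eq_refl |}.

Definition less_fst : @Hom SG less line := plane_fst ∘ less_incl.
Definition less_snd : @Hom SG less line := plane_snd ∘ less_incl.

Definition line_diagram (A : list R) : Functor (graph (@pt_lt A)) SG :=
  graph_diagram (@pt_lt A) less_fst less_snd.

Lemma emb_monotone (A : list R) (f : Emb A) (a b : pt A) :
  pt_lt a b -> proj1_sig f a < proj1_sig f b.
Proof. destruct f as [f [g Hg]]; simpl; rewrite !Hg; apply aut_lt. Qed.

Definition emb_edge (A : list R) (p : edge (@pt_lt A)) : @Hom SG (Emb A) less.
Proof.
  exists (fun f : Emb A => exist (fun q : R * R => fst q < snd q)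
    (proj1_sig f (fst (proj1_sig p)), proj1_sig f (snd (proj1_sig p)))
    (emb_monotone f (proj2_sig p)) : less).
  intros g f; now apply sig_eq.
Defined.

Lemma emb_cone_natural (A : list R) (i j : graph (@pt_lt A)) (u : Hom i j) :
  fmap (line_diagram A) u ∘
    (match i return Hom (Emb A : SG) (line_diagram A i) with
     | inl a => emb_leg a | inr p => emb_edge p end) =
  match j return Hom (Emb A : SG) (line_diagram A j) with
  | inl a => emb_leg a | inr p => emb_edge p end.
Proof.
  destruct i as [a|p], j as [b|q]; simpl in u |- *.
  - destruct u as [u|[]]; injection u as <-; now apply gmap_eq.
  - destruct (incident_absurd u).
  - destruct excluded_middle_informative as [->|n]; [now apply gmap_eq|].
    destruct u as [u|[u|u]]; [discriminate|contradiction|subst; now apply gmap_eq].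
  - destruct u as [u|[]]; injection u as <-; now apply gmap_eq.
Qed.

Definition emb_cone (A : list R) : Cone (line_diagram A) :=
  Build_Cone (@emb_cone_natural A).

(** A cone assigns to each point of its apex a strictly increasing map from A to the line, and
    homogeneity of the line makes it the restriction of an automorphism. *)
Lemma emb_cone_limit (A : list R) : is_limit (emb_cone A).
Proof.
  intros c'.
  pose (x := fun (a : pt A) z => (leg c' (inl a) : GMap (apex c') line) z).
  assert (Hx : forall z (a b : pt A), pt_lt a b -> x a z < x b z).
  { intros z a b L.
    pose (p := exist (fun p : pt A * pt A => pt_lt (fst p) (snd p)) (a, b) L : edge (@pt_lt A)).
    pose proof (leg_natural c' (i := inr p) (j := inl a) (or_intror (or_introl eq_refl))) as E1.
    pose proof (leg_natural c' (i := inr p) (j := inl b) (or_intror (or_intror eq_refl))) as E2.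
    simpl in E1, E2.
    destruct excluded_middle_informative as [_|n]; [|now destruct n].
    destruct excluded_middle_informative as [e|_] in E2.
    { exfalso; subst b; exact (pt_lt_irrefl L). }
    unfold x; simpl. rewrite <- E1, <- E2; simpl.
    exact (proj2_sig ((leg c' (inr p) : GMap (apex c') less) z)). }
  assert (Hg : forall z, exists g : autR, forall a, x a z = g (proj1_sig a)).
  { intros z; destruct (@aut_extend_pt A (fun a => x a z)) as [g Hg]; [apply Hx|].
    exists g; intros a; now symmetry. }
  unshelve eexists.
  { exists (fun z => exist (fun f : pt A -> R => exists g : autR, forall a, f a = g (proj1_sig a))
      (fun a => x a z) (Hg z) : Emb A).
    intros g z; apply sig_eq; simpl; apply functional_extensionality; intros a.
    unfold x; now rewrite gfun_equivariant. }
  split.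
  - intros [a|p]; apply gmap_eq; intros z; simpl; [reflexivity|].
    pose proof (leg_natural c' (i := inr p) (j := inl (fst (proj1_sig p)))
                  (or_intror (or_introl eq_refl))) as E1.
    pose proof (leg_natural c' (i := inr p) (j := inl (snd (proj1_sig p)))
                  (or_intror (or_intror eq_refl))) as E2.
    simpl in E1, E2.
    destruct excluded_middle_informative as [_|n]; [|now destruct n].
    destruct excluded_middle_informative as [e|_] in E2.
    { exfalso; destruct p as [[a b] L]; simpl in *; subst; exact (pt_lt_irrefl L). }
    apply sig_eq; simpl; unfold x; simpl in *.
    rewrite <- E1, <- E2; simpl; symmetry; apply surjective_pairing.
  - intros h Hh; apply gmap_eq; intros z; apply sig_eq; simpl.
    apply functional_extensionality; intros a; unfold x; now rewrite <- Hh.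
Qed.

(** A compatible family of points supported by A is a cone with apex [Emb A]. Evaluating the induced
    morphism at [emb_base A] gives the point, so no explicit model of limits in S(G) is required. *)
Lemma limit_point (J : Category) (K : Functor J SG) (c : Cone K) (A : list R)
    (y : forall j, gcar (K j)) :
  is_limit c -> (forall j, supports A (y j)) ->
  (forall i j (u : Hom i j), (fmap K u : GMap _ _) (y i) = y j) ->
  exists x : gcar (apex c), supports A x /\ forall j, (leg c j : GMap _ _) x = y j.
Proof.
  intros Hc Hy Hn.
  assert (N : forall i j (u : Hom i j), fmap K u ∘ orbit_map (Hy i) = orbit_map (Hy j)).
  { intros i j u; apply emb_ext; simpl comp; cbn [gfun gmap_comp comp SG].
    change ((fmap K u : GMap _ _) ((orbit_map (Hy i) : GMap _ _) (emb_base A)) =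
            (orbit_map (Hy j) : GMap _ _) (emb_base A)).
    now rewrite !orbit_map_base. }
  destruct (Hc (Build_Cone N)) as [h [Hh _]].
  exists ((h : GMap (Emb A) _) (emb_base A)); split.
  - apply supports_map, emb_base_supports.
  - intros j; pose proof (f_equal (fun k : GMap (Emb A) _ => k (emb_base A)) (Hh j)) as E.
    simpl in E; etransitivity; [exact E|]; apply (orbit_map_base (Hy j)).
Qed.

Lemma limit_point_unique (J : Category) (K : Functor J SG) (c : Cone K) (A : list R)
    (x x' : gcar (apex c)) :
  is_limit c -> supports A x -> supports A x' ->
  (forall j, (leg c j : GMap _ _) x = (leg c j : GMap _ _) x') -> x = x'.
Proof.
  intros Hc Hx Hx' E.
  assert (N : forall i j (u : Hom i j),
    fmap K u ∘ (leg c i ∘ orbit_map Hx) = leg c j ∘ orbit_map Hx).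
  { intros i j u; now rewrite comp_assoc, leg_natural. }
  destruct (Hc (Build_Cone N)) as [h [_ Hu]].
  rewrite <- (orbit_map_base Hx), <- (orbit_map_base Hx').
  assert (Q : orbit_map Hx = orbit_map Hx'); [|now rewrite Q].
  rewrite <- (Hu (orbit_map Hx)); [apply Hu|]; intros j; [|reflexivity].
  apply emb_ext.
  change ((leg c j : GMap _ _) ((orbit_map Hx' : GMap _ _) (emb_base A)) =
          (leg c j : GMap _ _) ((orbit_map Hx : GMap _ _) (emb_base A))).
  now rewrite !orbit_map_base.
Qed.

(** * Coproducts of G-sets and decomposition into orbits *)

Program Definition sum_gset (I : Type) (HI : Finite I) (X : I -> GSet) : GSet :=
  {| gcar := {i : I & X i}; gact := fun g u => existT _ (projT1 u) (gact g (projT2 u)) |}.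
Next Obligation. intros I HI X [i x]; simpl; now rewrite gact_one. Qed.
Next Obligation. intros I HI X g h [i x]; simpl; now rewrite gact_mul. Qed.
Next Obligation.
  intros I HI X [i x]; apply stabilizer_open with
    (act := fun g (u : {i : I & X i}) => existT X (projT1 u) (gact g (projT2 u))).
  - intros g h [k z]; simpl; now rewrite gact_mul.
  - destruct (supports_exists x) as [A HA]; exists A; intros h Hh; simpl; now rewrite HA.
Qed.
Next Obligation.
  intros I [l Hl] X.
  exists (flat_map (fun i => map (existT X i) (proj1_sig
    (constructive_indefinite_description _ (gact_orbits (X i))))) l).
  intros [i x]; destruct (constructive_indefinite_description _ (gact_orbits (X i)))
    as [m Hm] eqn:Em.
  destruct (Hm x) as [z [Hz [g Hg]]].
  exists (existT _ i z); split.
  - apply in_flat_map; exists i; split; [apply Hl|]; rewrite Em; now apply in_map.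
  - exists g; simpl; now rewrite Hg.
Qed.

(** Comparison of an abstract coproduct with the explicit disjoint union: s gives each point its
    index and its preimage. *)
Lemma coproduct_points (I : Type) (X : I -> SG) (Y : SG) (inj : forall i, Hom (X i) Y) :
  Finite I -> is_coproduct inj ->
  exists s : gcar Y -> {i : I & gcar (X i)},
    (forall y, (inj (projT1 (s y)) : GMap _ _) (projT2 (s y)) = y) /\
    (forall g y, s (gact g y) = existT _ (projT1 (s y)) (gact g (projT2 (s y)))) /\
    (forall i x, s ((inj i : GMap _ _) x) = existT _ i x).
Proof.
  intros HI H.
  destruct (H (sum_gset HI X) (fun i =>
    {| gfun := (fun x => existT _ i x) : X i -> sum_gset HI X;
       gfun_equivariant := fun g x => eq_refl |})) as [s [Hs _]].
  exists (s : GMap _ _); split; [|split].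
  - pose (b := {| gfun := (fun u => (inj (projT1 u) : GMap _ _) (projT2 u)) : sum_gset HI X -> gcar Y;
                  gfun_equivariant := fun g u => gfun_equivariant (inj (projT1 u)) g (projT2 u) |}
               : @Hom SG (sum_gset HI X) Y).
    destruct (H Y inj) as [k [_ Hk]].
    assert (E : b ∘ s = idm Y).
    { rewrite <- (Hk (b ∘ s)), <- (Hk (idm Y)); [reflexivity| |]; intros i.
      - apply comp_id_l.
      - rewrite <- comp_assoc, Hs; now apply gmap_eq. }
    intros y; exact (f_equal (fun m : GMap Y Y => m y) E).
  - intros g y; apply (gfun_equivariant (s : GMap _ _)).
  - intros i x; exact (f_equal (fun m : GMap (X i) _ => m x) (Hs i)).
Qed.

(** A morphism on the summand i is a point b i supported by [supp i]. Since [transport y] is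
    determined on that support, letting it act on b at the orbit of y is well behaved and
    equivariant. *)
Lemma orbit_coproduct (Y : SG) :
  is_coproduct (fun i : orbits Y => orbit_map (@supp_supports Y i)).
Proof.
  intros Z f.
  pose (b := fun i : orbits Y => (f i : GMap _ _) (emb_base (supp i))).
  assert (Hb : forall i, supports (supp i) (b i)).
  { intros i; apply supports_map, emb_base_supports. }
  assert (Eq : forall g y, gact (transport (gact g y)) (b (orb (gact g y))) =
                           gact g (gact (transport y) (b (orb y)))).
  { intros g y; rewrite <- gact_mul, orb_act; apply (gact_agree (Hb (orb y))).
    apply supp_agree; rewrite gact_mul, transport_spec.
    rewrite <- (orb_act y g); apply transport_spec. }
  exists ({| gfun := fun y => gact (transport y) (b (orb y)); gfun_equivariant := Eq |}
          : @Hom SG Y Z).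
  split.
  - intros i; apply emb_ext.
    change (gact (transport ((orbit_map (@supp_supports Y i) : GMap _ _) (emb_base (supp i))))
              (b (orb ((orbit_map (@supp_supports Y i) : GMap _ _) (emb_base (supp i))))) = b i).
    rewrite orbit_map_base, orb_self; rewrite <- (gact_one (b i)) at 2.
    apply (gact_agree (Hb i)); intros a Ha; now apply transport_self.
  - intros h Hh; apply gmap_eq; intros y; simpl.
    pose proof (gfun_equivariant (h : GMap Y Z) (transport y) (proj1_sig (orb y))) as E0.
    rewrite transport_spec in E0; rewrite E0; f_equal.
    unfold b; rewrite <- (Hh (orb y)); simpl.
    pose proof (orbit_map_base (@supp_supports Y (orb y))) as E; simpl in E; now rewrite E.
Qed.

(** * The functor attached to an ordered object *)

(** Density gives room just below the least point satisfying Q; if there is none, a real above all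
    of A will do. *)
Lemma separating_point (A : list R) (P Q : R -> Prop) :
  (forall a b, In a A -> In b A -> P a -> Q b -> a < b) ->
  exists c, forall a, In a A -> (P a -> a < c) /\ (Q a -> c < a).
Proof.
  intros H; destruct (classic (exists a, In a A /\ Q a)) as [HQ|HQ].
  - destruct (least_in_list HQ) as [u [Hu [Qu Lu]]].
    destruct (gap_left A u) as [p [P1 P2]].
    exists ((p + u) / 2); intros a Ha; split; intros H'.
    + specialize (H a u Ha Hu H' Qu); specialize (P2 a Ha); lra.
    + specialize (Lu a Ha H'); lra.
  - assert (B : exists c, forall a, In a A -> a < c).
    { clear H HQ; induction A as [|a A [c Hc]]; [exists 0; intros a []|].
      exists (Rmax a c + 1); pose proof (Rmax_l a c); pose proof (Rmax_r a c).
      intros b [<-|Hb]; [lra|]. specialize (Hc b Hb); lra. }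
    destruct B as [c Hc]; exists c; intros a Ha; split; intros H'; [now apply Hc|].
    exfalso; eauto.
Qed.

(** Embeddings of B into A are carried by automorphisms of the line, so that the same g acts on
    points of G-sets and on charts. *)
Definition moves (g : autR) (B A : list R) : Prop := forall b, In b B -> In (g b) A.

Lemma moves_one (A : list R) : moves aut_one A A.
Proof. intros b Hb; exact Hb. Qed.

Lemma moves_mul (g h : autR) (A B D : list R) :
  moves g B A -> moves h D B -> moves (aut_mul g h) D A.
Proof. intros H1 H2 d Hd; apply H1, H2, Hd. Qed.

Definition move_pt (g : autR) (B A : list R) (H : moves g B A) (b : pt B) : pt A :=
  exist _ (g (proj1_sig b)) (H _ (proj2_sig b)).

Lemma move_one (A : list R) (H : moves aut_one A A) (a : pt A) : move_pt H a = a.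
Proof. now apply sig_eq. Qed.

Section Psi.
Context (S : Category) {HS : lextensive S} (X : @OrderedObject S _ _).

Definition conf (A : list R) : S :=
  projT1 (proj1_sig (constructive_indefinite_description _ (conf_exists X A))).

Definition proj (A : list R) : pt A -> Hom (conf A) X :=
  projT2 (proj1_sig (constructive_indefinite_description _ (conf_exists X A))).

Lemma conf_represents (A : list R) : represents_charts (@proj A).
Proof. exact (proj2_sig (constructive_indefinite_description _ (conf_exists X A))). Qed.

Lemma proj_chart (A : list R) (Z : S) (c : Hom Z (conf A)) : is_chart (fun a => proj a ∘ c).
Proof. apply is_chart_comp, (proj1 (conf_represents A)). Qed.

Definition lift (A : list R) (Z : S) (x : pt A -> Hom Z X) (H : is_chart x) :
  Hom Z (conf A) :=
  proj1_sig (constructive_indefinite_description _ (proj2 (conf_represents A) Z x H)).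

Lemma proj_lift (A : list R) (Z : S) (x : pt A -> Hom Z X) (H : is_chart x) (a : pt A) :
  proj a ∘ lift H = x a.
Proof.
  exact (proj1 (proj2_sig (constructive_indefinite_description _
    (proj2 (conf_represents A) Z x H))) a).
Qed.

Lemma conf_ext (A : list R) (Z : S) (u v : Hom Z (conf A)) :
  (forall a, proj a ∘ u = proj a ∘ v) -> u = v.
Proof.
  intros H; destruct (proj2 (conf_represents A) Z _ (proj_chart v)) as [h [_ Hu]].
  rewrite <- (Hu u), <- (Hu v); auto.
Qed.

Lemma move_chart (g : autR) (B A : list R) (H : moves g B A) :
  is_chart (fun b => proj (move_pt H b)).
Proof. intros a b L; apply (proj1 (conf_represents A)), aut_lt, L. Qed.

Definition res (g : autR) (B A : list R) (H : moves g B A) : Hom (conf A) (conf B) :=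
  lift (move_chart H).

Lemma proj_res (g : autR) (B A : list R) (H : moves g B A) (b : pt B) :
  proj b ∘ res H = proj (move_pt H b).
Proof. exact (proj_lift (move_chart H) b). Qed.

Lemma res_comp (g h : autR) (A B D : list R) (H1 : moves g B A) (H2 : moves h D B) :
  res H2 ∘ res H1 = res (moves_mul H1 H2).
Proof.
  apply conf_ext; intros d; rewrite comp_assoc, !proj_res; f_equal; now apply sig_eq.
Qed.

Lemma res_one (A : list R) (H : moves aut_one A A) : res H = idm (conf A).
Proof. apply conf_ext; intros a; now rewrite proj_res, move_one, comp_id_r. Qed.

(** * Construction of the functor and of its elements *)

Lemma psi_exists (Y : GSet) :
  exists q : {T : S & forall i : orbits Y, Hom (conf (supp i)) T}, is_coproduct (projT2 q).
Proof.
  destruct (@lextensive_coproducts S HS _ (orbits_finite Y) (fun i => conf (supp i)))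
    as [T [inj H]].
  now exists (existT (fun T => forall i : orbits Y, Hom (conf (supp i)) T) T inj).
Qed.

Definition psi (Y : GSet) : S :=
  projT1 (proj1_sig (constructive_indefinite_description _ (psi_exists Y))).

Definition iota (Y : GSet) : forall i : orbits Y, Hom (conf (supp i)) (psi Y) :=
  projT2 (proj1_sig (constructive_indefinite_description _ (psi_exists Y))).

Lemma iota_coproduct (Y : GSet) : is_coproduct (@iota Y).
Proof. exact (proj2_sig (constructive_indefinite_description _ (psi_exists Y))). Qed.

(* The universal case of the morphism defined by a point y supported by A and a
   strictly monotone map c on A: if y = g i with i an orbit representative, it restricts
   c along g : supp i -> A. *)
Definition el (Y : GSet) (A : list R) (y : Y) (H : supports A y) : Hom (conf A) (psi Y) :=
  iota (orb y) ∘ res (transport_supp H).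

Lemma iota_res (Y : GSet) (A : list R) (i k : orbits Y) (g h : autR)
    (H1 : moves g (supp i) A) (H2 : moves h (supp k) A) :
  i = k -> (forall a, In a (supp i) -> g a = h a) -> iota i ∘ res H1 = iota k ∘ res H2.
Proof.
  intros <- E; f_equal; apply conf_ext; intros a; rewrite !proj_res; f_equal.
  apply sig_eq; simpl; apply E, (proj2_sig a).
Qed.

(** The product of g with [transport y], and [transport y'], carry the same representative to y',
    hence agree on its support and restrict charts in the same way. *)
Lemma el_act (Y : GSet) (A B : list R) (y y' : Y) (g : autR)
    (HB : supports B y) (HA : supports A y') (Hg : moves g B A) :
  gact g y = y' -> el HA = el HB ∘ res Hg.
Proof.
  intros <-; unfold el; rewrite <- comp_assoc, res_comp.
  apply iota_res; [apply orb_act|].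
  apply supp_agree; rewrite gact_mul, transport_spec, orb_act; now rewrite transport_spec.
Qed.

Lemma el_eq (Y : GSet) (A : list R) (y y' : Y) (H : supports A y) (H' : supports A y') :
  y = y' -> el H = el H'.
Proof. intros <-; f_equal; apply proof_irrelevance. Qed.

Lemma el_rep (Y : GSet) (i : orbits Y) : el (@supp_supports Y i) = iota i.
Proof.
  unfold el; rewrite <- (comp_id_r (iota i)), <- (res_one (@moves_one (supp i))).
  apply iota_res; [apply orb_self|].
  rewrite orb_self; apply transport_self.
Qed.

Lemma psi_ext (Y : GSet) (T : S) (u v : Hom (psi Y) T) :
  (forall A (y : Y) (H : supports A y), u ∘ el H = v ∘ el H) -> u = v.
Proof.
  intros E; apply (coproduct_ext (@iota_coproduct Y)); intros i.
  rewrite <- el_rep; apply E.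
Qed.

(** With [el_act] and [psi_ext] this makes [psi Y] the colimit of [conf A] over the pairs of a
    finite set A and a point supported by A. Morphisms out of it can then be defined without
    reference to representatives. *)
Lemma psi_desc (Y : GSet) (T : S)
    (tau : forall A (y : Y), supports A y -> Hom (conf A) T) :
  (forall A B (y y' : Y) g (HB : supports B y) (HA : supports A y') (Hg : moves g B A),
     gact g y = y' -> tau A y' HA = tau B y HB ∘ res Hg) ->
  exists h : Hom (psi Y) T, forall A y (H : supports A y), h ∘ el H = tau A y H.
Proof.
  intros Ht.
  destruct (@iota_coproduct Y T (fun i => tau _ _ (@supp_supports Y i))) as [h [Hh _]].
  exists h; intros A y H; unfold el; rewrite comp_assoc, Hh.
  symmetry; apply Ht, transport_spec.
Qed.

Lemma psi_map_exists (Y Y' : GSet) (f : GMap Y Y') :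
  exists h : Hom (psi Y) (psi Y'),
    forall A y (H : supports A y), h ∘ el H = el (supports_map f H).
Proof.
  apply psi_desc; intros; apply el_act; now rewrite <- gfun_equivariant; f_equal.
Qed.

Definition psi_map (Y Y' : GSet) (f : GMap Y Y') : Hom (psi Y) (psi Y') :=
  proj1_sig (constructive_indefinite_description _ (psi_map_exists f)).

Lemma psi_map_el (Y Y' : GSet) (f : GMap Y Y') A y (H : supports A y) (H' : supports A (f y)) :
  psi_map f ∘ el H = el H'.
Proof.
  rewrite (proof_irrelevance _ H' (supports_map f H)).
  exact (proj2_sig (constructive_indefinite_description _ (psi_map_exists f)) A y H).
Qed.

Program Definition Psi : Functor SG S := {| fob := psi; fmap := psi_map |}.
Next Obligation.
  intros Y; apply psi_ext; intros A y H.
  rewrite comp_id_l; exact (@psi_map_el Y Y (gmap_id Y) A y H H).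
Qed.
Next Obligation.
  intros Y Y' Y'' g f; apply psi_ext; intros A y H.
  assert (H' : supports A (f y)) by now apply supports_map.
  assert (H'' : supports A (g (f y))) by now apply supports_map.
  rewrite <- comp_assoc, (psi_map_el H H'), (psi_map_el H' H'').
  exact (@psi_map_el Y Y'' (gmap_comp g f) A y H H'').
Qed.

Lemma psi_local (Y : GSet) (Z : S) (z : Hom Z (psi Y)) :
  locally (fun W w => exists A (y : Y) (H : supports A y) (c : Hom W (conf A)),
    z ∘ w = el H ∘ c).
Proof.
  apply (locally_impl (locally_coproduct z (orbits_finite Y) (@iota_coproduct Y))).
  intros W w [i [a Ha]]; exists (supp i), (proj1_sig i), (@supp_supports Y i), a.
  now rewrite el_rep.
Qed.

(** Distinct summands are disjoint, injections are monic, and a chart on a noninitial object is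
    injective. *)
Lemma iota_res_inj (Y : GSet) (A : list R) (i k : orbits Y) (g h : autR)
    (H1 : moves g (supp i) A) (H2 : moves h (supp k) A) (Z : S) (c : Hom Z (conf A)) :
  ~ is_initial Z -> iota i ∘ res H1 ∘ c = iota k ∘ res H2 ∘ c ->
  i = k /\ forall a, In a (supp i) -> g a = h a.
Proof.
  intros HZ E; rewrite <- !comp_assoc in E.
  destruct (coproduct_disjoint (@iota_coproduct Y) E) as [?|<-]; [contradiction|].
  split; [reflexivity|]; intros a Ha.
  apply (coproduct_inj_mono (@iota_coproduct Y)) in E.
  apply (f_equal (fun k => proj (exist _ a Ha) ∘ k)) in E.
  rewrite !comp_assoc, !proj_res in E.
  apply (chart_inj (proj_chart c) HZ) in E.
  exact (f_equal (@proj1_sig _ _) E).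
Qed.

Lemma el_inj (Y : GSet) (A : list R) (y y' : Y) (H : supports A y) (H' : supports A y')
    (Z : S) (c : Hom Z (conf A)) :
  ~ is_initial Z -> el H ∘ c = el H' ∘ c -> y = y'.
Proof.
  intros HZ E; destruct (iota_res_inj HZ E) as [Eo Ea].
  rewrite <- (transport_spec y), <- (transport_spec y'), <- Eo.
  exact (gact_agree (@supp_supports Y (orb y)) Ea).
Qed.

(** Locally x either equals a value of the chart or lies strictly between consecutive values or
    beyond them; in the latter case a new real in the corresponding gap of A becomes its index. *)
Lemma insert_point (A : list R) (Z : S) (c : Hom Z (conf A)) (x : Hom Z X) :
  locally (fun W w => exists A' (HI : moves aut_one A A') (c' : Hom W (conf A')) (a : pt A'),
    c ∘ w = res HI ∘ c' /\ proj a ∘ c' = x ∘ w).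
Proof.
  (* Comparisons survive restriction, so finitely many can be decided in succession on ever smaller
     pieces. *)
  assert (Cmp : forall l : list (pt A), locally (fun W (w : Hom W Z) => forall a, In a l ->
    lt (proj a ∘ c ∘ w) (x ∘ w) \/ proj a ∘ c ∘ w = x ∘ w \/ lt (x ∘ w) (proj a ∘ c ∘ w))).
  { induction l as [|a l IH]; [apply locally_always; intros W w a []|].
    apply (locally_bind (lt_trichotomy (proj a ∘ c) x)); intros W w Hw.
    clear IH; revert W w Hw; induction l as [|b l IH]; intros W w Hw.
    - apply locally_always; intros V v d [<-|[]]; rewrite !(comp_assoc _ w v).
      destruct Hw as [Hw|[Hw|Hw]]; [left; now apply lt_comp|right; left; now rewrite Hw|].
      right; right; now apply lt_comp.
    - apply (locally_bind (IH W w Hw)); intros V v Hv.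
      apply (locally_impl (lt_trichotomy (proj b ∘ c ∘ (w ∘ v)) (x ∘ (w ∘ v)))).
      intros U u Hu d Hd; rewrite !(comp_assoc w v u), !(comp_assoc _ (w ∘ v) u).
      assert (D : d = b \/ In d (a :: l)) by (simpl in *; intuition).
      destruct D as [->|D]; [assumption|].
      destruct (Hv d D) as [K|[K|K]]; [left; now apply lt_comp|right; left; now rewrite K|].
      right; right; now apply lt_comp. }
  destruct (pt_finite A) as [l Hl].
  apply (locally_bind (Cmp l)); intros W w Hw.
  destruct (classic (is_initial W)) as [HW|HW]; [now apply locally_initial|].
  destruct (classic (exists a, proj a ∘ c ∘ w = x ∘ w)) as [[a Ea]|Hne].
  { apply locally_always; intros V v.
    exists A, (@moves_one A), (c ∘ (w ∘ v)), a; split.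
    - now rewrite res_one, comp_id_l.
    - now rewrite !comp_assoc, Ea. }
  assert (Hcmp : forall a, lt (proj a ∘ c ∘ w) (x ∘ w) \/ lt (x ∘ w) (proj a ∘ c ∘ w)).
  { intros a; destruct (Hw a (Hl a)) as [K|[K|K]]; auto; exfalso; eauto. }
  pose proof (is_chart_comp w (proj_chart c)) as Hch.
  (* r is to sit among the points of A as x sits among the values. That the two sides form a cut of
     A uses that W is not initial. *)
  destruct (@separating_point A
    (fun r => exists H : In r A, lt (proj (exist _ r H) ∘ c ∘ w) (x ∘ w))
    (fun r => exists H : In r A, lt (x ∘ w) (proj (exist _ r H) ∘ c ∘ w))) as [r Hr].
  { intros r1 r2 _ _ [H1 K1] [H2 K2].
    exact (chart_lt (a := exist _ r1 H1) (b := exist _ r2 H2) Hch HW (lt_trans K1 K2)). }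
  assert (Hlt : forall a : pt A, proj1_sig a < r -> lt (proj a ∘ c ∘ w) (x ∘ w)).
  { intros [a Ha] L; simpl in L.
    destruct (Hcmp (exist _ a Ha)) as [K|K]; [assumption|].
    destruct (Hr a Ha) as [_ Q]; assert (r < a) by (apply Q; now exists Ha); lra. }
  assert (Hgt : forall a : pt A, r < proj1_sig a -> lt (x ∘ w) (proj a ∘ c ∘ w)).
  { intros [a Ha] L; simpl in L.
    destruct (Hcmp (exist _ a Ha)) as [K|K]; [|assumption].
    destruct (Hr a Ha) as [Q _]; assert (a < r) by (apply Q; now exists Ha); lra. }
  assert (Hr' : ~ In r A).
  { intros Hin; destruct (Hr r Hin) as [Q1 Q2].
    destruct (Hcmp (exist _ r Hin)) as [K|K].
    - assert (r < r) by (apply Q1; now exists Hin); lra.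
    - assert (r < r) by (apply Q2; now exists Hin); lra. }
  pose (x' := fun a : pt (r :: A) => match excluded_middle_informative (In (proj1_sig a) A) with
    | left H => proj (exist _ (proj1_sig a) H) ∘ c ∘ w | right _ => x ∘ w end).
  assert (Hx' : is_chart x').
  { intros [a Ha] [b Hb] L; unfold pt_lt in L; unfold x'; simpl in *.
    destruct (excluded_middle_informative (In a A)) as [Ia|Na],
             (excluded_middle_informative (In b A)) as [Ib|Nb].
    - now apply Hch.
    - destruct Hb as [<-|?]; [|contradiction]; now apply Hlt.
    - destruct Ha as [<-|?]; [|contradiction]; now apply Hgt.
    - destruct Ha as [<-|?], Hb as [<-|?]; try contradiction; lra. }
  assert (HI : moves aut_one A (r :: A)) by (intros b Hb; now right).
  apply locally_always; intros V v.
  exists (r :: A), HI, (lift Hx' ∘ v), (exist _ r (or_introl eq_refl)); split.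
  - apply conf_ext; intros [a Ha].
    rewrite (comp_assoc _ (res HI)), proj_res, (comp_assoc _ (lift Hx')), proj_lift.
    rewrite !comp_assoc; unfold x'; simpl.
    destruct excluded_middle_informative as [Ia|Na]; [|contradiction].
    now rewrite (proof_irrelevance _ Ia Ha).
  - rewrite comp_assoc, proj_lift; unfold x'; simpl.
    destruct excluded_middle_informative as [Ia|Na]; [contradiction|].
    now rewrite comp_assoc.
Qed.

(** The values of d are inserted into c one after another. A is only enlarged, so the points it
    supports stay as they are, while B is moved into A' by an automorphism. *)
Lemma refine_charts (A B : list R) (Z : S) (c : Hom Z (conf A)) (d : Hom Z (conf B)) :
  locally (fun W w => exists A' (HI : moves aut_one A A') g (Hg : moves g B A')
    (c' : Hom W (conf A')), c ∘ w = res HI ∘ c' /\ d ∘ w = res Hg ∘ c').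
Proof.
  assert (Ins : forall l : list (pt B), locally (fun W (w : Hom W Z) =>
    exists A' (HI : moves aut_one A A') (c' : Hom W (conf A')), c ∘ w = res HI ∘ c' /\
      forall b, In b l -> exists a : pt A', proj a ∘ c' = proj b ∘ d ∘ w)).
  { induction l as [|b l IH].
    - apply locally_always; intros W w; exists A, (@moves_one A), (c ∘ w); split.
      + now rewrite res_one, comp_id_l.
      + intros b [].
    - apply (locally_bind IH); intros W w [A' [HI [c' [E1 E2]]]].
      apply (locally_impl (insert_point c' (proj b ∘ d ∘ w))).
      intros V v [A'' [HI' [c'' [a [E3 E4]]]]].
      assert (HI'' : moves aut_one A A'') by (intros k Hk; apply (HI' k), (HI k Hk)).
      exists A'', HI'', c''; split.
      + rewrite comp_assoc, E1, <- comp_assoc, E3, comp_assoc, res_comp.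
        f_equal; apply conf_ext; intros k; rewrite !proj_res; f_equal; now apply sig_eq.
      + intros b' [<-|Hb']; [exists a; now rewrite E4, comp_assoc|].
        destruct (E2 b' Hb') as [a' Ea']; exists (move_pt HI' a').
        now rewrite <- proj_res, <- comp_assoc, <- E3, comp_assoc, Ea', comp_assoc. }
  destruct (pt_finite B) as [l Hl].
  apply (locally_bind (Ins l)); intros W w [A' [HI [c' [E1 E2]]]].
  destruct (classic (is_initial W)) as [HW|HW]; [now apply locally_initial|].
  pose (phi := fun b => proj1_sig (constructive_indefinite_description _ (E2 b (Hl b)))).
  assert (Hphi : forall b, proj (phi b) ∘ c' = proj b ∘ d ∘ w).
  { intros b; exact (proj2_sig (constructive_indefinite_description _ (E2 b (Hl b)))). }
  clearbody phi.
  (* phi records where each value of d occurs in the refined chart; it is strictly increasing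
     because a chart on a noninitial object reflects the order. *)
  destruct (@aut_extend_pt B (fun b => proj1_sig (phi b))) as [g Hg].
  { intros a b L; apply (chart_lt (proj_chart c') HW); rewrite !Hphi.
    now apply (is_chart_comp w (proj_chart d)). }
  assert (Hm : moves g B A').
  { intros b Hb; pose proof (Hg (exist _ b Hb)) as Eb; simpl in Eb; rewrite Eb.
    exact (proj2_sig (phi _)). }
  apply locally_always; intros V v.
  exists A', HI, g, Hm, (c' ∘ v); split.
  - now rewrite !comp_assoc, E1.
  - apply conf_ext; intros b; rewrite !comp_assoc, <- Hphi, proj_res.
    replace (move_pt Hm b) with (phi b) by (apply sig_eq; simpl; symmetry; apply Hg).
    reflexivity.
Qed.

(** Each element locally has a chart of its own, which is merged with the chart of the previous
    ones; the new point y is replaced by its translate under the automorphism of the refinement. *)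
Lemma common_chart (J : Type) (D : J -> GSet) (Z : S) (z : forall j, Hom Z (psi (D j)))
    (l : list J) :
  locally (fun W w => exists A (c : Hom W (conf A)), forall j, In j l ->
    exists (y : D j) (H : supports A y), z j ∘ w = el H ∘ c).
Proof.
  induction l as [|j l IH].
  - apply locally_always; intros W w.
    (* [conf nil] is terminal: the empty chart exists over every W. *)
    assert (H0 : is_chart (fun a : pt nil => match proj2_sig a with end : Hom W X)).
    { intros [a []]. }
    exists nil, (lift H0); intros j [].
  - apply (locally_bind IH); intros W w [A [c Hc]].
    apply (locally_bind (psi_local (z j ∘ w))); intros V v [B [y [H [d Hd]]]].
    apply (locally_impl (refine_charts (c ∘ v) d)).
    intros U u [A' [HI [g [Hg [c' [E1 E2]]]]]].
    exists A', c'; intros k [<-|Hk].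
    + assert (H' : supports A' (gact g y)).
      { apply supports_incl with (map g B); [|now apply supports_act].
        intros a Ha; apply in_map_iff in Ha; destruct Ha as [b [<- Hb]]; now apply Hg. }
      exists (gact g y), H'.
      rewrite (el_act H H' Hg eq_refl), <- comp_assoc, <- E2, !comp_assoc, <- Hd.
      reflexivity.
    + destruct (Hc k Hk) as [y' [K E]].
      assert (K' : supports A' y') by (apply supports_incl with A; [exact HI|exact K]).
      exists y', K'.
      rewrite (el_act K K' HI (gact_one y')), <- comp_assoc, <- E1, !comp_assoc, <- E.
      reflexivity.
Qed.

Lemma Psi_left_exact : left_exact Psi.
Proof.
  intros J HJ K c Hc c'.
  destruct (proj1 HJ) as [l Hl].
  assert (Ex : exists h : Hom (apex c') (psi (apex c)),
    forall j, fmap Psi (leg c j) ∘ h = leg c' j).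
  { apply locally_lift.
    apply (locally_bind (common_chart (leg c') l)); intros W w [A [d Hd]].
    destruct (classic (is_initial W)) as [HW|HW]; [now apply locally_initial|].
    pose (y := fun j => proj1_sig (constructive_indefinite_description _ (Hd j (Hl j)))).
    assert (Hy : forall j, exists H : supports A (y j), leg c' j ∘ w = el H ∘ d).
    { intros j; exact (proj2_sig (constructive_indefinite_description _ (Hd j (Hl j)))). }
    clearbody y.
    destruct (@limit_point J K c A y Hc) as [x [Hx Ex]].
    { intros j; now destruct (Hy j). }
    (* The cone equation in S becomes an equation between points because the chart d lives on a
       noninitial W. *)
    { intros i j u; destruct (Hy i) as [Hi Ei], (Hy j) as [Hj Ej].
      apply (@el_inj (K j) A _ _ (supports_map (fmap K u : GMap _ _) Hi) Hj W d HW).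
      refine (eq_trans _ (eq_trans (f_equal (fun k => k ∘ w) (leg_natural c' u)) Ej)).
      refine (eq_trans _ (comp_assoc (psi_map (fmap K u)) (leg c' i) w)).
      refine (eq_trans _ (f_equal (fun k => psi_map (fmap K u) ∘ k) (eq_sym Ei))).
      rewrite comp_assoc; f_equal; symmetry; apply (@psi_map_el (K i) (K j)). }
    apply locally_always; intros V v; exists (el Hx ∘ (d ∘ v)); intros j.
    destruct (Hy j) as [Hj Ej].
    refine (eq_trans _ (eq_sym (eq_trans (comp_assoc _ w v) (f_equal (fun k => k ∘ v) Ej)))).
    rewrite !comp_assoc; do 2 f_equal.
    refine (eq_trans (@psi_map_el (apex c) (K j) (leg c j) A x Hx (supports_map _ Hx)) _).
    now apply el_eq. }
  destruct Ex as [h Hh]; exists h; split; [exact Hh|].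
  intros h' Hh'; apply locally_eq.
  (* Uniqueness: on a common chart both lifts are points of the limit, and [el_inj] shows that all
     their legs agree. *)
  apply (locally_bind (common_chart
    (fun b : bool => if b return Hom (apex c') (psi (apex c)) then h else h') (true :: false :: nil))).
  intros W w [A [d Hd]].
  destruct (classic (is_initial W)) as [HW|HW]; [now apply locally_initial|].
  destruct (Hd true) as [y [H1 E1]]; [simpl; auto|].
  destruct (Hd false) as [y' [H2 E2]]; [simpl; auto|].
  apply locally_always; intros V v.
  refine (eq_trans (comp_assoc h w v) (eq_trans _ (eq_sym (comp_assoc h' w v)))).
  refine (f_equal (fun k => k ∘ v) (eq_trans E1 (eq_trans _ (eq_sym E2)))).
  f_equal; apply el_eq.
  apply (limit_point_unique Hc H1 H2); intros j.
  apply (@el_inj (K j) A _ _ (supports_map _ H1) (supports_map _ H2) W d HW).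
  rewrite <- (@psi_map_el (apex c) (K j) (leg c j) A y H1 (supports_map _ H1)).
  rewrite <- (@psi_map_el (apex c) (K j) (leg c j) A y' H2 (supports_map _ H2)).
  rewrite <- !comp_assoc.
  refine (eq_trans (f_equal (comp (psi_map (leg c j))) (eq_sym E1)) _).
  refine (eq_trans _ (f_equal (comp (psi_map (leg c j))) E2)).
  refine (eq_trans (comp_assoc (psi_map (leg c j)) h w) _).
  refine (eq_trans _ (eq_sym (comp_assoc (psi_map (leg c j)) h' w))).
  exact (f_equal (fun k => k ∘ w) (eq_trans (Hh j) (eq_sym (Hh' j)))).
Qed.

(** Every point y of the coproduct comes from one summand, and the prescribed morphism on that
    summand is applied to the preimage of y. [psi_desc] assembles these values because s commutes
    with the action. *)
Lemma Psi_additive : additive Psi.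
Proof.
  intros I HI Y T inj Hinj U f.
  destruct (coproduct_points HI Hinj) as [s [S1 [S2 S3]]].
  (* Equivariance of s: an automorphism fixing y fixes its preimage, so the same set supports
     both. *)
  assert (Hs : forall A y, supports A y -> supports A (projT2 (s y))).
  { intros A y H h Hh; specialize (S2 h y); rewrite (H h Hh) in S2.
    destruct (s y) as [k x]; simpl in *.
    now apply EqdepTheory.inj_pair2 in S2. }
  assert (Ex : exists h : Hom (psi T) U, forall A y (H : supports A y),
    h ∘ el H = f (projT1 (s y)) ∘ el (Hs A y H)).
  { apply (psi_desc (tau := fun A y H => f (projT1 (s y)) ∘ el (Hs A y H))).
    intros A B y y' g HB HA Hg E.
    pose proof (S2 g y) as E2; rewrite E in E2.
    generalize (Hs A y' HA) as K'; generalize (Hs B y HB) as K.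
    rewrite E2; destruct (s y) as [k x]; simpl; intros K K'.
    now rewrite (el_act K K' Hg eq_refl), comp_assoc. }
  destruct Ex as [h Hh]; exists h; split.
  - intros i; apply psi_ext; intros A x H; simpl.
    rewrite <- comp_assoc, (psi_map_el H (supports_map (inj i : GMap _ _) H)), Hh.
    generalize (Hs A _ (supports_map (inj i : GMap _ _) H)).
    rewrite S3; simpl; intros H'; f_equal; now apply el_eq.
  - intros h' Hh'; apply psi_ext; intros A y H; rewrite Hh.
    rewrite <- Hh'; rewrite <- comp_assoc; simpl.
    rewrite (psi_map_el (Hs A y H) (supports_map _ (Hs A y H))).
    f_equal; now apply el_eq.
Qed.
End Psi.

(** * Fullness, faithfulness and essential surjectivity *)

(** The converse direction tests f on the universal comparable pair, the two projections of the
    relation itself. *)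
Lemma monotonicP (S : Category) {HS : lextensive S} (X Y : @OrderedObject S _ _)
    (f : Hom X Y) :
  monotonic X Y f <->
  forall (Z : S) (x y : Hom Z X), lt (X := X) x y -> lt (X := Y) (f ∘ x) (f ∘ y).
Proof.
  rewrite monotonicE; split.
  - intros [e He] Z x y [d Hd]; exists (e ∘ d).
    rewrite comp_assoc, He, <- comp_assoc, Hd; unfold bprod_map.
    now rewrite pairing_comp, <- !comp_assoc, pr1_pairing, pr2_pairing.
  - intros H.
    destruct (H _ (pr1 ∘ sub_arr (ord_rel X)) (pr2 ∘ sub_arr (ord_rel X))) as [e He].
    { apply ltE; exists (idm _); now rewrite !comp_id_r. }
    exists e; rewrite He; unfold bprod_map; now rewrite pairing_comp, !comp_assoc.
Qed.

Lemma represents_ext (S : Category) {HS : lextensive S} (X : @OrderedObject S _ _)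
    (A : list R) (K Z : S) (p : pt A -> Hom K X) (u v : Hom Z K) :
  represents_charts p -> (forall a, p a ∘ u = p a ∘ v) -> u = v.
Proof.
  intros [Hp Hr] E; destruct (Hr Z _ (is_chart_comp v Hp)) as [h [_ Hu]].
  now rewrite <- (Hu u), <- (Hu v).
Qed.

Lemma lt_coproduct (S : Category) {HS : lextensive S} (X : @OrderedObject S _ _)
    (I : Type) (D : I -> S) (T : S) (inj : forall i, Hom (D i) T) (x y : Hom T X) :
  is_coproduct inj -> (forall i, lt (X := X) (x ∘ inj i) (y ∘ inj i)) -> lt (X := X) x y.
Proof.
  intros HT H.
  destruct (HT _ (fun i => proj1_sig (constructive_indefinite_description _ (H i))))
    as [e [He _]].
  exists e; apply (coproduct_ext HT); intros i.
  rewrite <- comp_assoc, He, pairing_comp.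
  exact (proj2_sig (constructive_indefinite_description _ (H i))).
Qed.

Section Evaluation.
Context (S : Category) {HS : lextensive S}.

Lemma lt_eval (F : LEx SG S) (Z : S) (x y : Hom Z (proj1_sig F line)) :
  lt (X := eval_line_ob F) x y <->
  exists e : Hom Z (proj1_sig F less),
    fmap (proj1_sig F) less_fst ∘ e = x /\ fmap (proj1_sig F) less_snd ∘ e = y.
Proof.
  rewrite ltE; simpl; unfold square_map, less_fst, less_snd.
  rewrite !(comp_assoc _ (pairing _ _)), pr1_pairing, pr2_pairing, !fmap_comp.
  reflexivity.
Qed.

(** Left exactness transports [emb_cone_limit]; the two coordinates remain jointly monic because the
    image of [less] is a subobject of the square. *)
Lemma emb_represents (F : LEx SG S) (A : list R) :
  represents_charts (X := eval_line_ob F) (A := A) (K := proj1_sig F (Emb A))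
    (fun a => fmap (proj1_sig F) (emb_leg a)).
Proof.
  split.
  - intros a b L; apply lt_eval.
    exists (fmap (proj1_sig F) (emb_edge
      (exist (fun p : pt A * pt A => pt_lt (fst p) (snd p)) (a, b) L))).
    split; rewrite <- fmap_comp; f_equal; now apply gmap_eq.
  - intros Z x Hx.
    apply (@graph_limit _ _ (@pt_lt_irrefl A) SG line less less_fst less_snd S
             (proj1_sig F) (map_cone (proj1_sig F) (emb_cone A)) Z x).
    + intros a b E1 E2; apply (@edge_ext S HS (eval_line_ob F)); simpl;
      unfold square_map; rewrite !comp_assoc, ?pr1_pairing, ?pr2_pairing, <- fmap_comp;
      assumption.
    + apply (proj2 (proj2_sig F)); [|apply emb_cone_limit].
      apply graph_finite, pt_finite.
    + intros i j L; now apply lt_eval, Hx.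
Qed.

(** Agreement spreads from the line to [Emb A], whose legs to the line are jointly monic under G,
    and then to Y, whose orbit maps are jointly epic under F. *)
Lemma eval_line_faithful (F G : LEx SG S) (s t : Hom F G) :
  fmap (eval_line (S := S)) s = fmap (eval_line (S := S)) t -> s = t.
Proof.
  intros E; apply (f_equal (@proj1_sig _ _)) in E; simpl in E.
  apply nat_trans_eq; intros Y.
  assert (EA : forall A, nt s (Emb A) = nt t (Emb A)).
  { intros A; apply (represents_ext (emb_represents G A)); intros a.
    pose proof (nt_natural s (emb_leg a)) as Ns; pose proof (nt_natural t (emb_leg a)) as Nt.
    simpl in *; now rewrite <- Ns, <- Nt, E. }
  apply (coproduct_ext (proj1 (proj2_sig F) _ (orbits_finite Y) _ _ _ (@orbit_coproduct Y))).
  intros i.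
  pose proof (nt_natural s (orbit_map (@supp_supports Y i))) as Ns.
  pose proof (nt_natural t (orbit_map (@supp_supports Y i))) as Nt.
  simpl in *; now rewrite Ns, Nt, EA.
Qed.

Lemma line_support (A : list R) (y : line) : supports A y -> In y A.
Proof.
  intros H; apply (@fixes_incl A (y :: nil)); [|now left].
  intros h Hh b [<-|[]]; now apply H.
Qed.

Lemma emb_leg_orbit_map (A : list R) (a : pt A) (H : supports A (proj1_sig a : line)) :
  emb_leg a = orbit_map H.
Proof. apply emb_ext; now rewrite orbit_map_base. Qed.

(** * Extension of a monotonic morphism to a natural transformation *)

Section Full.
Context (F G : LEx SG S) (m : Hom (proj1_sig F line) (proj1_sig G line)).
Context (Hm : monotonic (eval_line_ob F) (eval_line_ob G) m).

Lemma emb_map_exists (A : list R) :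
  exists h : Hom (proj1_sig F (Emb A)) (proj1_sig G (Emb A)),
    forall a : pt A, fmap (proj1_sig G) (emb_leg a) ∘ h = m ∘ fmap (proj1_sig F) (emb_leg a).
Proof.
  destruct (proj2 (emb_represents G A) _ (fun a => m ∘ fmap (proj1_sig F) (emb_leg a)))
    as [h [Hh _]]; [|now exists h].
  intros a b L; apply (proj1 (@monotonicP S HS (eval_line_ob F) (eval_line_ob G) m) Hm);
  now apply (proj1 (emb_represents F A)).
Qed.

Definition emb_map (A : list R) : Hom (proj1_sig F (Emb A)) (proj1_sig G (Emb A)) :=
  proj1_sig (constructive_indefinite_description _ (emb_map_exists A)).

Lemma emb_map_leg (A : list R) (a : pt A) :
  fmap (proj1_sig G) (emb_leg a) ∘ emb_map A = m ∘ fmap (proj1_sig F) (emb_leg a).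
Proof. exact (proj2_sig (constructive_indefinite_description _ (emb_map_exists A)) a). Qed.

Lemma emb_map_natural (g : autR) (B A : list R) (H : moves g B A) :
  emb_map B ∘ fmap (proj1_sig F) (orbit_map (in_conj_support H)) =
  fmap (proj1_sig G) (orbit_map (in_conj_support H)) ∘ emb_map A.
Proof.
  assert (E : forall b, emb_leg b ∘ orbit_map (in_conj_support H) = emb_leg (move_pt H b)).
  { intros b; apply emb_ext.
    change (proj1_sig ((orbit_map (in_conj_support H) : GMap _ _) (emb_base A)) b =
            g (proj1_sig b)).
    now rewrite orbit_map_base. }
  apply (represents_ext (emb_represents G B)); intros b.
  cbn [ord_car eval_line_ob]; rewrite !comp_assoc, emb_map_leg, <- comp_assoc, <- fmap_comp, E.
  now rewrite <- fmap_comp, E, emb_map_leg.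
Qed.

(** h is prescribed only at the representatives. Any orbit map factors through one of these followed
    by a restriction of embeddings, to which [emb_map_natural] applies; having all orbit maps at
    hand makes naturality in Y easy. *)
Lemma extension_exists (Y : SG) :
  exists h : Hom (proj1_sig F Y) (proj1_sig G Y),
    forall A y (H : supports A y),
      h ∘ fmap (proj1_sig F) (orbit_map H) = fmap (proj1_sig G) (orbit_map H) ∘ emb_map A.
Proof.
  destruct (proj1 (proj2_sig F) _ (orbits_finite Y) _ _ _ (@orbit_coproduct Y) _
    (fun i => fmap (proj1_sig G) (orbit_map (@supp_supports Y i)) ∘ emb_map (supp i)))
    as [h [Hh _]].
  exists h; intros A y H.
  assert (E : orbit_map H = orbit_map (@supp_supports Y (orb y)) ∘
                            orbit_map (in_conj_support (transport_supp H))).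
  { apply emb_ext; rewrite orbit_map_base.
    change (y = (orbit_map (@supp_supports Y (orb y)) : GMap _ _)
      ((orbit_map (in_conj_support (transport_supp H)) : GMap _ _) (emb_base A))).
    rewrite orbit_map_base, orbit_map_act; symmetry; apply transport_spec. }
  rewrite E, !fmap_comp, comp_assoc, Hh, <- !comp_assoc.
  f_equal; apply emb_map_natural.
Qed.

Definition extension (Y : SG) : Hom (proj1_sig F Y) (proj1_sig G Y) :=
  proj1_sig (constructive_indefinite_description _ (extension_exists Y)).

Lemma extension_orbit (Y : SG) A (y : gcar Y) (H : supports A y) :
  extension Y ∘ fmap (proj1_sig F) (orbit_map H) =
  fmap (proj1_sig G) (orbit_map H) ∘ emb_map A.
Proof.
  exact (proj2_sig (constructive_indefinite_description _ (extension_exists Y)) A y H).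
Qed.

Lemma extension_ext (Y : SG) (T : S) (u v : Hom (proj1_sig F Y) T) :
  (forall A (y : gcar Y) (H : supports A y),
     u ∘ fmap (proj1_sig F) (orbit_map H) = v ∘ fmap (proj1_sig F) (orbit_map H)) -> u = v.
Proof.
  intros E.
  apply (coproduct_ext (proj1 (proj2_sig F) _ (orbits_finite Y) _ _ _ (@orbit_coproduct Y))).
  intros i; apply E.
Qed.

Lemma extension_natural (Y Y' : SG) (f : Hom Y Y') :
  extension Y' ∘ fmap (proj1_sig F) f = fmap (proj1_sig G) f ∘ extension Y.
Proof.
  apply extension_ext; intros A y H.
  assert (E : f ∘ orbit_map H = orbit_map (supports_map (f : GMap _ _) H)).
  { apply emb_ext; rewrite orbit_map_base.
    change ((f : GMap _ _) ((orbit_map H : GMap _ _) (emb_base A)) = (f : GMap _ _) y).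
    now rewrite orbit_map_base. }
  rewrite <- !comp_assoc, extension_orbit, <- fmap_comp, E, extension_orbit.
  now rewrite <- E, fmap_comp, comp_assoc.
Qed.

Lemma extension_line : extension line = m.
Proof.
  apply extension_ext; intros A y H.
  rewrite extension_orbit.
  replace (orbit_map H) with (emb_leg (exist _ y (line_support H)))
    by exact (@emb_leg_orbit_map A (exist _ y (line_support H)) H).
  apply emb_map_leg.
Qed.
End Full.

Lemma eval_line_full (F G : LEx SG S) (m : Hom (eval_line (S := S) F) (eval_line (S := S) G)) :
  exists s : Hom F G, fmap (eval_line (S := S)) s = m.
Proof.
  destruct m as [m Hm].
  exists {| nt := extension Hm; nt_natural := extension_natural Hm |}.
  apply sig_eq; exact (extension_line Hm).
Qed.

(** * The counit between the value of the constructed functor at the line and X *)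

Section Surjective.
Context (X : @OrderedObject S _ _).

Definition psi_lex : LEx SG S :=
  exist _ (Psi X) (conj (@Psi_additive S HS X) (@Psi_left_exact S HS X)).

(** A point of the line supported by A belongs to A, and the counit evaluates the chart there. *)
Lemma counit_exists :
  exists h : Hom (psi X line) X, forall A y (H : supports A y),
    h ∘ el X H = proj X (exist _ y (line_support H)).
Proof.
  apply (psi_desc (tau := fun A (y : line) (H : supports A y) =>
                            proj X (exist _ y (line_support H)))).
  intros A B y y' g HB HA Hg E; rewrite proj_res; f_equal; apply sig_eq; simpl.
  symmetry; exact E.
Qed.

Lemma origin_supports : supports (0 :: nil) (0 : line).
Proof. intros h Hh; apply Hh; now left. Qed.

Lemma origin_chart : is_chart (X := X) (fun _ : pt (0 :: nil) => idm X).
Proof.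
  intros [a Ha] [b Hb] L; unfold pt_lt in L; simpl in *.
  destruct Ha as [<-|[]], Hb as [<-|[]]; lra.
Qed.

(** The inverse regards an element x of X as the chart sending 0 to x, taken at the point 0. The
    origin is an arbitrary base point, since the line is a single orbit. *)
Lemma counit_inverse (h : Hom (psi X line) X) :
  (forall A y (H : supports A y), h ∘ el X H = proj X (exist _ y (line_support H))) ->
  h ∘ (el X origin_supports ∘ lift origin_chart) = idm X /\
  (el X origin_supports ∘ lift origin_chart) ∘ h = idm (psi X line).
Proof.
  intros Hh; split.
  - rewrite comp_assoc, Hh; apply proj_lift.
  - apply psi_ext; intros A y H; rewrite <- comp_assoc, Hh, comp_id_l.
    (* Only the value y at 0 matters; the other two values merely have to increase. *)
    destruct (@aut_three y (y + 1) (y + 2)) as [g [Hg _]]; [lra|lra|].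
    assert (Hm : moves g (0 :: nil) A).
    { intros b [<-|[]]; rewrite Hg; now apply line_support. }
    rewrite (el_act X origin_supports H Hm Hg), <- comp_assoc; f_equal.
    apply conf_ext; intros [a Ha]; rewrite comp_assoc, proj_lift, comp_id_l, proj_res.
    f_equal; apply sig_eq; simpl; destruct Ha as [<-|[]]; now symmetry.
Qed.

(** It suffices to look at the summands of the value at [less]: there the counit evaluates a chart
    at the two entries of a pair a < b, and charts preserve the order. *)
Lemma counit_monotonic (h : Hom (psi X line) X) :
  (forall A y (H : supports A y), h ∘ el X H = proj X (exist _ y (line_support H))) ->
  monotonic (eval_line_ob psi_lex) X h.
Proof.
  intros Hh; apply monotonicP; intros Z x y H; apply lt_eval in H.
  destruct H as [e [<- <-]]; simpl; rewrite !comp_assoc; apply lt_comp.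
  apply (lt_coproduct (@iota_coproduct S HS X less)); intros i.
  rewrite <- el_rep, <- !comp_assoc.
  pose proof (@supp_supports less i) as H.
  rewrite (@psi_map_el S HS X less line less_fst _ _ _ (supports_map (less_fst : GMap _ _) H)).
  rewrite (@psi_map_el S HS X less line less_snd _ _ _ (supports_map (less_snd : GMap _ _) H)).
  rewrite !Hh; apply (proj1 (conf_represents X (supp i))).
  exact (proj2_sig (proj1_sig i)).
Qed.

Lemma unit_interval_supports :
  supports (0 :: 1 :: nil) (exist (fun p : R * R => fst p < snd p) (0, 1) Rlt_0_1 : less).
Proof. intros h Hh; apply sig_eq; simpl; f_equal; apply Hh; simpl; auto. Qed.

(** An isomorphism of ordered objects needs a monotonic inverse. A pair x < y in X is a chart on {0,
    1}, and with the point (0, 1) of [less] it defines the required element. *)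
Lemma counit_inverse_monotonic :
  monotonic X (eval_line_ob psi_lex) (el X origin_supports ∘ lift origin_chart).
Proof.
  apply monotonicP; intros Z x y H; apply lt_eval.
  pose (c := fun a : pt (0 :: 1 :: nil) => if Req_dec_T (proj1_sig a) 0 then x else y).
  assert (Hc : is_chart (X := X) c).
  { intros [a Ha] [b Hb] L; unfold pt_lt in L; unfold c; simpl in *.
    destruct Ha as [<-|[<-|[]]], Hb as [<-|[<-|[]]]; try (exfalso; lra).
    destruct Req_dec_T; [|lra]; destruct Req_dec_T; [lra|assumption]. }
  (* g carries the base point 0 to 1, so that it selects the second entry of the chart; the identity
     selects the first. *)
  destruct (@aut_three 1 2 3) as [g [Hg _]]; [lra|lra|].
  assert (M0 : moves aut_one (0 :: nil) (0 :: 1 :: nil)).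
  { intros b [<-|[]]; simpl; auto. }
  assert (M1 : moves g (0 :: nil) (0 :: 1 :: nil)).
  { intros b [<-|[]]; rewrite Hg; simpl; auto. }
  pose proof unit_interval_supports as Hs.
  exists (el X Hs ∘ lift Hc); simpl; rewrite !comp_assoc; split.
  - rewrite (@psi_map_el S HS X less line less_fst _ _ _ (supports_map (less_fst : GMap _ _) Hs)).
    rewrite (el_act X origin_supports _ M0 eq_refl), <- !comp_assoc; f_equal.
    apply conf_ext; intros [a Ha]; rewrite !comp_assoc, proj_lift, comp_id_l, proj_res, proj_lift.
    unfold c; simpl; destruct Ha as [<-|[]]; destruct Req_dec_T; [reflexivity|lra].
  - rewrite (@psi_map_el S HS X less line less_snd _ _ _ (supports_map (less_snd : GMap _ _) Hs)).
    rewrite (el_act X origin_supports _ M1 Hg), <- !comp_assoc; f_equal.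
    apply conf_ext; intros [a Ha]; rewrite !comp_assoc, proj_lift, comp_id_l, proj_res, proj_lift.
    unfold c; simpl; destruct Ha as [<-|[]]; rewrite Hg; destruct Req_dec_T; [lra|reflexivity].
Qed.
End Surjective.
End Evaluation.

Theorem theorem6p7 (S : Category) (HS : lextensive S) :
  is_equivalence (@eval_line S HS).
Proof.
  apply equivalence_criterion.
  - exact (@eval_line_full S HS).
  - exact (@eval_line_faithful S HS).
  - intros X; destruct (counit_exists X) as [h Hh].
    destruct (counit_inverse Hh) as [E1 E2].
    exists (psi_lex X).
    exists (exist (monotonic (eval_line_ob (psi_lex X)) X) h (counit_monotonic Hh)).
    exists (exist (monotonic X (eval_line_ob (psi_lex X))) _ (@counit_inverse_monotonic S HS X)).
    split; now apply sig_eq.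
Qed.
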